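(* Let $G$ be a locally compact group, $S\subset G$ a closed submonoid and $(\Omega;\varphi)$ a topological $G$-dynamical system. Then the assignments $$(E;\Phi)\mapsto(\Gamma_0(E);\mathcal{T}_\Phi),\qquad \Theta\mapsto V_\Theta$$ define an essentially surjective, fully faithful functor from the category of $S$-dynamical topological Banach bundles over $(\Omega;\varphi)$ to the category of $S$-dynamical AM-modules over $(\mathrm{C}_0(\Omega);T_\varphi)$.
   Context: Conventions. All vector spaces are over a fixed field $\mathbb{K}\in\{\mathbb{R},\mathbb{C}\}$; locally compact spaces are Hausdorff; $\mathscr{L}(X,Y)$ is the space of bounded linear maps; $\mathrm{C}_0(\Omega)$ is the algebra of continuous $\mathbb{K}$-valued functions on $\Omega$ vanishing at infinity, $\mathrm{C}_0(\Omega)_+$ its non-negative elements. Topological $G$-dynamical system $(\Omega;\varphi)$: $\Omega$ is a locally compact space and the locally compact group $G$ acts on $\Omega$ via a continuous map $\varphi\colon G\times\Omega\to\Omega$, $(g,x)\mapsto\varphi_g(x)=gx$. A closed submonoid $S\subset G$ is a closed subsemigroup containing the neutral element. Banach bundle over $\Omega$: a pair $(E,p_E)$ of a topological space $E$ and a continuous, open, surjective map $p_E\colon E\to\Omega$ such that (i) each fiber $E_x=p_E^{-1}(x)$ is a Banach space; (ii) addition $E\times_\Omega E\to E$ (with $E\times_\Omega E=\bigcup_{x}E_x\times E_x\subset E\times E$ carrying the subspace topology) and scalar multiplication $\mathbb{K}\times E\to E$ are continuous; (iii) $E\to\mathbb{R}_{\ge0}$, $v\mapsto\|v\|_{E_{p_E(v)}}$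 is upper semicontinuous; (iv) for each $x\in\Omega$ and each open $W\subset E$ containing the zero $0_x\in E_x$ there are $\varepsilon>0$ and an open neighborhood $U$ of $x$ with $\{v\in p_E^{-1}(U):\|v\|\le\varepsilon\}\subset W$. Banach bundle morphism from $E$ to $F$ over a continuous $\psi\colon\Omega\to\Omega$: a continuous map $\Phi\colon E\to F$ with $p_F\circ\Phi=\psi\circ p_E$, $\Phi|_{E_x}\in\mathscr{L}(E_x,F_{\psi(x)})$ for all $x$, and $\|\Phi\|:=\sup_{x}\|\Phi|_{E_x}\|<\infty$. For $\psi=\mathrm{id}_\Omega$ it is called a Banach bundle morphism. $S$-dynamical (topological) Banach bundle over $(\Omega;\varphi)$: a pair $(E;\Phi)$ of a Banach bundle $E$ over $\Omega$ and a monoid homomorphism $\Phi\colon S\to E^E$, $g\mapsto\Phi_g$ (composition on $E^E$), such that each $\Phi_g$ is a Banach bundle morphism over $\varphi_g$, the map $S\times E\to E$, $(g,v)\mapsto\Phi_gv$ is continuous, and $\sup_{g\in L}\|\Phi_g\|<\infty$ for every compact $L\subset S$. A morphism $(E;\Phi)\to(F;\Psi)$ is a Banach bundle morphism $\Theta\colon E\to F$ (over $\mathrm{id}_\Omega$) with $\Theta\circ\Phi_g=\Psi_g\circ\Theta$ for all $g\in S$. $\Gamma_0(E)$ is the space of continuous sections $s\colon\Omega\to E$ ($p_E\circ s=\mathrm{id}_\Omega$) such that for every $\varepsilon>0$ there is a compact $L\subset\Omega$ with $\|s(x)\|\le\varepsilon$ for $x\notin L$, with norm $\|s\|=\sup_x\|s(x)\|$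 and module operation $(fs)(x)=f(x)s(x)$ for $f\in\mathrm{C}_0(\Omega)$. Banach module over a commutative Banach algebra $A$: a Banach space $\Gamma$ that is an $A$-module with $\|fs\|\le\|f\|\|s\|$; always assumed non-degenerate, i.e. $\Gamma=\overline{\mathrm{lin}}\{fs: f\in A,s\in\Gamma\}$. A homomorphism of Banach modules is a bounded $A$-linear operator. For an algebra homomorphism $T\in\mathscr{L}(A)$, an operator $\mathcal{T}\in\mathscr{L}(\Gamma,\Lambda)$ is a $T$-homomorphism if $\mathcal{T}(fs)=Tf\cdot\mathcal{T}s$ for all $f\in A$, $s\in\Gamma$. $S$-dynamical Banach module over $(A;T)$, where $T\colon G\to\mathscr{L}(A)$ is a strongly continuous representation of $G$ by algebra automorphisms: a pair $(\Gamma;\mathcal{T})$ of a Banach module $\Gamma$ over $A$ and a monoid homomorphism $\mathcal{T}\colon S\to\mathscr{L}(\Gamma)$ such that $\mathcal{T}(g)$ is a $T(g)$-homomorphism for each $g\in S$ and $g\mapsto\mathcal{T}(g)s$ is continuous for every $s\in\Gamma$. A homomorphism $(\Gamma;\mathcal{T})\to(\Lambda;\mathcal{S})$ is a homomorphism $V\in\mathscr{L}(\Gamma,\Lambda)$ of Banach modules with $V\mathcal{T}(g)=\mathcal{S}(g)V$ for all $g\in S$. AM-module over $\mathrm{C}_0(\Omega)$: a Banach module $\Gamma$ over $\mathrm{C}_0(\Omega)$ such that for each $s\in\Gamma$ the submodule $\Gamma_s=\overline{\mathrm{C}_0(\Omega)s}$, which is a Banach lattice with positive cone $\overline{\mathrm{C}_0(\Omega)_+s}$,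 is an AM-space; equivalently $\max(\|f_1s\|,\|f_2s\|)=\|(f_1\vee f_2)s\|$ for all $f_1,f_2\in\mathrm{C}_0(\Omega)_+$, $s\in\Gamma$. An $S$-dynamical AM-module is an $S$-dynamical Banach module $(\Gamma;\mathcal{T})$ with $\Gamma$ an AM-module; morphisms are homomorphisms of $S$-dynamical Banach modules. Koopman representations: $T_\varphi(g)f=f\circ\varphi_g^{-1}$ for $f\in\mathrm{C}_0(\Omega)$, $g\in G$; $\mathcal{T}_\Phi(g)s=\Phi_g\circ s\circ\varphi_g^{-1}$ for $s\in\Gamma_0(E)$, $g\in S$; $V_\Theta s=\Theta\circ s$ for $s\in\Gamma_0(E)$. *)

(* Defs.v *)
From HB Require Import structures.
From mathcomp Require Import all_boot all_order all_algebra.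
From mathcomp Require Import all_classical all_reals all_analysis.
From mathcomp Require Import complex.

Set Implicit Arguments.
Unset Strict Implicit.
Unset Printing Implicit Defensive.

Import Order.TTheory GRing.Theory Num.Theory.
Import numFieldNormedType.Exports.

Local Open Scope classical_set_scope.
Local Open Scope ring_scope.

Variant scalar_kind := RealScalars | ComplexScalars.

Definition scalar_field (R : realType) (k : scalar_kind) : numFieldType :=
  match k with RealScalars => R | ComplexScalars => R[i] end.

(* The library norm of a normed module over K takes its values in K, also for
   K = C; [toR] and [ofR] move between such values and the reals, where suprema
   exist. *)
Definition toR (R : realType) (k : scalar_kind) : scalar_field R k -> R :=
  match k return scalar_field R k -> R with
  | RealScalars => fun a => a
  | ComplexScalars => @complex.Re R
  end.

Definition ofR (R : realType) (k : scalar_kind) : R -> scalar_field R k :=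
  match k return R -> scalar_field R k with
  | RealScalars => fun a => a
  | ComplexScalars => fun a => a%:C%C
  end.

Section scalar_lemmas.
Context (R : realType) (k : scalar_kind).
Local Notation K := (scalar_field R k).
Local Notation toR := (@toR R k).
Local Notation ofR := (@ofR R k).

Lemma le_ofR (a b : R) : (ofR a <= ofR b) = (a <= b).
Proof. by case: k => //=; rewrite lecR. Qed.

Lemma ofR0 : ofR 0 = 0. Proof. by case: k. Qed.

Lemma ofRD (a b : R) : ofR (a + b) = ofR a + ofR b.
Proof. by case: k => //=; rewrite rmorphD. Qed.

Lemma ofRM (a b : R) : ofR (a * b) = ofR a * ofR b.
Proof. by case: k => //=; rewrite rmorphM. Qed.

Lemma ofRn (n : nat) : ofR n%:R = n%:R.
Proof. by case: k => //=; rewrite rmorph_nat. Qed.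

Lemma toRK (a : K) : 0 <= a -> ofR (toR a) = a.
Proof. by rewrite /K; case: k a => //= a a0; rewrite RRe_real// ger0_real. Qed.

Lemma ofRK (a : R) : toR (ofR a) = a.
Proof. by case: k. Qed.

Lemma le_toR (a b : K) : a <= b -> toR a <= toR b.
Proof. by rewrite /K; case: k a b => //= a b; rewrite lecE => /andP[]. Qed.

Lemma scalar_archi (a : K) : 0 <= a -> exists n : nat, a < n%:R.
Proof.
move=> a0; exists (Num.Def.archi_bound (toR a)).
have lt : toR a < (Num.Def.archi_bound (toR a))%:R.
  by apply: archi_boundP; have := le_toR a0; rewrite -ofR0 ofRK.
rewrite -[ltLHS](toRK a0) -ofRn lt_neqAle le_ofR (ltW lt) andbT.
apply/eqP => /(congr1 toR); rewrite !ofRK => h.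
by move: lt; rewrite -h ltxx.
Qed.

End scalar_lemmas.

Section bounded_sections.
Context (R : realType) (k : scalar_kind) (X : Type).
Local Notation K := (scalar_field R k).
Context (V : X -> normedModType K).

Record bounded_submodule := BoundedSubmodule {
  bs_mem :> (forall x, V x) -> Prop ;
  bs_mem0 : bs_mem (fun x => 0) ;
  bs_memP : forall (a : K) (s t : forall x, V x),
    bs_mem s -> bs_mem t -> bs_mem (fun x => a *: s x + t x) ;
  bs_bounded : forall s, bs_mem s -> exists M : K, forall x, `|s x| <= M
}.

Record sections (P : bounded_submodule) := MkSection {
  sec :> forall x, V x ;
  sec_mem : P sec
}.

Context (P : bounded_submodule).
Implicit Types s t : sections P.

Lemma sections_ext s t : (forall x, s x = t x) -> s = t.
Proof.
case: s t => [s ps] [t pt] /= st.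
have e : s = t by apply: functional_extensionality_dep.
by rewrite e in ps *; congr MkSection; exact: Prop_irrelevance.
Qed.

HB.instance Definition _ := gen_eqMixin (sections P).
HB.instance Definition _ := gen_choiceMixin (sections P).

Lemma bs_memD s t : P (fun x => s x + t x).
Proof.
have := bs_memP 1 (sec_mem s) (sec_mem t).
by congr (P _); apply: functional_extensionality_dep => x; rewrite scale1r.
Qed.

Lemma bs_memZ (a : K) s : P (fun x => a *: s x).
Proof.
have := bs_memP a (sec_mem s) (bs_mem0 P).
by congr (P _); apply: functional_extensionality_dep => x; rewrite addr0.
Qed.

Lemma bs_memN s : P (fun x => - s x).
Proof.
have := bs_memZ (-1) s.
by congr (P _); apply: functional_extensionality_dep => x; rewrite scaleN1r.
Qed.

Definition sec0 : sections P := MkSection (bs_mem0 P).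
Definition secD s t : sections P := MkSection (bs_memD s t).
Definition secN s : sections P := MkSection (bs_memN s).
Definition secZ (a : K) s : sections P := MkSection (bs_memZ a s).

Lemma secDA : associative secD.
Proof. by move=> s t u; apply: sections_ext => x /=; rewrite addrA. Qed.
Lemma secDC : commutative secD.
Proof. by move=> s t; apply: sections_ext => x /=; rewrite addrC. Qed.
Lemma sec0D : left_id sec0 secD.
Proof. by move=> s; apply: sections_ext => x /=; rewrite add0r. Qed.
Lemma secND : left_inverse sec0 secN secD.
Proof. by move=> s; apply: sections_ext => x /=; rewrite addNr. Qed.

HB.instance Definition _ :=
  GRing.isZmodule.Build (sections P) secDA secDC sec0D secND.

Lemma secZA a b s : secZ a (secZ b s) = secZ (a * b) s.
Proof. by apply: sections_ext => x /=; rewrite scalerA. Qed.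
Lemma secZ1 : left_id 1 secZ.
Proof. by move=> s; apply: sections_ext => x /=; rewrite scale1r. Qed.
Lemma secZDr : right_distributive secZ +%R.
Proof. by move=> a s t; apply: sections_ext => x /=; rewrite scalerDr. Qed.
Lemma secZDl s : {morph secZ^~ s : a b / a + b}.
Proof. by move=> a b; apply: sections_ext => x /=; rewrite scalerDl. Qed.

HB.instance Definition _ :=
  GRing.Zmodule_isLmodule.Build K (sections P) secZA secZ1 secZDr secZDl.

Definition sup_norm s : K := ofR k (sup [set toR `|s x| | x in [set: X]]).

Lemma sup_norm_ubound s : has_ubound [set toR `|s x| | x in [set: X]].
Proof.
have [M hM] := bs_bounded (sec_mem s).
by exists (toR M) => _ [x _ <-]; exact/le_toR/hM.
Qed.

Lemma sup_norm_ge s x : `|s x| <= sup_norm s.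
Proof.
rewrite -[leLHS]toRK// /sup_norm le_ofR.
by apply: (ub_le_sup (sup_norm_ubound s)); exists x.
Qed.

Lemma sup_norm_le s (M : K) : 0 <= M -> (forall x, `|s x| <= M) ->
  sup_norm s <= M.
Proof.
move=> M0 hM; rewrite -[leRHS]toRK// /sup_norm le_ofR.
have [e|/set0P ne] := eqVneq [set toR `|s x| | x in [set: X]] set0.
  by rewrite e sup0; have := le_toR M0; rewrite -{1}(ofR0 R k) ofRK.
by apply: ge_sup => // _ [x _ <-]; exact/le_toR/hM.
Qed.

Lemma sup_norm_ge0 s : 0 <= sup_norm s.
Proof.
rewrite /sup_norm -(ofR0 R k) le_ofR.
have [e|/set0P [_ [x _ _]]] := eqVneq [set toR `|s x| | x in [set: X]] set0.
  by rewrite e sup0.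
rewrite -(le_ofR k) ofR0; apply: le_trans (sup_norm_ge s x); exact: normr_ge0.
Qed.

Lemma sup_normD s t : sup_norm (s + t) <= sup_norm s + sup_norm t.
Proof.
apply: sup_norm_le => [|x]; first by rewrite addr_ge0// sup_norm_ge0.
by apply: (le_trans (ler_normD _ _)); rewrite lerD// sup_norm_ge.
Qed.

Lemma sup_normZ (a : K) s : sup_norm (a *: s) = `|a| * sup_norm s.
Proof.
have le b t : sup_norm (b *: t) <= `|b| * sup_norm t.
  apply: sup_norm_le => [|x]; first by rewrite mulr_ge0// sup_norm_ge0.
  by rewrite /= normrZ ler_wpM2l// sup_norm_ge.
apply/eqP; rewrite eq_le le/=.
have [->|a0] := eqVneq a 0; first by rewrite normr0 mul0r sup_norm_ge0.
have := le a^-1 (a *: s); rewrite scalerA mulVf// scale1r normfV.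
by rewrite -ler_pdivrMl ?invr_gt0 ?normr_gt0// invrK.
Qed.

Lemma sup_norm0_eq0 s : sup_norm s = 0 -> s = 0.
Proof.
move=> s0; apply: sections_ext => x /=; apply/eqP.
by rewrite -normr_le0 -s0 sup_norm_ge.
Qed.

HB.instance Definition _ := Lmodule_isNormed.Build K (sections P)
  sup_normD sup_normZ sup_norm0_eq0.

End bounded_sections.

Definition vanishing (X : topologicalType) (K : numFieldType) (n : X -> K) :=
  forall e : K, 0 < e ->
    exists L : set X, compact L /\ forall x, ~ L x -> n x <= e.

Lemma vanishing_usc_bounded (R : realType) (k : scalar_kind)
    (X : topologicalType) (n : X -> scalar_field R k) :
  (forall x, 0 <= n x) -> (forall r, open [set x | n x < r]) ->
  vanishing n -> exists M, forall x, n x <= M.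
Proof.
move=> n0 usc /(_ 1 ltr01)[L [/compact_near_coveringP cL nL]].
have [N _ hN] : \forall N \near \oo, L `<=` (fun x => n x < N%:R).
  apply: (cL nat \oo (fun N x => n x < N%:R)) => x Lx.
  have [N nN] := scalar_archi (n0 x).
  exists ([set y | n y < N%:R], [set m | (N <= m)%N]).
    split => /=; last by exists N.
    exact: (open_nbhs_nbhs (conj (usc N%:R) nN)).
  move=> [y m] [/= ny Nm]; apply: (lt_le_trans ny).
  by rewrite ler_nat.
exists (1 + N%:R) => x; have [Lx|Lx] := pselect (L x).
  by apply: ltW; apply: (lt_le_trans (hN N (leqnn N) x Lx)); rewrite lerDr.
by apply: (le_trans (nL x Lx)); rewrite lerDl.
Qed.

Lemma vanishing_le (X : topologicalType) (K : numFieldType) (m n : X -> K) :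
  (forall x, m x <= n x) -> vanishing n -> vanishing m.
Proof.
move=> mn nV e /nV[L [cL nL]]; exists L; split => // x /nL.
exact: le_trans.
Qed.

Lemma vanishing_lin (X : topologicalType) (K : numFieldType) (c : K)
    (m n : X -> K) : 0 <= c -> vanishing m -> vanishing n ->
  vanishing (fun x => c * m x + n x).
Proof.
move=> c0 mV nV e e0; have c1 : 0 < c + 1 by rewrite ltr_wpDl.
have d0 : 0 < e / 2 by rewrite divr_gt0.
have [L [cL mL]] := mV (e / 2 / (c + 1)) (divr_gt0 d0 c1).
have [L' [cL' nL]] := nV _ d0.
exists (L `|` L'); split; first exact: compactU.
move=> x /not_orP[Lx Lx']; rewrite [leRHS]splitr lerD ?nL//.
apply: (le_trans (ler_wpM2l c0 (mL _ Lx))).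
by rewrite mulrCA ler_piMr ?ltW// ltr_pdivrMr// mul1r ltrDl.
Qed.

Lemma vanishing0 (X : topologicalType) (K : numFieldType) :
  vanishing (fun _ : X => 0 : K).
Proof.
by move=> e e0; exists set0; split => [|x _]; [exact: compact0|exact: ltW].
Qed.

Section C0.
Context (R : realType) (k : scalar_kind) (X : topologicalType).
Local Notation K := (scalar_field R k).

Definition C0_mem (f : X -> K) : Prop :=
  continuous f /\ vanishing (fun x => `|f x|).

Lemma C0_mem0 : C0_mem (fun=> 0).
Proof.
split; first by move=> x; exact: cvg_cst.
by under [X in vanishing X]eq_fun do rewrite normr0; exact: vanishing0.
Qed.

Lemma C0_memP (a : K) (f g : X -> K) :
  C0_mem f -> C0_mem g -> C0_mem (fun x => a * f x + g x).
Proof.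
move=> [cf Vf] [cg Vg]; split.
  by move=> x; apply: cvgD; [apply: cvgM; [exact: cvg_cst|exact: cf]|exact: cg].
apply: vanishing_le (vanishing_lin (normr_ge0 a) Vf Vg) => x.
by rewrite -normrM ler_normD.
Qed.

Lemma C0_bounded (f : X -> K) :
  C0_mem f -> exists M : K, forall x, `|f x| <= M.
Proof.
move=> [cf Vf]; apply: vanishing_usc_bounded => // r.
have cn : continuous (fun x => `|f x|).
  by move=> x; apply: cvg_norm; exact: cf.
have := @open_comp _ _ (fun x => `|f x|) [set y : K | `|y| < r].
rewrite /preimage/=; under eq_set do rewrite normr_id.
apply; first by move=> x _; exact: cn.
have -> : [set y : K | `|y| < r] = ball (0 : K) r.
  by apply/seteqP; split => y; rewrite -ball_normE/= sub0r normrN.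
exact: ball_open.
Qed.

Definition C0_submodule : bounded_submodule (fun _ : X => K : normedModType K) :=
  @BoundedSubmodule R k X (fun _ => K : normedModType K) C0_mem
    C0_mem0 C0_memP C0_bounded.

Definition C0 := sections C0_submodule.

Lemma C0_mulP (f g : C0) : C0_mem (fun x => f x * g x).
Proof.
have [cf Vf] := sec_mem f; have [cg Vg] := sec_mem g; split.
  by move=> x; apply: cvgM; [exact: cf|exact: cg].
have [M hM] := C0_bounded (sec_mem f).
have V0 := vanishing_lin (normr_ge0 M) Vg (@vanishing0 X K).
apply: vanishing_le V0 => x.
rewrite addr0 normrM; apply: ler_wpM2r => //.
by rewrite (le_trans (hM x))// real_ler_norm// ger0_real// (le_trans _ (hM x)).
Qed.

Definition C0_mul (f g : C0) : C0 := MkSection (P := C0_submodule) (C0_mulP f g).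

Definition C0_nonneg (f : C0) : Prop := forall x, 0 <= (f x : K).

End C0.

HB.mixin Record isTopologicalGroup G of Group G & Topological G := {
  mulg_continuous : continuous (fun gh : G * G => (gh.1 * gh.2)%g) ;
  invg_continuous : continuous (fun g : G => (g^-1)%g)
}.

#[short(type="topologicalGroupType")]
HB.structure Definition TopologicalGroup :=
  {G of isTopologicalGroup G & Group G & Topological G}.

(* Used as a type, a closed submonoid is the library's [set_type] of its
   underlying set, with the subspace topology. *)
Record closed_submonoid (G : topologicalGroupType) := ClosedSubmonoid {
  submonoid_set :> set G ;
  submonoid_closed : closed submonoid_set ;
  submonoid_one : submonoid_set 1%g ;
  submonoid_mul : forall g h,
    submonoid_set g -> submonoid_set h -> submonoid_set (g * h)%g
}.

Section submonoid_operations.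
Context (G : topologicalGroupType) (S : closed_submonoid G).

Definition sone : S := exist _ 1%g (mem_set (submonoid_one S)).

Definition smul (g h : S) : S :=
  exist _ (\val g * \val h)%g
    (mem_set (submonoid_mul (set_valP g) (set_valP h))).

End submonoid_operations.

Record dynamical_system (G : topologicalGroupType) (X : topologicalType) :=
  DynamicalSystem {
    flow :> G -> X -> X ;
    flow1 : forall x, flow 1%g x = x ;
    flowM : forall g h x, flow (g * h)%g x = flow g (flow h x) ;
    flow_continuous : continuous (fun gx : G * X => flow gx.1 gx.2)
  }.

Section flow_lemmas.
Context (G : topologicalGroupType) (X : topologicalType).
Context (phi : dynamical_system G X).

Lemma flowK g x : phi g^-1%g (phi g x) = x.
Proof. by rewrite -flowM mulVg flow1. Qed.

Lemma flowVK g x : phi g (phi g^-1%g x) = x.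
Proof. by rewrite -flowM mulgV flow1. Qed.

Lemma flow_cont g : continuous (phi g).
Proof.
move=> x; apply: (@continuous_comp _ _ _ (fun y => (g, y))
  (fun gx : G * X => phi gx.1 gx.2)); last exact: flow_continuous.
by apply: cvg_pair; [exact: cvg_cst|exact: cvg_id].
Qed.

Lemma vanishing_flow (K : numFieldType) (n : X -> K) g :
  vanishing n -> vanishing (fun x => n (phi g^-1%g x)).
Proof.
move=> nV e /nV[L [cL nL]]; exists (phi g @` L); split.
  by apply: continuous_compact cL; apply: continuous_subspaceT; exact: flow_cont.
move=> x Lx; apply: nL => Ly; apply: Lx; exists (phi g^-1%g x) => //.
exact: flowVK.
Qed.

End flow_lemmas.

Section koopman_C0.
Context (R : realType) (k : scalar_kind).
Context (G : topologicalGroupType) (X : topologicalType).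
Context (phi : dynamical_system G X) (g : G).

Lemma koopman_C0_mem (f : C0 R k X) : C0_mem (fun x => f (phi g^-1%g x)).
Proof.
have [cf Vf] := sec_mem f; split; last exact: (vanishing_flow phi g Vf).
by move=> x; apply: continuous_comp; [exact: flow_cont|exact: cf].
Qed.

(* The inverse of phi g is phi g^-1 since phi is an action. *)
Definition koopman_C0 (f : C0 R k X) : C0 R k X :=
  MkSection (P := C0_submodule R k X) (koopman_C0_mem f).

End koopman_C0.

(* The fibers are given as a family of Banach spaces together with bijections
   [point x] of [fiber x] onto the preimage of x in the total space. *)
Record fibered_space (K : numFieldType) (X : topologicalType) := FiberedSpace {
  total : topologicalType ;
  proj : total -> X ;
  fiber : X -> completeNormedModType K ;
  point : forall x, fiber x -> total ;
  point_bij : forall x, set_bij [set: fiber x] (proj @^-1` [set x]) (@point x)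
}.
Arguments point {K X} _ {x}.

Section fibered_space_operations.
Context (K : numFieldType) (X : topologicalType) (E : fibered_space K X).

(* The inverse of [point] on the preimage of x, and 0 elsewhere. *)
Definition coord (x : X) (e : total E) : fiber E x :=
  xget 0 [set v | point E v = e].

Definition fadd (ee : total E * total E) : total E :=
  let x := proj ee.1 in point E (coord x ee.1 + coord x ee.2).

Definition fscale (ae : K * total E) : total E :=
  let x := proj ae.2 in point E (ae.1 *: coord x ae.2).

Definition fnorm (e : total E) : K := `|coord (proj e) e|.

Lemma proj_point x (v : fiber E x) : proj (point E v) = x.
Proof. by have [/(_ v I)] := point_bij E x. Qed.

Lemma pointK x : cancel (@point _ _ E x) (coord x).
Proof.
move=> v; have [_ inj _] := point_bij E x.
rewrite /coord; case: xgetP => [w _ wv|/(_ v)/(_ erefl)]; last by [].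
by apply: inj wv; rewrite inE.
Qed.

Lemma coordK x e : proj e = x -> point E (coord x e) = e.
Proof.
move=> ex; have [_ _ /(_ e ex)[v _ <-]] := point_bij E x.
by rewrite pointK.
Qed.

Lemma fnorm_point x (v : fiber E x) : fnorm (point E v) = `|v|.
Proof.
rewrite /fnorm; move: (point E v) (proj_point v) (pointK v) => e ex.
by case: _ / ex v => v ->.
Qed.

Lemma norm_coord x e : proj e = x -> `|coord x e| = fnorm e.
Proof. by move=> ex; rewrite -fnorm_point coordK. Qed.

End fibered_space_operations.

(* [fadd] takes junk values off the fiber product, where continuity within the
   fiber product requires nothing. *)
Record banach_bundle (K : numFieldType) (X : topologicalType) := BanachBundle {
  bundle_space :> fibered_space K X ;
  proj_continuous : continuous (@proj _ _ bundle_space) ;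
  proj_open : forall U : set (total bundle_space),
    open U -> open (@proj _ _ bundle_space @` U) ;
  proj_surj : set_surj setT setT (@proj _ _ bundle_space) ;
  fadd_continuous :
    {within [set ee : total bundle_space * total bundle_space |
              proj ee.1 = proj ee.2],
     continuous (@fadd _ _ bundle_space)} ;
  fscale_continuous : continuous (@fscale _ _ bundle_space) ;
  fnorm_usc : forall r : K, open [set e : total bundle_space | fnorm e < r] ;
  zero_nbhs : forall x (W : set (total bundle_space)),
    open W -> W (point bundle_space (0 : fiber bundle_space x)) ->
    exists2 e : K, 0 < e &
      exists U : set X, [/\ open U, U x &
        [set v | U (proj v) /\ fnorm v <= e] `<=` W]
}.

Lemma le_mul_norm (K : numFieldType) (M a b : K) :
  0 <= a -> 0 <= b -> a <= M * b -> a <= `|M| * b.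
Proof.
move=> a0 b0; have [->|bN0] := eqVneq b 0; first by rewrite !mulr0.
move=> aM; rewrite ger0_norm//.
by have := le_trans a0 aM; rewrite pmulr_lge0// lt_def bN0.
Qed.

Section bundle_morphisms.
Context (K : numFieldType) (X : topologicalType).
Implicit Types E F H : banach_bundle K X.

(* The restriction of Phi to the fiber at x, when Phi is a map over psi. *)
Definition fiber_map E F (psi : X -> X) (Phi : total E -> total F) (x : X)
    (v : fiber E x) : fiber F (psi x) :=
  coord (psi x) (Phi (point E v)).

(* The last clause says that the operator norms of the fiber maps are uniformly
   bounded; in particular each fiber map is bounded. *)
Definition is_bundle_morphism E F (psi : X -> X) (Phi : total E -> total F) :=
  [/\ continuous Phi,
      forall e, proj (Phi e) = psi (proj e),
      forall x, linear (@fiber_map E F psi Phi x) &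
      exists M : K, forall x (v : fiber E x), `|fiber_map psi Phi v| <= M * `|v|].

Lemma point_fiber_map E F psi (Phi : total E -> total F) x (v : fiber E x) :
  is_bundle_morphism psi Phi -> point F (fiber_map psi Phi v) = Phi (point E v).
Proof. by move=> [_ pPhi _ _]; rewrite coordK// pPhi proj_point. Qed.

Lemma bundle_morphism_comp E F H psi chi
    (Phi : total E -> total F) (Psi : total F -> total H) :
  is_bundle_morphism psi Phi -> is_bundle_morphism chi Psi ->
  is_bundle_morphism (chi \o psi) (Psi \o Phi).
Proof.
move=> mPhi mPsi; have [cPhi pPhi lPhi [M bPhi]] := mPhi.
have [cPsi pPsi lPsi [N bPsi]] := mPsi.
have fE x (v : fiber E x) : fiber_map (chi \o psi) (Psi \o Phi) v =
    fiber_map chi Psi (fiber_map psi Phi v).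
  by rewrite {2}/fiber_map point_fiber_map.
split.
- by move=> e; apply: continuous_comp; [exact: cPhi|exact: cPsi].
- by move=> e /=; rewrite pPsi pPhi.
- by move=> x a u v; rewrite !fE lPhi lPsi.
- exists (`|N| * `|M|) => x v; rewrite fE.
  apply: (le_trans (le_mul_norm (normr_ge0 _) (normr_ge0 _) (bPsi _ _))).
  by rewrite -mulrA ler_wpM2l// le_mul_norm.
Qed.

Lemma bundle_morphism_id E : is_bundle_morphism id (@id (total E)).
Proof.
have fE x (v : fiber E x) : fiber_map id (@id (total E)) v = v.
  by rewrite /fiber_map pointK.
split.
- by move=> e; exact: cvg_id.
- by [].
- by move=> x a u v; rewrite !fE.
- by exists 1 => x v; rewrite fE mul1r.
Qed.

End bundle_morphisms.

Section Gamma0.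
Context (R : realType) (k : scalar_kind) (X : topologicalType).
Local Notation K := (scalar_field R k).
Context (E : banach_bundle K X).

Definition Gamma0_mem (s : forall x, fiber E x) : Prop :=
  continuous (fun x => point E (s x)) /\ vanishing (fun x => `|s x|).

Lemma zero_section_continuous : continuous (fun x => point E (0 : fiber E x)).
Proof.
move=> x W /=; rewrite nbhsE => -[W' [oW' W'x] W'W].
have [e e0 [U [oU Ux hU]]] := zero_nbhs oW' W'x.
apply: filterS (open_nbhs_nbhs (conj oU Ux)) => y Uy /=.
apply/W'W/hU; split; first by rewrite /= proj_point.
by rewrite fnorm_point normr0 ltW.
Qed.

Lemma fscale_section (a : X -> K) (s : forall x, fiber E x) :
  continuous a -> continuous (fun x => point E (s x)) ->
  continuous (fun x => point E (a x *: s x)).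
Proof.
move=> ca cs x.
have -> : (fun x => point E (a x *: s x)) =
    @fscale _ _ E \o (fun x => (a x, point E (s x))).
  by apply: funext => y /=; rewrite /fscale/= proj_point pointK.
apply: (@continuous_comp _ _ _ (fun x => (a x, point E (s x))) (@fscale _ _ E));
  last exact: fscale_continuous.
exact: (cvg_pair (ca x) (cs x)).
Qed.

Lemma fadd_section (s t : forall x, fiber E x) :
  continuous (fun x => point E (s x)) -> continuous (fun x => point E (t x)) ->
  continuous (fun x => point E (s x + t x)).
Proof.
move=> cs ct x.
set A := [set ee : total E * total E | proj ee.1 = proj ee.2].
have Ast y : A (point E (s y), point E (t y)) by rewrite /A/= !proj_point.
have -> : (fun x => point E (s x + t x)) =
    @fadd _ _ E \o (fun x => (point E (s x), point E (t x))).
  by apply: funext => y /=; rewrite /fadd/= proj_point !pointK.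
have := (@subspace_continuousP _ A _ (@fadd _ _ E)).1
  (@fadd_continuous _ _ E) _ (Ast x).
apply: cvg_comp => W /= hW.
have : (fun y => (point E (s y), point E (t y))) @ x -->
    (point E (s x), point E (t x)).
  exact: (cvg_pair (cs x) (ct x)).
move=> /(_ _ hW) h.
have {}h : \forall y \near x, A (point E (s y), point E (t y)) ->
    W (point E (s y), point E (t y)) := h.
by apply: filterS h => y; apply.
Qed.

Lemma Gamma0_mem0 : Gamma0_mem (fun x => 0).
Proof.
split; first exact: zero_section_continuous.
by under [X in vanishing X]eq_fun do rewrite normr0; exact: vanishing0.
Qed.

Lemma Gamma0_memP (a : K) (s t : forall x, fiber E x) :
  Gamma0_mem s -> Gamma0_mem t -> Gamma0_mem (fun x => a *: s x + t x).
Proof.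
move=> [cs Vs] [ct Vt]; split.
  apply: fadd_section => //; apply: (fscale_section (a := fun=> a)) => //.
  by move=> x; exact: cvg_cst.
apply: vanishing_le (vanishing_lin (normr_ge0 a) Vs Vt) => x.
by rewrite -normrZ ler_normD.
Qed.

Lemma Gamma0_bounded (s : forall x, fiber E x) :
  Gamma0_mem s -> exists M : K, forall x, `|s x| <= M.
Proof.
move=> [cs Vs]; apply: vanishing_usc_bounded => // r.
have := open_comp (fun x _ => cs x) (@fnorm_usc _ _ E r).
by congr open; apply/seteqP; split => x /=; rewrite fnorm_point.
Qed.

Definition Gamma0_submodule : bounded_submodule (fiber E) :=
  @BoundedSubmodule R k X (fiber E) Gamma0_mem
    Gamma0_mem0 Gamma0_memP Gamma0_bounded.

Definition Gamma0 := sections Gamma0_submodule.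

Lemma Gamma0_actP (f : C0 R k X) (s : Gamma0) :
  Gamma0_mem (fun x => (f x : K) *: s x).
Proof.
have [cf Vf] := sec_mem f; have [cs Vs] := sec_mem s.
split; first exact: fscale_section.
have [M hM] := C0_bounded (sec_mem f).
have V0 := vanishing_lin (normr_ge0 M) Vs (@vanishing0 X K).
apply: vanishing_le V0 => x.
rewrite addr0 normrZ; apply: ler_wpM2r => //.
by rewrite (le_trans (hM x))// real_ler_norm// ger0_real// (le_trans _ (hM x)).
Qed.

Definition Gamma0_act (f : C0 R k X) (s : Gamma0) : Gamma0 :=
  MkSection (P := Gamma0_submodule) (Gamma0_actP f s).

End Gamma0.

Record category := Category {
  obj :> Type ;
  hom : obj -> obj -> Type ;
  idm : forall A, hom A A ;
  mcomp : forall A B C, hom B C -> hom A B -> hom A C ;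
  mcomp1m : forall A B (f : hom A B), mcomp (idm B) f = f ;
  mcompm1 : forall A B (f : hom A B), mcomp f (idm A) = f ;
  mcompA : forall A B C D (f : hom A B) (g : hom B C) (h : hom C D),
    mcomp h (mcomp g f) = mcomp (mcomp h g) f
}.
Arguments idm {c} A.

Definition isomorphic (C : category) (A B : C) : Prop :=
  exists (f : hom A B) (g : hom B A), mcomp g f = idm A /\ mcomp f g = idm B.

Record functor (C D : category) := Functor {
  fobj :> C -> D ;
  fmap : forall A B, hom A B -> hom (fobj A) (fobj B) ;
  fmap1 : forall A, fmap (idm A) = idm (fobj A) ;
  fmapM : forall A B B' (f : hom A B) (g : hom B B'),
    fmap (mcomp g f) = mcomp (fmap g) (fmap f)
}.

Definition fully_faithful (C D : category) (F : functor C D) : Prop :=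
  forall A B, bijective (@fmap _ _ F A B).

Definition essentially_surjective (C D : category) (F : functor C D) : Prop :=
  forall B, exists A, isomorphic (F A) B.

Section dynamical_bundles.
Context (R : realType) (k : scalar_kind).
Local Notation K := (scalar_field R k).
Context (G : topologicalGroupType) (S : closed_submonoid G).
Context (X : topologicalType) (phi : dynamical_system G X).

Record dynamical_bundle := DynamicalBundle {
  dbundle :> banach_bundle K X ;
  dact : S -> total dbundle -> total dbundle ;
  dact1 : dact (sone S) = id ;
  dactM : forall g h, dact (smul g h) = dact g \o dact h ;
  dact_morphism : forall g, is_bundle_morphism (phi (\val g)) (dact g) ;
  dact_continuous :
    continuous (fun ge : S * total dbundle => dact ge.1 ge.2) ;
  dact_bounded : forall L : set S, compact L ->
    exists M : K, forall g, L g -> forall x (v : fiber dbundle x),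
      `|fiber_map (phi (\val g)) (dact g) v| <= M * `|v|
}.

Record bundle_hom (E F : dynamical_bundle) := BundleHom {
  bhom :> total E -> total F ;
  bhom_morphism : is_bundle_morphism id bhom ;
  bhom_dact : forall g, bhom \o dact g = dact g \o bhom
}.

Lemma bundle_hom_ext E F (Theta Xi : bundle_hom E F) :
  (forall e, Theta e = Xi e) -> Theta = Xi.
Proof.
case: Theta Xi => [f pf qf] [g pg qg] /= fg.
have e : f = g by apply: funext.
by rewrite e in pf qf *; congr BundleHom; exact: Prop_irrelevance.
Qed.

Definition bundle_id E : bundle_hom E E :=
  BundleHom (bundle_morphism_id E) (fun=> erefl).

Lemma bundle_comp_dact E F H (Xi : bundle_hom F H) (Theta : bundle_hom E F) g :
  (Xi \o Theta) \o dact g = dact g \o (Xi \o Theta).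
Proof. by rewrite -compA bhom_dact [LHS]compA bhom_dact. Qed.

Definition bundle_comp E F H (Xi : bundle_hom F H) (Theta : bundle_hom E F) :
    bundle_hom E H :=
  BundleHom (bundle_morphism_comp (bhom_morphism Theta) (bhom_morphism Xi))
    (bundle_comp_dact Xi Theta).

Definition bundle_category : category.
Proof.
refine (@Category dynamical_bundle bundle_hom bundle_id bundle_comp _ _ _).
- by move=> *; exact: bundle_hom_ext.
- by move=> *; exact: bundle_hom_ext.
- by move=> *; exact: bundle_hom_ext.
Defined.

End dynamical_bundles.

Section dynamical_modules.
Context (R : realType) (k : scalar_kind).
Local Notation K := (scalar_field R k).
Context (G : topologicalGroupType) (S : closed_submonoid G).
Context (X : topologicalType) (phi : dynamical_system G X).

Definition is_banach_module (V : normedModType K) (act : C0 R k X -> V -> V) :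
    Prop :=
  [/\ (forall F : set_system V, ProperFilter F -> cauchy F -> cvg F),
      (forall f, linear (act f)) /\ (forall s, linear (act^~ s)),
      forall f g s, act (C0_mul f g) s = act f (act g s),
      forall f s, `|act f s| <= `|f| * `|s| &
      closure [set t | exists n (a : 'I_n -> K) (f : 'I_n -> C0 R k X)
        (s : 'I_n -> V), t = \sum_(i < n) a i *: act (f i) (s i)] = setT].

Definition cyclic_submodule (V : normedModType K) (act : C0 R k X -> V -> V)
  (s : V) : set V := closure [set act f s | f in setT].

Definition cyclic_cone (V : normedModType K) (act : C0 R k X -> V -> V)
  (s : V) : set V := closure [set act f s | f in @C0_nonneg R k X].

(* w is the least upper bound of u and v in W for the order with positive
   cone C. *)
Definition is_join (V : zmodType) (W C : set V) (u v w : V) : Prop :=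
  [/\ W w, C (w - u), C (w - v) &
      forall z, W z -> C (z - u) -> C (z - v) -> C (z - w)].

Definition is_AM_space (V : normedModType K) (W C : set V) : Prop :=
  forall u v, C u -> C v ->
    exists2 w, is_join W C u v w & `|w| = Num.max `|u| `|v|.

(* The cyclic submodules of a Banach module over C_0(X) always are Banach
   lattices (complexified ones for complex scalars) for their cyclic cones, so
   only the AM property of their norms has to be required. *)
Definition is_AM_module (V : normedModType K) (act : C0 R k X -> V -> V) :
    Prop :=
  is_banach_module act /\
  forall s, is_AM_space (cyclic_submodule act s) (cyclic_cone act s).

Record module_data := ModuleData {
  mcarrier :> normedModType K ;
  mact : C0 R k X -> mcarrier -> mcarrier ;
  mrep : S -> mcarrier -> mcarrier
}.

Definition is_bounded_linear (V W : normedModType K) (T : V -> W) : Prop :=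
  linear T /\ exists M : K, forall s, `|T s| <= M * `|s|.

Definition is_dynamical_AM_module (V : module_data) : Prop :=
  [/\ is_AM_module (@mact V),
      (forall g, is_bounded_linear (@mrep V g)),
      mrep (sone S) = @id V /\
        (forall g h, mrep (smul g h) = @mrep V g \o mrep h),
      forall g f (s : V),
        mrep g (mact f s) = mact (koopman_C0 phi (\val g) f) (mrep g s) &
      forall s : V, continuous (fun g : S => mrep g s)].

Record dynamical_AM_module := DynamicalAMModule {
  am_module :> module_data ;
  am_moduleP : is_dynamical_AM_module am_module
}.

Definition is_module_hom (V W : module_data) (T : V -> W) : Prop :=
  [/\ is_bounded_linear T,
      forall f s, T (mact f s) = mact f (T s) &
      forall g s, T (mrep g s) = mrep g (T s)].

Record module_hom (V W : module_data) := ModuleHom {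
  mhom :> V -> W ;
  mhomP : is_module_hom mhom
}.

Lemma module_hom_ext V W (T U : module_hom V W) :
  (forall s, T s = U s) -> T = U.
Proof.
case: T U => [f pf] [g pg] /= fg.
have e : f = g by apply: funext.
by rewrite e in pf *; congr ModuleHom; exact: Prop_irrelevance.
Qed.

Lemma module_idP (V : module_data) : is_module_hom (@id V).
Proof. by split => //; split => //; exists 1 => s; rewrite mul1r. Qed.

Lemma module_compP (V W U : module_data) (T : module_hom V W)
  (T' : module_hom W U) : is_module_hom (T' \o T).
Proof.
have [[lT [M bT]] aT gT] := mhomP T; have [[lT' [N bT']] aT' gT'] := mhomP T'.
split; first (split; last exists (`|N| * `|M|)).
- by move=> a s t /=; rewrite lT lT'.
- move=> s /=.
  apply: (le_trans (le_mul_norm (normr_ge0 _) (normr_ge0 _) (bT' _))).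
  by rewrite -mulrA ler_wpM2l// le_mul_norm.
- by move=> f s /=; rewrite aT aT'.
- by move=> g s /=; rewrite gT gT'.
Qed.

Definition module_id (V : module_data) : module_hom V V :=
  ModuleHom (module_idP V).

Definition module_comp (V W U : module_data) (T' : module_hom W U)
  (T : module_hom V W) : module_hom V U := ModuleHom (module_compP T T').

Definition AM_module_category : category.
Proof.
refine (@Category dynamical_AM_module (fun V W => module_hom V W)
  (fun V => module_id V) (fun V W U => @module_comp V W U) _ _ _).
- by move=> *; exact: module_hom_ext.
- by move=> *; exact: module_hom_ext.
- by move=> *; exact: module_hom_ext.
Defined.

End dynamical_modules.

Section section_functor.
Context (R : realType) (k : scalar_kind).
Local Notation K := (scalar_field R k).
Context (G : topologicalGroupType) (S : closed_submonoid G).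
Context (X : topologicalType) (phi : dynamical_system G X).

Section koopman_Gamma0.
Context (E : dynamical_bundle R k S phi) (g : S).
Local Notation g' := (\val g)^-1%g.

(* Sections are dependent functions; as a map into the total space this one is
   dact g \o s \o (phi g)^-1, see [point_koopman]. *)
Definition koopman_fun (s : forall x, fiber E x) (x : X) : fiber E x :=
  coord x (dact g (point E (s (phi g' x)))).

Lemma point_koopman (s : forall x, fiber E x) x :
  point E (koopman_fun s x) = dact g (point E (s (phi g' x))).
Proof.
have [_ p _ _] := dact_morphism E g.
by rewrite coordK// p proj_point flowVK.
Qed.

Lemma koopman_mem (s : Gamma0 E) : Gamma0_mem (koopman_fun s).
Proof.
have [cs Vs] := sec_mem s; have [cg pg _ [M bM]] := dact_morphism E g.
split.
  have -> : (fun x => point E (koopman_fun s x)) =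
      dact g \o (fun y => point E (s y)) \o phi g'.
    by apply: funext => x; rewrite point_koopman.
  move=> x; apply: continuous_comp; first exact: flow_cont.
  by apply: continuous_comp; [exact: cs|exact: cg].
have V1 := vanishing_flow phi (\val g) Vs.
apply: vanishing_le (vanishing_lin (normr_ge0 M) V1 (@vanishing0 X K)) => x.
rewrite addr0 norm_coord; last by rewrite pg proj_point flowVK.
have := bM (phi g' x) (s (phi g' x)).
rewrite norm_coord; last by rewrite pg proj_point.
exact: le_mul_norm (normr_ge0 _) (normr_ge0 _).
Qed.

Definition koopman_Gamma0 (s : Gamma0 E) : Gamma0 E :=
  MkSection (P := Gamma0_submodule E) (koopman_mem s).

End koopman_Gamma0.

Definition Gamma0_module (E : dynamical_bundle R k S phi) : module_data R k S X :=
  @ModuleData R k G S X (Gamma0 E) (@Gamma0_act R k X E) (@koopman_Gamma0 E).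

Section Gamma0_morphism.
Context (E F : dynamical_bundle R k S phi) (Theta : bundle_hom E F).

Lemma Gamma0_map_mem (s : Gamma0 E) :
  Gamma0_mem (fun x => fiber_map id Theta (s x) : fiber F x).
Proof.
have [cs Vs] := sec_mem s; have mT := bhom_morphism Theta.
have [cT pT _ [M bM]] := mT; split.
  have -> : (fun x => point F (fiber_map id Theta (s x) : fiber F x)) =
      Theta \o (fun x => point E (s x)).
    by apply: funext => x /=; rewrite (point_fiber_map _ mT).
  by move=> x; apply: continuous_comp; [exact: cs|exact: cT].
apply: vanishing_le (vanishing_lin (normr_ge0 M) Vs (@vanishing0 X K)) => x.
by rewrite addr0; exact: (le_mul_norm (normr_ge0 _) (normr_ge0 _) (bM _ _)).
Qed.

(* As a map into the total space, Gamma0_map Theta s is Theta \o s, see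
   [point_Gamma0_map]. *)
Definition Gamma0_map (s : Gamma0_module E) : Gamma0_module F :=
  MkSection (P := Gamma0_submodule F) (Gamma0_map_mem s).

Lemma point_Gamma0_map (s : Gamma0_module E) x :
  point F (sec (Gamma0_map s) x) = Theta (point E (sec s x)).
Proof. exact: (point_fiber_map _ (bhom_morphism Theta)). Qed.

End Gamma0_morphism.

Section functor_laws.
Context (objP : forall E : dynamical_bundle R k S phi,
  is_dynamical_AM_module phi (Gamma0_module E)).
Context (homP : forall (E F : dynamical_bundle R k S phi)
  (Theta : bundle_hom E F), is_module_hom (Gamma0_map Theta)).

(* Parametrized by proofs that the two assignments land in the category of
   dynamical AM-modules; that such proofs exist is part of the theorem. *)
Definition section_functor :
  functor (bundle_category R k S phi) (AM_module_category R k S phi).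
Proof.
refine (@Functor (bundle_category R k S phi) (AM_module_category R k S phi)
  (fun E => DynamicalAMModule (objP E))
  (fun E F Theta => ModuleHom (homP Theta)) _ _).
- move=> E; apply: module_hom_ext => s; apply: sections_ext => x.
  by rewrite /= /fiber_map pointK.
- move=> E F H Theta Xi; apply: module_hom_ext => s; apply: sections_ext => x.
  rewrite /= [in RHS]/fiber_map (point_fiber_map _ (bhom_morphism Theta)).
  by [].
Defined.

End functor_laws.

End section_functor.

(* Main.v *)
From HB Require Import structures.
From mathcomp Require Import all_boot all_order all_algebra.
From mathcomp Require Import all_classical all_reals all_analysis.
From mathcomp Require Import generic_quotient complex ring lra.

Require Import Defs.

Set Implicit Arguments.
Unset Strict Implicit.
Unset Printing Implicit Defensive.

Import Order.TTheory GRing.Theory Num.Theory.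
Import numFieldNormedType.Exports.

Local Open Scope classical_set_scope.
Local Open Scope quotient_scope.
Local Open Scope ring_scope.

(** That sections of an S-dynamical bundle form an S-dynamical AM-module is
    mostly a matter of computing fiberwise. In the fiber at x the cyclic cone of
    a section s is the ray of s x, so joins are computed by taking the longer of
    two vectors in each fiber, and the sup norm has the AM property
    ([Gamma0_AM_space]). Strong continuity of the Koopman representation is a
    tube lemma ([koopman_continuous]).

    Fullness and faithfulness rest on two facts. Every vector of a Banach bundle
    over a locally compact Hausdorff space lies on a continuous section vanishing
    at infinity ([section_through_point]). The proof, in the spirit of Michael's
    selection theorem, weakens continuity to continuity up to an error e
    ([almost_continuous]). Such sections can be chosen arbitrarily in thin
    neighborhoods and glued with bump functions, so the error can be halved
    again and again; the limit is continuous. On the other hand a module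
    homomorphism V is local: [`|V s x| <= M * `|s x|], because s may be replaced
    by h s for a bump h at x, whose norm is nearly that of s x by upper
    semicontinuity ([module_hom_local]). Hence V s x depends on s x only, and
    this defines the bundle morphism that induces V; it is continuous because
    tubes around continuous sections form neighborhood bases.

    For essential surjectivity let V be an AM-module. The seminorm [loc_norm x s]
    is the infimum of the norms of f s over the functions f with values between
    0 and 1 that are 1 near x. The quotients of V by these seminorms are the
    fibers of a bundle ([loc_bundle]), topologized by the tubes around the
    sections given by elements of V. The AM property enters in one inequality:
    the norm of the maximum of f and g times s is at most the larger of those of
    f s and g s ([AM_norm_max]). With compactness and nondegeneracy it makes the
    norm of s the supremum of the [loc_norm x s] ([AM_norm_local]), so V embeds
    isometrically into the sections of the bundle. Gluing with bumps shows that
    the range is dense ([germ_section_dense]), and completeness that it is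
    everything. The representation of S passes to the fibers since it maps
    functions that are 1 near x to functions that are 1 near g x; it is jointly
    continuous and locally bounded by the Banach-Steinhaus theorem
    ([uniform_boundedness]).

    In all gluing arguments compactness is used through [compact_bump_ind], an
    induction over a finite cover by bumps. *)

(** * Scalars and bump functions *)

Section scalars.
Context (R : realType) (k : scalar_kind).
Local Notation K := (scalar_field R k).
Local Notation ofR := (@ofR R k).

Lemma ofRN (a : R) : ofR (- a) = - ofR a.
Proof. by case: k => //=; rewrite rmorphN. Qed.

Lemma ofR1 : ofR 1 = 1 :> K.
Proof. exact: (ofRn R k 1). Qed.

Lemma lt_ofR (a b : R) : (ofR a < ofR b) = (a < b).
Proof.
rewrite !lt_neqAle le_ofR; congr andb; congr negb.
by apply/eqP/eqP => [/(congr1 (@toR R k))|->//]; rewrite !ofRK.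
Qed.

Lemma normr_ofR (a : R) : `|ofR a| = ofR `|a|.
Proof.
have [a0|a0] := leP 0 a.
  by rewrite (ger0_norm a0) ger0_norm// -(ofR0 R k) le_ofR.
by rewrite (ltr0_norm a0) ofRN ltr0_norm// -(ofR0 R k) lt_ofR.
Qed.

Lemma ofR_continuous : continuous (ofR : R -> K).
Proof.
move=> a; apply/cvgrPdist_lt => e e0.
have r0 : 0 < toR e by rewrite -lt_ofR ofR0 toRK// ltW.
near=> b; rewrite -ofRN -ofRD normr_ofR -[ltRHS]toRK ?ltW// lt_ofR.
near: b; apply: (@cvgr_dist_lt _ R^o _ (nbhs a) _ id) => //; exact: cvg_id.
Unshelve. all: by end_near. Qed.

End scalars.

Section real_scalars.
Context (K : numFieldType).
Implicit Types a b e : K.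

Lemma ler_forall_gt0 a b : a \is Num.real -> b \is Num.real ->
  (forall e, 0 < e -> a <= b + e) -> a <= b.
Proof.
move=> ra rb h; rewrite real_leNgt//; apply/negP => ba.
have e0 : 0 < (a - b) / 2 by rewrite divr_gt0// subr_gt0.
have := h _ e0; rewrite real_leNgt ?rpredD ?rpred_div ?rpredB ?realn//.
by rewrite -ltrBrDl ltr_pdivrMr// ltr_pMr ?subr_gt0// ltr1n.
Qed.

End real_scalars.

Section bumps.
Context (R : realType) (k : scalar_kind) (X : topologicalType).
Local Notation K := (scalar_field R k).
Local Notation C0 := (C0 R k X).

(** Containing the carrier in a compact closed subset of [U], and not merely in
    [U], makes a product with a bump vanish near every point outside [U]. *)
Definition is_bump (U : set X) (h : C0) : Prop :=
  (forall y, 0 <= (h y : K) <= 1) /\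
  exists C, [/\ compact C, closed C, C `<=` U & forall y, ~ C y -> h y = 0].

Lemma is_bumpS (U V : set X) (h : C0) : U `<=` V -> is_bump U h -> is_bump V h.
Proof.
move=> UV [h01 [C [cC clC CU Ch]]]; split => //.
by exists C; split => //; exact: (subset_trans CU).
Qed.

Lemma bump_ge0 U (h : C0) y : is_bump U h -> 0 <= (h y : K).
Proof. by move=> [/(_ y)/andP[]]. Qed.

Lemma bump_le1 U (h : C0) y : is_bump U h -> (h y : K) <= 1.
Proof. by move=> [/(_ y)/andP[]]. Qed.

Lemma bump_onem_ge0 U (h : C0) y : is_bump U h -> 0 <= 1 - (h y : K).
Proof. by move=> hb; rewrite subr_ge0 (bump_le1 _ hb). Qed.

Lemma bump_off U (h : C0) y : is_bump U h -> ~ U y -> h y = 0.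
Proof. by move=> [_ [C [_ _ CU Ch]]] Uy; apply: Ch => /CU. Qed.

Lemma bump_near_off U (h : C0) y : is_bump U h -> ~ U y ->
  \forall z \near y, h z = 0.
Proof.
move=> [_ [C [_ clC CU Ch]]] Uy.
have : open_nbhs y (~` C) by split; [exact: closed_openC|move/CU].
by move=> /open_nbhs_nbhs; apply: filterS => z /Ch.
Qed.

Lemma is_bump0 U : is_bump U 0.
Proof.
split=> [y|]; first by rewrite /= lexx ler01.
by exists set0; split => //; [exact: compact0|exact: closed0].
Qed.

(** Complements multiply, so that the values stay between 0 and 1 and are 1
    wherever those of one of the functions are. *)
Definition cup (h H : C0) : C0 := H + h - C0_mul h H.

Lemma cupE (h H : C0) y : cup h H y = (1 - (h y : K)) * H y + h y.
Proof. by rewrite /cup /= mulrBl mul1r addrAC. Qed.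

Lemma onem_cup (h H : C0) y :
  1 - (cup h H y : K) = (1 - (h y : K)) * (1 - (H y : K)).
Proof. by rewrite cupE mulrBr mulr1 opprD addrA addrAC. Qed.

Lemma is_bump_cup U V (h H : C0) :
  is_bump U h -> is_bump V H -> is_bump (U `|` V) (cup h H).
Proof.
move=> hb Hb; split=> [y|].
  rewrite -(subr_ge0 _ 1) onem_cup mulr_ge0 ?(bump_onem_ge0 _ hb)
    ?(bump_onem_ge0 _ Hb)// andbT cupE.
  by rewrite addr_ge0 ?mulr_ge0 ?(bump_onem_ge0 _ hb) ?(bump_ge0 _ hb)
     ?(bump_ge0 _ Hb).
have [_ [C [cC clC CU Ch]]] := hb; have [_ [D [cD clD DV DH]]] := Hb.
exists (C `|` D); split; [exact: compactU|exact: closedU|exact: setUSS|].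
by move=> y /not_orP[/Ch hy /DH Hy]; rewrite cupE hy Hy mulr0 addr0.
Qed.

Lemma cup_eq1l (h H : C0) y : h y = 1 -> cup h H y = 1.
Proof. by move=> hy; rewrite cupE hy subrr mul0r add0r. Qed.

Lemma cup_eq1r (h H : C0) y : H y = 1 -> cup h H y = 1.
Proof. by move=> hy; rewrite cupE hy mulr1 subrK. Qed.

Lemma locally_compact_nbhs : locally_compact [set: X] ->
  forall x : X, exists C, [/\ nbhs x C, compact C & closed C].
Proof.
move=> lcX x; have [C + [cC clC]] := lcX x I.
by rewrite withinET => nC; exists C.
Qed.

Hypotheses (hausX : hausdorff_space X) (lcX : locally_compact [set: X]).

Lemma bump_exists (x : X) (U : set X) : nbhs x U ->
  exists2 h : C0, is_bump U h & \forall y \near x, h y = 1.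
Proof.
move=> xU; have [C [nC cC clC]] := locally_compact_nbhs lcX x.
have cB : closed (~` (U `&` C)^°) by apply: open_closedC; exact: open_interior.
have xB : ~ (~` (U `&` C)^°) x by apply; exact: filterI.
have [f [cf f01 fx fB]] := (@uniform_separatorP X R _ _).1
  (@locally_compact_completely_regular X R lcX hausX _ _ cB xB).
(* f is 0 at x and 1 off the interior of U `&` C; g is 1 where f <= 1/3 and 0
   where f >= 2/3, hence locally constant at x and supported in U `&` C. *)
pose g y : R := Num.min 1 (Num.max 0 (2 - 3 * f y)).
have cg : continuous g.
  move=> y; apply: (@continuous_min R X (fun=> 1)
    (fun y => Num.max 0 (2 - 3 * f y)) y); first exact: cvg_cst.
  apply: (@continuous_max R X (fun=> 0) (fun y => 2 - 3 * f y) y).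
    exact: cvg_cst.
  by apply: cvgB; [exact: cvg_cst|apply: cvgM; [exact: cvg_cst|exact: cf]].
have g0 y : 2 / 3 < f y -> g y = 0.
  move=> fy; rewrite /g max_l; last by lra.
  by rewrite min_r// ler01.
have g1 y : f y < 1 / 3 -> g y = 1.
  move=> fy; rewrite /g max_r; last by lra.
  by rewrite min_l//; lra.
have g01 y : 0 <= g y <= 1.
  by rewrite /g le_min ler01 le_max lexx /= ge_min lexx.
pose D := [set y | f y <= 2 / 3].
have clD : closed D.
  by apply: (@preimage_closed _ _ f [set r | r <= 2 / 3]);
    [move=> y _; exact: cf|exact: closed_le].
have DUC : D `<=` U `&` C.
  move=> y Dy; apply: contrapT => nUC.
  have : (f @` (~` (U `&` C)^°)) (f y) by exists y => // /interior_subset.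
  by move=> /fB /= fy1; move: Dy; rewrite /D/= fy1; lra.
have cD : compact D by apply: subclosed_compact cC _ => // y /DUC[].
have hC0 : C0_mem (fun y => ofR k (g y)).
  split; first by move=> y; apply: continuous_comp (cg y) (@ofR_continuous _ _ _).
  move=> e e0; exists D; split => // y Dy.
  rewrite g0 ?ofR0 ?normr0 ?ltW// ltNge; exact/negP.
exists (MkSection (P := C0_submodule R k X) hC0).
  split => [y /=|]; first by rewrite -(ofR0 R k) -(ofR1 R k) !le_ofR.
  exists D; split => //; first by move=> y /DUC[].
  by move=> y Dy /=; rewrite g0 ?ofR0// ltNge; exact/negP.
have : nbhs x (f @^-1` [set r | r < 1 / 3]).
  have fx0 : f x = 0 by apply: (fx (f x)); exists x.
  apply: (cf x); apply: open_nbhs_nbhs; split; first exact: open_lt.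
  by rewrite /= fx0; lra.
by apply: filterS => y /= /g1 ->; exact: ofR1.
Qed.

(** Compactness as an induction over a finite cover. It replaces partitions of
    unity: [cup h H] is the convex combination of 1 and [H] with weights [h] and
    [1 - h], so a datum attached to [H] is updated by mixing it, with the same
    weights, with a datum attached to a neighborhood of one point. *)
Lemma compact_bump_ind (L : set X) (P : C0 -> Prop) : compact L -> P 0 ->
  (forall x, L x -> exists2 U, nbhs x U &
    forall h H, is_bump U h -> is_bump setT H -> P H -> P (cup h H)) ->
  exists H, [/\ is_bump setT H, P H & forall y, L y -> H y = 1].
Proof.
move=> /compact_near_coveringP cL P0 PS.
have /choice[W hW] : forall x, exists W : set X, L x ->
    nbhs x W /\ exists h : C0, [/\ is_bump setT h, (forall y, W y -> h y = 1) &
      forall H, is_bump setT H -> P H -> P (cup h H)].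
  move=> x; have [Lx|Lx] := pselect (L x); last by exists setT.
  have [U xU hU] := PS _ Lx; have [h hb h1] := bump_exists xU.
  exists [set y | h y = 1] => _; split => //; exists h; split => //.
    exact: (is_bumpS _ hb).
  by move=> H; exact: hU.
(* Finite sets of centers, directed by inclusion: that L is eventually covered
   along this filter means that it has a finite subcover. *)
pose F : set_system (seq X) :=
  [set Q : set (seq X) | exists s : seq X, forall t : seq X,
    {subset s <= t} -> Q t].
have FF : Filter F.
  split; first by exists [::].
    move=> P' Q [s sP] [t tQ]; exists (s ++ t) => u stu.
    by split; [apply: sP|apply: tQ] => y yst; apply: stu; rewrite mem_cat yst ?orbT.
  by move=> P' Q PQ [s sP]; exists s => t /sP /PQ.
have [s /(_ s (fun _ => id)) cov] :
    F [set s : seq X | L `<=` fun y => exists x, [/\ x \in s, L x & W x y]].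
  apply: (cL _ F (fun (s : seq X) y => exists x, [/\ x \in s, L x & W x y])) => x Lx.
  exists (W x, [set s : seq X | x \in s]) => /=.
    by split; [have [] := hW x Lx|exists [:: x] => t; apply; rewrite mem_head].
  by move=> [y t] [/= Wy xt]; exists x.
suff [H [Hb PH H1]] : exists H, [/\ is_bump setT H, P H &
    forall y, (exists x, [/\ x \in s, L x & W x y]) -> H y = 1].
  by exists H; split => // y /cov /H1.
elim: s {cov} => [|x s [H [Hb PH H1]]].
  exists 0; split => //; [exact: is_bump0|by move=> y [x []]].
have [Lx|Lx] := pselect (L x); last first.
  exists H; split => // y [z [+ Lz Wz]]; rewrite inE => /orP[/eqP zx|zs].
    by rewrite zx in Lz.
  by apply: H1; exists z.
have [_ [h [hb h1 hP]]] := hW x Lx.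
exists (cup h H); split; [|exact: hP|].
  by rewrite -(setUT setT); exact: is_bump_cup.
move=> y [z [+ Lz Wz]]; rewrite inE => /orP[/eqP zx|zs].
  by apply/cup_eq1l/h1; rewrite -zx.
by apply: cup_eq1r; apply: H1; exists z.
Qed.

Lemma bump_compact (L : set X) : compact L ->
  exists2 H : C0, is_bump setT H & forall y, L y -> H y = 1.
Proof.
move=> cL; have [|x _|H [Hb _ H1]] := @compact_bump_ind L (fun=> True) cL.
- by [].
- by exists setT => //; exact: filterT.
- by exists H.
Qed.

End bumps.

(** * Completeness and uniform boundedness *)

Section linear_functions.
Context (K : nzRingType) (U V : lmodType K) (f : U -> V).
Hypothesis lf : linear f.

Let fL : {linear U -> V} := HB.pack f (GRing.isLinear.Build _ _ _ _ f lf).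

Lemma linear_fun0 : f 0 = 0. Proof. exact: (linear0 fL). Qed.
Lemma linear_funD u v : f (u + v) = f u + f v. Proof. exact: (linearD fL). Qed.
Lemma linear_funB u v : f (u - v) = f u - f v. Proof. exact: (linearB fL). Qed.
Lemma linear_funZ a u : f (a *: u) = a *: f u. Proof. exact: (linearZZ fL). Qed.

End linear_functions.

Lemma exists_le2 (K : numDomainType) (a b : K) : 0 < a -> 0 < b ->
  exists c, [/\ 0 < c, c <= a & c <= b].
Proof.
move=> a0 b0; have [ab|ba] := real_leP (gtr0_real a0) (gtr0_real b0).
  by exists a.
by exists b; split => //; exact: ltW.
Qed.

(** Completeness as a property, for normed modules that do not come packaged as
    complete ones. *)
Definition complete_space (K : numFieldType) (V : normedModType K) :=
  forall F : set_system V, ProperFilter F -> cauchy F -> cvg F.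

Section completeness.
Context (R : realType) (k : scalar_kind).
Local Notation K := (scalar_field R k).

Lemma half_pow_small (C e : K) : 0 <= C -> 0 < e -> exists n, C / 2 ^+ n < e.
Proof.
move=> C0 e0; have [n Cn] := scalar_archi (divr_ge0 C0 (ltW e0)).
exists n; rewrite ltr_pdivrMr ?exprn_gt0// mulrC -ltr_pdivrMr//.
by apply: (lt_le_trans Cn); rewrite -natrX ler_nat ltnW// ltn_expl.
Qed.

(** The bounds telescope to [`|u m - u n| <= r n - r m] for [n <= m], which makes
    the centers a Cauchy sequence. *)
Lemma nested_balls (V : normedModType K) (u : nat -> V) (r : nat -> K) :
  complete_space V -> (forall n, 0 <= r n) -> (forall n, r n.+1 <= r n / 2) ->
  (forall n, `|u n.+1 - u n| <= r n - r n.+1) ->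
  exists l, forall n, `|l - u n| <= r n.
Proof.
move=> cV r0 rS uS.
have ur n m : `|u (n + m)%N - u n| <= r n - r (n + m)%N.
  elim: m => [|m IH]; first by rewrite addn0 !subrr normr0.
  rewrite addnS -(subrKA (u (n + m)%N)) (le_trans (ler_normD _ _))//.
  by rewrite -[leRHS](subrKA (r (n + m)%N)) addrC lerD.
have ur' n m : (n <= m)%N -> `|u m - u n| <= r n.
  move=> nm; rewrite -(subnKC nm) (le_trans (ur _ _))//.
  by rewrite lerBlDr lerDl.
have rn n : r n <= r 0%N / 2 ^+ n.
  elim: n => [|n IH]; first by rewrite expr0 divr1.
  by rewrite (le_trans (rS n))// exprSr invfM mulrA ler_pM2r// invr_gt0 ltr0n.
have small (e : K) : 0 < e -> exists n, r n < e.
  by move=> /(half_pow_small (r0 0%N))[n re]; exists n; exact: le_lt_trans re.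
have : cvg (u n @[n --> \oo]).
  apply: cV; apply/cauchyP => e e0; have [N rN] := small _ e0.
  exists (u N), N => // m /= Nm; rewrite -ball_normE /= distrC.
  exact: le_lt_trans (ur' _ _ Nm) rN.
move=> /cvg_ex[l ul]; exists l => n; apply: ler_forall_gt0 => // [|e e0].
  exact: ger0_real.
have [N _ hN] := (@cvgrPdist_le _ _ _ _ _ u l).1 ul _ e0.
rewrite -(subrKA (u (n + N)%N)) (le_trans (ler_normD _ _))// addrC lerD//.
  by apply: ur'; exact: leq_addr.
by apply: hN => /=; exact: leq_addl.
Qed.

Lemma geometric_cvg (V : normedModType K) (u : nat -> V) (C : K) :
  complete_space V -> 0 <= C ->
  (forall n, `|u n.+1 - u n| <= C / 2 ^+ n) ->
  exists l, forall n, `|l - u n| <= 2 * C / 2 ^+ n.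
Proof.
move=> cV C0 uS; apply: nested_balls => // n.
- by rewrite divr_ge0 ?mulr_ge0 ?exprn_ge0.
- by rewrite exprSr invfM mulrA.
- apply: (le_trans (uS n)); rewrite exprS invfM mulrA.
  rewrite [X in _ - X / _]mulrAC mulfV ?pnatr_eq0// mul1r -mulrBl.
  by rewrite mulr_natl mulr2n addrK.
Qed.

Lemma complete_geometric (V : normedModType K) :
  (forall u : nat -> V, (forall n, `|u n.+1 - u n| <= 1 / 2 ^+ n) ->
    exists l, forall e, 0 < e -> exists2 n, 1 / 2 ^+ n < e & `|l - u n| < e) ->
  complete_space V.
Proof.
move=> cV F FF /cauchyP FC.
have p2 n : 0 < 1 / 2 ^+ n :> K by rewrite divr_gt0 ?exprn_gt0.
have /choice[u hu] : forall n, exists v, F (ball v (1 / 2 ^+ n.+1)).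
  by move=> n; exact: FC.
have [n|l hl] := cV u.
  have [v [uv uv']] := filter_ex (filterI (hu n) (hu n.+1)).
  rewrite -(subrKA v) (le_trans (ler_normD _ _))//.
  have -> : 1 / 2 ^+ n = 1 / 2 ^+ n.+1 + 1 / 2 ^+ n.+1 :> K.
    by rewrite [LHS]splitr exprSr invfM mulrA.
  move: uv uv'; rewrite -!ball_normE /= => uv uv'; rewrite lerD//.
    apply: (le_trans (ltW uv')); rewrite !mul1r lef_pV2 ?posrE ?exprn_gt0//.
    by rewrite ler_weXn2l// ler1n.
  by rewrite distrC ltW.
apply/cvg_ex; exists l; apply/cvgrPdist_lt => e e0.
have [n ne ln] := hl _ (divr_gt0 e0 (ltr0n K 2)).
apply: filterS (hu n) => v; rewrite -ball_normE /= => uv.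
rewrite -(subrKA (u n)) (le_lt_trans (ler_normD _ _))// [ltRHS]splitr ltrD//.
apply: (lt_trans uv); apply: le_lt_trans ne.
by rewrite !mul1r lef_pV2 ?posrE ?exprn_gt0// ler_weXn2l// ler1n.
Qed.

(** A fast Cauchy sequence of [W] lifts, increment by increment, to one of [V].
    This is how quotients of Banach spaces inherit completeness. *)
Lemma complete_lift (V W : normedModType K) (p : V -> W) :
  complete_space V -> linear p -> (forall v, `|p v| <= `|v|) ->
  (forall w r, `|w| < r -> exists2 v, p v = w & `|v| <= r) ->
  complete_space W.
Proof.
move=> cV lp pM lift; apply: complete_geometric => u uS.
have p2 n : 0 < 1 / 2 ^+ n :> K by rewrite divr_gt0 ?exprn_gt0.
have [v0 pv0 _] := lift (u 0%N) (`|u 0%N| + 1) (ltr_pwDr ltr01 (lexx _)).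
have /choice[d hd] : forall n, exists v,
    p v = u n.+1 - u n /\ `|v| <= 2 / 2 ^+ n.
  move=> n; have [|v] := lift (u n.+1 - u n) (2 / 2 ^+ n); last by exists v.
  by apply: (le_lt_trans (uS n)); rewrite ltr_pM2r ?invr_gt0 ?exprn_gt0// ltr1n.
pose v n := v0 + \sum_(i < n) d i.
have pv n : p (v n) = u n.
  elim: n => [|n IH]; first by rewrite /v big_ord0 addr0.
  by rewrite /v big_ord_recr /= addrA (linear_funD lp) IH (hd n).1 addrC subrK.
have [|n|l hl] := @geometric_cvg V v 2 cV; first by [].
  by rewrite /v big_ord_recr /= addrA addrC addrK (hd n).2.
exists (p l) => e e0.
have [n ne] := half_pow_small (mulr_ge0 (ler0n K 2) (ler0n K 2)) e0.
exists n.
  by apply: le_lt_trans ne; rewrite ler_pM2r ?invr_gt0 ?exprn_gt0// -natrM ler1n.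
by rewrite -pv -(linear_funB lp) (le_lt_trans (pM _))// (le_lt_trans (hl n)).
Qed.

(** Banach-Steinhaus. If it failed, each ball would contain a smaller one on
    which some [T i] exceeds any given bound; nesting such balls gives a point at
    which the [T i] are not bounded. *)
Lemma uniform_boundedness (V W : normedModType K) (I : Type) (A : set I)
    (T : I -> V -> W) :
  complete_space V -> (forall i, linear (T i)) ->
  (forall i, exists M, forall v, `|T i v| <= M * `|v|) ->
  (forall v, exists M, forall i, A i -> `|T i v| <= M) ->
  exists M, forall i, A i -> forall v, `|T i v| <= M * `|v|.
Proof.
move=> cV lT bT pT; apply: contrapT => nb.
have large (M : K) : exists2 i, A i & exists2 v, v != 0 & `|M| * `|v| < `|T i v|.
  apply: contrapT => h; apply: nb; exists `|M| => i Ai v.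
  rewrite real_leNgt ?ger0_real ?mulr_ge0//; apply/negP => Mv.
  apply: h; exists i => //; exists v => //.
  by apply: contraTneq Mv => ->; rewrite (linear_fun0 (lT i)) !normr0 mulr0 ltxx.
pose step (n : nat) (p q : V * K) := [/\ 0 < q.2, q.2 <= p.2 / 2,
  `|q.1 - p.1| <= p.2 / 2 & exists2 i, A i &
    forall y, `|y - q.1| <= q.2 -> n%:R <= `|T i y|].
have next n (p : V * K) : 0 < p.2 -> exists q, step n p q.
  case: p => x r /= r0; have [B hB] := pT x.
  pose M := 2 * (n.+1%:R + `|B|) / r.
  have M0 : 0 <= M by rewrite divr_ge0 ?mulr_ge0 ?addr_ge0 ?(ltW r0).
  have [i Ai [v vN0 Mv]] := large M.
  have nv0 : 0 < `|v| by rewrite normr_gt0.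
  have [N hN] := bT i.
  have r20 : 0 < r / 2 by rewrite divr_gt0.
  pose z := (r / 2 / `|v|) *: v.
  have nz : `|z| = r / 2.
    by rewrite normrZ ger0_norm ?divr_ge0 ?ltW// divfK// gt_eqF.
  have Tz : n.+1%:R + `|B| < `|T i z|.
    rewrite (linear_funZ (lT i)) normrZ ger0_norm ?divr_ge0 ?ltW//.
    rewrite -ltr_pdivrMl ?divr_gt0//; apply: le_lt_trans Mv.
    rewrite (ger0_norm M0) invf_div /M.
    rewrite le_eqVlt; apply/orP; left; apply/eqP.
    move: (n.+1%:R + `|B|) `|v| nv0 => c a a0.
    by rewrite invf_div [RHS]mulrC -[LHS]mulrA; congr (_ * _); rewrite mulrAC.
  have Txz : n.+1%:R < `|T i (x + z)|.
    rewrite (linear_funD (lT i)) addrC -[T i x]opprK.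
    apply: lt_le_trans (lerB_dist _ _).
    rewrite normrN ltrBrDr; apply: le_lt_trans Tz.
    rewrite lerD2l (le_trans (hB i Ai))// real_ler_norm// ger0_real//.
    exact: le_trans (hB i Ai).
  have N10 : 0 < (`|N| + 1)^-1 by rewrite invr_gt0 ltr_wpDl.
  have [s [s0 sr sN]] := exists_le2 r20 N10.
  exists (x + z, s); split => //=; first by rewrite addrC addKr nz.
  exists i => // y yz.
  have -> : y = (x + z) - (x + z - y) by rewrite opprB addrC subrK.
  rewrite (linear_funB (lT i)); apply: le_trans (lerB_dist _ _).
  rewrite lerBrDr; apply: le_trans (ltW Txz); rewrite -natr1 lerD2l.
  apply: (le_trans (le_mul_norm (normr_ge0 _) (normr_ge0 _) (hN _))).
  rewrite distrC; apply: (le_trans (ler_wpM2l (normr_ge0 _) yz)).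
  apply: (le_trans (ler_wpM2l (normr_ge0 _) sN)).
  by rewrite ler_pdivrMr ?mul1r ?lerDl// ltr_wpDl.
have /choice[f hf] : forall np : nat * (V * K), exists q, 0 < np.2.2 ->
    step np.1 np.2 q.
  move=> [n p] /=; have [p0|p0] := pselect (0 < p.2); last by exists p.
  by have [q] := next n p p0; exists q.
pose s := fix s n : V * K := if n is m.+1 then f (m, s m) else (0, 1).
have s0 n : 0 < (s n).2.
  by elim: n => [|n /= /(hf (n, s n))[]//]; exact: ltr01.
have sS n : step n (s n) (s n.+1) by exact: (hf (n, s n)) (s0 n).
have [||n|l hl] := @nested_balls _ (fun n => (s n).1) (fun n => (s n).2) cV.
- by move=> n; exact: ltW.
- by move=> n; have [] := sS n.
- have [_ h1 h2 _] := sS n; apply: (le_trans h2).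
  by rewrite lerBrDr [leRHS]splitr lerD2l.
have [M hM] := pT l; have [n Mn] := scalar_archi (normr_ge0 M).
have [_ _ _ [i Ai /(_ l (hl n.+1)) nT]] := sS n.
have := lt_le_trans Mn (le_trans nT (hM i Ai)).
rewrite ger0_norm ?ltxx//; exact: le_trans (hM i Ai).
Qed.

End completeness.

(** * Neighborhoods in a Banach bundle *)

Section bundle_neighborhoods.
Context (K : numFieldType) (X : topologicalType) (E : banach_bundle K X).

Lemma fadd_nbhs x (u v : fiber E x) (W : set (total E)) :
  nbhs (point E (u + v)) W ->
  exists U V, [/\ nbhs (point E u) U, nbhs (point E v) V &
    forall y (a b : fiber E y), U (point E a) -> V (point E b) ->
      W (point E (a + b))].
Proof.
move=> hW; set A := [set ee : total E * total E | proj ee.1 = proj ee.2].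
have Auv : A (point E u, point E v) by rewrite /A/= !proj_point.
have := (@subspace_continuousP _ A _ (@fadd _ _ E)).1
  (@fadd_continuous _ _ E) _ Auv.
have -> : fadd (point E u, point E v) = point E (u + v).
  by rewrite /fadd/= proj_point !pointK.
move=> /(_ W hW) [[U V]/= [hU hV] UV].
exists U, V; split => // y a b Ua Vb.
have /= := UV (point E a, point E b) (conj Ua Vb).
by rewrite /A/= !proj_point /fadd/= proj_point !pointK; apply.
Qed.

Lemma fscale_nbhs x (a : K) (v : fiber E x) (W : set (total E)) :
  nbhs (point E (a *: v)) W ->
  exists N V, [/\ nbhs a N, nbhs (point E v) V &
    forall y b (w : fiber E y), N b -> V (point E w) -> W (point E (b *: w))].
Proof.
move=> hW; have [|[N V]/= [hN hV] NV] :=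
    @fscale_continuous _ _ E (a, point E v) W.
  by rewrite /fscale/= proj_point !pointK.
exists N, V; split => // y b w Nb Vw.
by have := NV (b, point E w) (conj Nb Vw); rewrite /fscale/= proj_point pointK.
Qed.

Lemma proj_nbhs x (v : fiber E x) (U : set (total E)) :
  nbhs (point E v) U -> \forall y \near x, exists w : fiber E y, U (point E w).
Proof.
rewrite nbhsE => -[U' [oU' U'v] U'U].
have : nbhs x (@proj _ _ E @` U').
  apply: open_nbhs_nbhs; split; first exact: proj_open.
  by exists (point E v) => //; exact: proj_point.
apply: filterS => y [e U'e ey].
by exists (coord y e); rewrite coordK//; exact: U'U.
Qed.

Lemma norm_nbhs x (v : fiber E x) (r : K) : `|v| < r ->
  nbhs (point E v) [set e | fnorm e < r].
Proof.
move=> vr; apply: open_nbhs_nbhs; split; first exact: fnorm_usc.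
by rewrite /= fnorm_point.
Qed.

Lemma proj_near x (v : fiber E x) (P : set X) :
  nbhs x P -> nbhs (point E v) (@proj _ _ E @^-1` P).
Proof. by move=> xP; apply: (@proj_continuous _ _ E); rewrite proj_point. Qed.

(** Continuity of the addition at [(v, 0)], combined with the description of the
    neighborhoods of zero vectors. *)
Lemma tube_sub_nbhs x (v : fiber E x) (W : set (total E)) :
  nbhs (point E v) W ->
  exists2 d : K, 0 < d & exists2 U, nbhs (point E v) U &
    forall y (a b : fiber E y), U (point E a) -> `|b - a| <= d -> W (point E b).
Proof.
rewrite -{1}(addr0 v) => /fadd_nbhs[U [V [hU hV UV]]].
move: hV; rewrite nbhsE => -[V' [oV' V'0] V'V].
have [d d0 [Q [oQ Qx dQ]]] := zero_nbhs oV' V'0.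
exists d => //; exists (U `&` (@proj _ _ E @^-1` Q)).
  by apply: filterI => //; apply/proj_near/open_nbhs_nbhs.
move=> y a b [Ua]; rewrite /= proj_point => Qy ba.
rewrite -(subrK a b) addrC; apply: UV => //; apply/V'V/dQ.
by rewrite /= proj_point fnorm_point.
Qed.

(** The subtraction is continuous at [(v, v)] and the norm is small near 0. *)
Lemma thin_nbhs x (v : fiber E x) (d : K) : 0 < d ->
  exists2 U, nbhs (point E v) U &
    forall y (a b : fiber E y), U (point E a) -> U (point E b) -> `|a - b| <= d.
Proof.
move=> d0; have : nbhs (point E (v - v)) [set e | fnorm e < d].
  by apply: norm_nbhs; rewrite subrr normr0.
move=> /fadd_nbhs[U [V [hU hV UV]]].
move: hV; rewrite -scaleN1r => /fscale_nbhs[N [V' [hN hV' NV]]].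
exists (U `&` V'); first exact: filterI.
move=> y a b [Ua _] [_ Vb]; have := UV _ a (- b) Ua.
rewrite /= fnorm_point => h; apply/ltW/h; rewrite -scaleN1r.
by apply: NV => //; exact: nbhs_singleton hN.
Qed.

Section tubes.
Context (s : forall x, fiber E x).
Hypothesis cs : continuous (fun x => point E (s x)).

(** Translation by a continuous section [s] carries tubes around the zero section
    to tubes around [s]; with [section_tube_sub_nbhs], the latter form a
    neighborhood basis at the points of [s]. *)
Lemma tube_nbhs x (v : fiber E x) (r : K) : `|v - s x| < r ->
  nbhs (point E v) [set e | `|coord (proj e) e - s (proj e)| < r].
Proof.
move=> /norm_nbhs /fadd_nbhs[U [V [hU hV UV]]].
have : nbhs x [set y | V (point E (- s y))].
  have cN : continuous (fun x => point E (- s x)).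
    move=> y W; rewrite -scaleN1r => /fscale_nbhs[N [V' [hN hV' NV]]].
    have sV' : \forall z \near y, V' (point E (s z)) := cs hV'.
    suff: \forall z \near y, W (point E (- s z)) by [].
    apply: filterS sV' => z V'z; rewrite -scaleN1r.
    by apply: NV => //; exact: nbhs_singleton hN.
  exact: (cN x _ hV).
move=> /(proj_near v) hV'; apply: filterS (filterI hU hV') => e [Ue /= Ve].
have := UV (proj e) (coord (proj e) e) (- s (proj e)).
by rewrite coordK// /= fnorm_point; apply.
Qed.

Lemma section_tube_sub_nbhs x (W : set (total E)) : nbhs (point E (s x)) W ->
  exists2 d : K, 0 < d & \forall y \near x, forall w : fiber E y,
    `|w - s y| <= d -> W (point E w).
Proof.
move=> /tube_sub_nbhs[d d0 [U hU dU]]; exists d => //.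
have sU : \forall y \near x, U (point E (s y)) := cs hU.
by apply: filterS sU => y Uy w; exact: dU.
Qed.

End tubes.

End bundle_neighborhoods.

(** * Almost continuous sections *)

Section almost_continuity.
Context (K : numFieldType) (X : topologicalType) (E : banach_bundle K X).
Implicit Types (s t : forall x, fiber E x) (e : X -> K).

Lemma section_nbhsP s x : {for x, continuous (fun x => point E (s x))} <->
  forall W, nbhs (point E (s x)) W -> \forall y \near x, W (point E (s y)).
Proof. by split => h W hW; exact: h. Qed.

(** Continuity of a section up to an error [e]. Unlike continuity it can be met
    by arbitrary local choices, and unlike membership in a small neighborhood it
    is visibly stable under sums and multiplication by functions. *)
Definition almost_continuous s x e := forall W, nbhs (point E (s x)) W ->
  \forall y \near x, exists2 w : fiber E y, W (point E w) & `|s y - w| <= e y.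

Lemma almost_continuous0 s x :
  almost_continuous s x (fun=> 0) <-> {for x, continuous (fun x => point E (s x))}.
Proof.
split=> [h|/section_nbhsP h W /h]; first apply/section_nbhsP => W /h.
  apply: filterS => y [w Ww].
  by rewrite normr_le0 subr_eq0 => /eqP ->.
by apply: filterS => y; exists (s y) => //; rewrite subrr normr0.
Qed.

Lemma almost_continuousS s x e e' : (\forall y \near x, e y <= e' y) ->
  almost_continuous s x e -> almost_continuous s x e'.
Proof.
move=> ee' h W /h; apply: filter_app; apply: filterS ee' => y ee [w Ww sw].
by exists w => //; exact: le_trans ee.
Qed.

Lemma almost_continuous_near s t x e : (\forall y \near x, s y = t y) ->
  almost_continuous s x e -> almost_continuous t x e.
Proof.
move=> st h W; rewrite -(nbhs_singleton st) => /h; apply: filter_app.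
by apply: filterS st => y ->.
Qed.

Lemma almost_continuousD s t x e e' :
  almost_continuous s x e -> almost_continuous t x e' ->
  almost_continuous (fun x => s x + t x) x (fun y => e y + e' y).
Proof.
move=> hs ht W /fadd_nbhs[U [V [/hs hU /ht hV UV]]].
apply: filterS (filterI hU hV) => y [[u Uu su] [v Vv tv]].
exists (u + v); first exact: UV.
by rewrite opprD addrACA (le_trans (ler_normD _ _))// lerD.
Qed.

Lemma almost_continuousZ (a : X -> K) s x e : {for x, continuous a} ->
  almost_continuous s x e ->
  almost_continuous (fun x => a x *: s x) x (fun y => `|a y| * e y).
Proof.
move=> ca hs W /fscale_nbhs[N [V [hN /hs hV NV]]].
have {}hN : \forall y \near x, N (a y) := ca _ hN.
apply: filterS (filterI hN hV) => y [Ny [v Vv sv]].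
by exists (a y *: v); [exact: NV|rewrite -scalerBr normrZ ler_wpM2l].
Qed.

(** Since the projection is open, every neighborhood of [s x] contains over each
    nearby point a vector of norm less than [2 e]. *)
Lemma almost_continuous_bounded s x (e : K) : 0 < e ->
  (\forall y \near x, `|s y| <= e) -> almost_continuous s x (fun=> 3 * e).
Proof.
move=> e0 se W hW; have : `|s x| < 2 * e.
  by rewrite (le_lt_trans (nbhs_singleton se))// ltr_pMl// ltr1n.
move=> /norm_nbhs hW'; apply: filterS2 se (proj_nbhs (filterI hW hW')).
move=> y sy [w [Ww]]; rewrite /= fnorm_point => we; exists w => //.
rewrite (le_trans (ler_normB _ _))// (natrD _ 1 2) mulrDl mul1r lerD//.
exact: ltW.
Qed.

Lemma almost_continuous_small s x :
  (forall e : K, 0 < e -> almost_continuous s x (fun=> e)) ->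
  {for x, continuous (fun x => point E (s x))}.
Proof.
move=> h; apply/section_nbhsP => W /tube_sub_nbhs[d d0 [U hU dU]].
by apply: filterS (h d d0 U hU) => y [w Uw]; exact: dU.
Qed.

(** Split [s] into [t] and the small section [s - t]. *)
Lemma almost_continuous_limit s x :
  (forall e : K, 0 < e -> exists2 t, almost_continuous t x (fun=> e) &
    \forall y \near x, `|s y - t y| <= e) ->
  {for x, continuous (fun x => point E (s x))}.
Proof.
move=> h; apply: almost_continuous_small => e e0.
have d0 : 0 < e / 4 by rewrite divr_gt0.
have [t ht st] := h _ d0.
have := almost_continuousD ht (almost_continuous_bounded d0 st).
have -> : (fun y : X => e / 4 + 3 * (e / 4)) = fun=> e.
  apply: funext => _; rewrite -[X in X + _]mul1r -mulrDl -(natrD _ 1 3).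
  by rewrite mulrC divfK// pnatr_eq0.
apply: almost_continuous_near; apply: nearW => y.
by rewrite addrC subrK.
Qed.

(** The values of [t] are chosen, arbitrarily and within distance [e] of those of
    [s], in one thin open neighborhood of [s x]. Two vectors of it over the same
    base point are at distance at most [d], whatever the choice. *)
Lemma almost_continuous_improve s x (e d : K) : 0 < d ->
  0 <= e -> almost_continuous s x (fun=> e) ->
  exists t U, [/\ open U, U x, t x = s x &
    forall y, U y -> almost_continuous t y (fun=> d) /\ `|s y - t y| <= e].
Proof.
move=> d0 e0 hs; have [N + Nd] := thin_nbhs (s x) d0.
rewrite nbhsE => -[N' [oN' N's] N'N].
set Q := [set y | exists2 w : fiber E y, N' (point E w) & `|s y - w| <= e].
have xQ : nbhs x Q by apply: hs; exact: open_nbhs_nbhs.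
have /all_sig[t ht] : forall y, {w : fiber E y |
    (Q y -> N' (point E w) /\ `|s y - w| <= e) /\ (y = x -> w = s y)}.
  move=> y; apply: cid; have [->|yx] := pselect (y = x).
    by exists (s x); split => // _; rewrite subrr normr0.
  by have [[w Nw sw]|nQ] := pselect (Q y); [exists w|exists 0].
exists t, Q^°; split => //; first exact: open_interior.
  exact: (ht x).2.
move=> y yQ; have Qy := interior_subset yQ.
split; last exact: ((ht y).1 Qy).2.
move=> W hW; have hN : nbhs (point E (t y)) N'.
  exact: open_nbhs_nbhs (conj oN' ((ht y).1 Qy).1).
apply: filterS2 yQ (proj_nbhs (filterI hW hN)) => z Qz [w [Ww Nw]].
by exists w => //; apply: Nd; apply: N'N => //; exact: ((ht z).1 Qz).1.
Qed.

End almost_continuity.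

(** * Continuous sections through every point *)

Section sections_through_points.
Context (R : realType) (k : scalar_kind) (X : topologicalType).
Local Notation K := (scalar_field R k).
Context (E : banach_bundle K X).
Hypotheses (hausX : hausdorff_space X) (lcX : locally_compact [set: X]).
Implicit Types s t : forall x, fiber E x.

Lemma C0_continuous (h : C0 R k X) : continuous (h : X -> K).
Proof. by have [] := sec_mem h. Qed.

Lemma almost_continuous_bumpZ (U : set X) (h : C0 R k X) s (d : K) : open U ->
  is_bump U h -> (forall y, U y -> almost_continuous s y (fun=> d)) ->
  forall y, almost_continuous (fun z => (h z : K) *: s z) y (fun z => h z * d).
Proof.
move=> oU hb hs y; have [Uy|Uy] := pselect (U y).
  have := almost_continuousZ (@C0_continuous h y) (hs y Uy).
  apply: almost_continuousS; apply: nearW => z.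
  by rewrite ger0_norm// (bump_ge0 _ hb).
have h0 := bump_near_off hb Uy.
apply: (@almost_continuousS _ _ _ _ _ (fun=> 0)).
  by apply: filterS h0 => z ->; rewrite mul0r.
apply: (@almost_continuous_near _ _ _ (fun z => 0)).
  by apply: filterS h0 => z ->; rewrite scale0r.
by apply/almost_continuous0; exact: zero_section_continuous.
Qed.

(** The local modifications of [almost_continuous_improve] are glued with bumps:
    errors and distances are stable under convex combinations. *)
Lemma almost_continuous_glue (L : set X) s x (e d : K) :
  compact L -> L x -> 0 <= e -> 0 < d ->
  (forall y, L y -> almost_continuous s y (fun=> e)) ->
  exists t, [/\ t x = s x, forall y, almost_continuous t y (fun=> d) &
    forall y, L y -> `|s y - t y| <= e].
Proof.
move=> cL Lx e0 d0 hs.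
pose P (H : C0 R k X) := exists t, [/\ t x = (H x : K) *: s x,
  forall y, almost_continuous t y (fun z => H z * d) &
  forall y, `|(H y : K) *: s y - t y| <= H y * e].
have [| |H [Hb [t [tx ht st]] H1]] := @compact_bump_ind _ _ _ hausX lcX L P cL.
- exists (fun=> 0); split => [|y|y]; first by rewrite scale0r.
    apply: (@almost_continuousS _ _ _ _ _ (fun=> 0)).
      by apply: nearW => z; rewrite mul0r.
    by apply/almost_continuous0; exact: zero_section_continuous.
  by rewrite scale0r subrr normr0 mul0r.
- move=> z Lz; have [r [U [oU Uz rz hr]]] :=
    almost_continuous_improve d0 e0 (hs z Lz).
  (* Unless z = x, the bumps around z avoid x and do not change the value there. *)
  pose V := U `&` [set y | y = x -> x = z].
  have oV : open V.
    apply: openI => //; have [->|xz] := pselect (x = z).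
      have -> : [set y | y = z -> z = z] = setT by apply/seteqP; split.
      exact: openT.
    have -> : [set y | y = x -> x = z] = ~` [set x].
      by apply/seteqP; split => y yx // /yx.
    apply: closed_openC; apply: accessible_closed_set1.
    exact: hausdorff_accessible.
  exists V; first by apply: open_nbhs_nbhs; split => //; split.
  move=> h H hb Hb [t [tx ht st]].
  exists (fun y => (1 - (h y : K)) *: t y + (h y : K) *: r y); split => [|y|y].
  + rewrite cupE tx scalerA scalerDl.
    have [xz|xz] := pselect (x = z); first by have -> : r x = s x by rewrite xz.
    have -> : h x = 0 :> K by apply: (bump_off hb) => -[_ /(_ erefl)].
    by rewrite !scale0r.
  + have c1 : continuous (fun y => 1 - (h y : K)).
      by move=> w; apply: cvgB; [exact: cvg_cst|exact: C0_continuous].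
    have hrb : forall y, almost_continuous
        (fun z => (h z : K) *: r z) y (fun z => h z * d).
      by apply: (almost_continuous_bumpZ oV hb) => w [/hr[]].
    have := almost_continuousD (almost_continuousZ (c1 y) (ht y)) (hrb y).
    apply: almost_continuousS; apply: nearW => w.
    by rewrite ger0_norm ?(bump_onem_ge0 _ hb)// mulrA -mulrDl -cupE.
  + rewrite cupE [_ * e]mulrDl [(_ + _) *: s y]scalerDl -scalerA opprD addrACA.
    rewrite -!scalerBr.
    rewrite (le_trans (ler_normD _ _))// -mulrA !normrZ.
    rewrite (ger0_norm (bump_onem_ge0 _ hb)) (ger0_norm (bump_ge0 _ hb)).
    apply: lerD; first by apply: ler_wpM2l (bump_onem_ge0 _ hb) _ _ (st y).
    have [[/hr[_ sr] _]|Vy] := pselect (V y).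
      by apply: ler_wpM2l (bump_ge0 _ hb) _ _ sr.
    by rewrite (bump_off hb Vy) !mul0r.
- exists t; split => [|y|y Ly]; first by rewrite tx H1 ?scale1r.
    apply: almost_continuousS (ht y); apply: nearW => z.
    by rewrite ler_piMl ?(bump_le1 _ Hb)// ltW.
  by have := st y; rewrite H1// scale1r mul1r.
Qed.

Lemma Gamma0_bump (U : set X) (h : C0 R k X) s : open U -> is_bump U h ->
  (forall y, U y -> {for y, continuous (fun x => point E (s x))}) ->
  Gamma0_mem (fun y => (h y : K) *: s y).
Proof.
move=> oU hb cs; split=> [y|e e0].
  apply/almost_continuous0.
  have := @almost_continuous_bumpZ U h s 0 oU hb _ y.
  have -> : (fun z => h z * 0) = fun=> 0 :> K by apply: funext => z; rewrite mulr0.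
  by apply => z /cs /almost_continuous0.
have [_ [C [cC _ _ Ch]]] := hb.
by exists C; split => // y /Ch ->; rewrite scale0r normr0 ltW.
Qed.

(** A section that is zero except at one point is almost continuous with a
    finite error; halving the error repeatedly near the point, without changing
    the value there, converges to a continuous section. *)
Lemma section_through_point x (v : fiber E x) : exists s : Gamma0 E, s x = v.
Proof.
have [L [xL cL clL]] := locally_compact_nbhs lcX x.
have Lx : L x := nbhs_singleton xL.
pose C := 3 * (`|v| + 1).
have v10 : 0 < `|v| + 1 by rewrite ltr_wpDl.
have C0 : 0 < C by rewrite mulr_gt0.
have p2 n : 0 < C / 2 ^+ n by rewrite divr_gt0 ?exprn_gt0.
pose good (n : nat) (s : forall x, fiber E x) :=
  forall y, almost_continuous s y (fun=> C / 2 ^+ n).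
pose s0 y : fiber E y := if y == x then coord y (point E v) else 0.
have s0x : s0 x = v by rewrite /s0 eqxx pointK.
have s0_good : good 0%N s0.
  move=> y; rewrite expr0 divr1; apply: almost_continuous_bounded => //.
  apply: nearW => z; rewrite /s0; case: eqP => [->|_].
    by rewrite pointK lerDl.
  by rewrite normr0 ltW.
have /choice[f hf] : forall ns : nat * (forall x, fiber E x), exists t,
    good ns.1 ns.2 -> [/\ t x = ns.2 x, good ns.1.+1 t &
      forall y, L y -> `|ns.2 y - t y| <= C / 2 ^+ ns.1].
  move=> [n s] /=; have [gs|gs] := pselect (good n s); last by exists s.
  have [t [tx gt st]] := almost_continuous_glue cL Lx (ltW (p2 n)) (p2 n.+1)
    (fun y _ => gs y).
  by exists t.
pose s := fix s n := if n is m.+1 then f (m, s m) else s0.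
have s_good n : good n (s n).
  by elim: n => [//|n IH] /=; have [] := hf (n, s n) IH.
have sx n : s n x = v.
  by elim: n => [//|n <-] /=; have [] := hf (n, s n) (s_good n).
have /all_sig[l hl] : forall y, {l : fiber E y |
    L y -> forall n, `|l - s n y| <= 2 * C / 2 ^+ n}.
  move=> y; apply: cid; have [Ly|Ly] := pselect (L y); last by exists 0.
  have [||n|l hl] := @geometric_cvg _ _ (fiber E y) (fun n => s n y) C.
  - exact: cauchy_cvg.
  - exact: ltW.
  - by have [_ _ /(_ y Ly)] := hf (n, s n) (s_good n); rewrite distrC.
  - by exists l.
have C2 : 0 <= 2 * C by rewrite mulr_ge0 ?ltW.
have lx : l x = v.
  apply/eqP; rewrite -subr_eq0 -normr_le0; apply: ler_forall_gt0 => // e e0.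
  have [n ne] := half_pow_small C2 e0.
  by rewrite add0r -{1}(sx n) (le_trans (hl x Lx n))// ltW.
have cl y : L^° y -> {for y, continuous (fun x => point E (l x))}.
  move=> Ly; apply: almost_continuous_limit => e e0.
  have [n ne] := half_pow_small C2 e0; exists (s n).
    apply: almost_continuousS (s_good n y); apply: nearW => _.
    apply: le_trans (ltW ne).
    by rewrite ler_pM2r ?invr_gt0 ?exprn_gt0// ler_pMl// ler1n.
  by apply: filterS Ly => z Lz; apply: (le_trans (hl z Lz n)); exact: ltW.
have oL := open_interior L.
have [h hb h1] := bump_exists R k hausX lcX (open_nbhs_nbhs (conj oL xL)).
exists (MkSection (P := Gamma0_submodule E) (Gamma0_bump oL hb cl)).
by rewrite /= (nbhs_singleton h1) scale1r.
Qed.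

End sections_through_points.

(** * Spaces of sections are AM-modules *)

Section Gamma0_topology.
Context (R : realType) (k : scalar_kind) (X : topologicalType).
Local Notation K := (scalar_field R k).
Context (E : banach_bundle K X).

Lemma Gamma0_continuous (s : Gamma0 E) : continuous (fun x => point E (s x)).
Proof. by have [] := sec_mem s. Qed.

Lemma Gamma0_norm_ge (s : Gamma0 E) x : `|s x| <= `|s|.
Proof. exact: sup_norm_ge. Qed.

Lemma Gamma0_norm_le (s : Gamma0 E) M : 0 <= M -> (forall x, `|s x| <= M) ->
  `|s| <= M.
Proof. exact: sup_norm_le. Qed.

Lemma Gamma0_mem_limit (s : forall x, fiber E x) :
  (forall e : K, 0 < e -> exists t : Gamma0 E, forall x, `|s x - t x| <= e) ->
  Gamma0_mem s.
Proof.
move=> h; split=> [x|e e0].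
  apply: almost_continuous_limit => e /h[t st]; exists t; last exact: nearW.
  apply: (@almost_continuousS _ _ _ _ _ (fun=> 0)).
    by apply: nearW => y; exact: le_trans (st y).
  by apply/almost_continuous0; exact: Gamma0_continuous.
have e20 : 0 < e / 2 by rewrite divr_gt0.
have [t st] := h _ e20; have [_ /(_ _ e20)[L [cL tL]]] := sec_mem t.
exists L; split => // x Lx; rewrite -(subrK (t x) (s x)).
by rewrite (le_trans (ler_normD _ _))// [leRHS]splitr lerD ?tL.
Qed.

Lemma Gamma0_complete : complete_space (Gamma0 E : normedModType K).
Proof.
apply: complete_geometric => u uS.
have /all_sig[l hl] : forall y, {l : fiber E y |
    forall n, `|l - u n y| <= 2 * 1 / 2 ^+ n}.
  move=> y; apply: cid; apply: geometric_cvg => //; first exact: cauchy_cvg.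
  by move=> n; apply: le_trans (uS n); exact: (Gamma0_norm_ge (u n.+1 - u n)).
have small (e : K) : 0 < e -> exists2 n, 1 / 2 ^+ n < e &
    forall y, `|l y - u n y| <= e / 2.
  move=> e0; have [n ne] := half_pow_small (ler0n K 4) e0.
  have e4 : 2 * (2 * 1 / 2 ^+ n) < e.
    by rewrite mulr1 !mulrA -natrM.
  exists n.
    apply: le_lt_trans ne.
    by rewrite ler_pM2r ?invr_gt0 ?exprn_gt0// ler1n.
  move=> y; apply: (le_trans (hl y n)).
  by rewrite ler_pdivlMr// mulrC ltW.
have lG : Gamma0_mem l.
  apply: Gamma0_mem_limit => e /[dup] e0 /small[n _ hn]; exists (u n) => y.
  by apply: (le_trans (hn y)); rewrite ler_pdivrMr// ler_pMr// ler1n.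
exists (MkSection (P := Gamma0_submodule E) lG) => e /[dup] e0 /small[n ne hn].
exists n => //; apply: le_lt_trans (_ : e / 2 < e).
  by apply: Gamma0_norm_le => //; rewrite divr_ge0 ?ltW.
by rewrite ltr_pdivrMr// ltr_pMr// ltr1n.
Qed.

End Gamma0_topology.

Lemma closure_normP (K : numFieldType) (V : normedModType K) (A : set V) v :
  closure A v <-> forall e, 0 < e -> exists2 a, A a & `|v - a| <= e.
Proof.
split=> [clA e e0|h B /nbhs_normP[e /= e0 eB]].
  have [a [Aa]] := clA _ (nbhsx_ballx v _ e0).
  by rewrite -ball_normE /= => va; exists a => //; exact: ltW.
have e20 : 0 < e / 2 by rewrite divr_gt0.
have [a Aa va] := h _ e20; exists a; split => //; apply: eB => /=.
by rewrite (le_lt_trans va)// ltr_pdivrMr// ltr_pMr// ltr1n.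
Qed.

Lemma max_dist (K : numDomainType) (p q a b : K) :
  0 <= p -> 0 <= q -> 0 <= a -> 0 <= b ->
  `|Num.max p q - Num.max a b| <= `|p - a| \/
  `|Num.max p q - Num.max a b| <= `|q - b|.
Proof.
move=> /ger0_real rp /ger0_real rq /ger0_real ra /ger0_real rb.
have aux (x y z w : K) : x \is Num.real -> y \is Num.real -> z <= x -> w <= y ->
    `|x - y| <= `|z - y| \/ `|x - y| <= `|x - w|.
  move=> rx ry zx wy; have [xy|yx] := real_leP rx ry.
    left; rewrite ler0_norm ?subr_le0; last exact: le_trans xy.
    by rewrite opprB lerB.
  right; rewrite ger0_norm ?subr_ge0; last exact: le_trans (ltW yx).
  by rewrite lerB.
have [pq|qp] := real_leP rp rq; have [ab|ba] := real_leP ra rb.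
- by right.
- by apply: aux => //; exact: ltW.
- by case: (aux p b q a rp rb (ltW qp) ab); [right|left].
- by left.
Qed.

Lemma scale_max_dist (K : numFieldType) (V : normedModType K) (v : V)
    (p q a b e : K) : 0 <= p -> 0 <= q -> 0 <= a -> 0 <= b ->
  `|p *: v - a *: v| <= e -> `|q *: v - b *: v| <= e ->
  `|Num.max p q *: v - Num.max a b *: v| <= e.
Proof.
rewrite -!scalerBl !normrZ => p0 q0 a0 b0 pa qb.
have [h|h] := max_dist p0 q0 a0 b0.
  by apply: le_trans pa; rewrite ler_wpM2r.
by apply: le_trans qb; rewrite ler_wpM2r.
Qed.

(** The coefficient can only be the quotient of the norms, and approximating [u]
    by [a *: v] controls the error of this choice. *)
Lemma ray_closed (K : numFieldType) (V : normedModType K) (u v : V) :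
  (forall e, 0 < e -> exists2 a, 0 <= a & `|u - a *: v| <= e) ->
  exists2 a, 0 <= a & u = a *: v.
Proof.
move=> h; have small (w : V) : (forall e, 0 < e -> `|w| <= e) -> w = 0.
  move=> w0; apply/eqP; rewrite -normr_le0.
  by apply: ler_forall_gt0 => // e e0; rewrite add0r w0.
have [v0|v0] := eqVneq v 0.
  exists 0 => //; rewrite v0 scaler0; apply: small => e /h[a _].
  by rewrite v0 scaler0 subr0.
exists (`|u| / `|v|); first by rewrite divr_ge0.
apply/eqP; rewrite -subr_eq0; apply/eqP/small => e e0.
have e20 : 0 < e / 2 by rewrite divr_gt0.
have [a a0 ua] := h _ e20.
rewrite -(subrKA (a *: v)) (le_trans (ler_normD _ _))// [leRHS]splitr lerD//.
rewrite -scalerBl normrZ -[X in _ * X]normr_id -normrM mulrBl divfK ?normr_eq0//.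
rewrite -{1}(ger0_norm a0) -normrZ distrC.
exact: le_trans (ler_dist_dist _ _) ua.
Qed.

Section C0_max.
Context (R : realType) (k : scalar_kind) (X : topologicalType).
Local Notation K := (scalar_field R k).
Implicit Types f g : C0 R k X.

Lemma C0_abs_mem f : C0_mem (fun x => `|f x : K|).
Proof.
have [cf Vf] := sec_mem f; split; first by move=> x; apply: cvg_norm; exact: cf.
by under [X in vanishing X]eq_fun do rewrite normr_id.
Qed.

Definition C0_abs f : C0 R k X := MkSection (P := C0_submodule R k X) (C0_abs_mem f).

(** The maximum written with the norm, whose continuity does not depend on the
    kind of scalars. *)
Definition C0_max f g : C0 R k X := (2^-1 : K) *: (f + g + C0_abs (f - g)).

Lemma C0_maxE f g x : 0 <= (f x : K) -> 0 <= (g x : K) ->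
  C0_max f g x = Num.max (f x : K) (g x).
Proof.
move=> f0 g0; have /= -> : C0_max f g x = 2^-1 * (f x + g x + `|f x - g x|) by [].
have [fg|gf] := real_leP (ger0_real f0) (ger0_real g0).
  by rewrite addrC addrA subrK mulrDr !(mulrC 2^-1) -splitr.
by rewrite addrACA subrr addr0 mulrDr !(mulrC 2^-1) -splitr.
Qed.

Lemma C0_max_ge0 f g : C0_nonneg f -> C0_nonneg g -> C0_nonneg (C0_max f g).
Proof.
move=> f0 g0 x; rewrite C0_maxE//.
by case: (real_leP (ger0_real (f0 x)) (ger0_real (g0 x))) => _; rewrite ?f0 ?g0.
Qed.

Lemma C0_max_gel f g x : C0_nonneg f -> C0_nonneg g ->
  (f x : K) <= C0_max f g x.
Proof.
move=> f0 g0; rewrite C0_maxE//.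
by case: (real_leP (ger0_real (f0 x)) (ger0_real (g0 x))).
Qed.

Lemma C0_max_ger f g x : C0_nonneg f -> C0_nonneg g ->
  (g x : K) <= C0_max f g x.
Proof.
move=> f0 g0; rewrite C0_maxE//.
by case: (real_leP (ger0_real (f0 x)) (ger0_real (g0 x))) => // /ltW.
Qed.

End C0_max.

Section Gamma0_AM.
Context (R : realType) (k : scalar_kind) (X : topologicalType).
Local Notation K := (scalar_field R k).
Context (E : banach_bundle K X).
Hypotheses (hausX : hausdorff_space X) (lcX : locally_compact [set: X]).
Local Notation act := (@Gamma0_act R k X E).

Lemma Gamma0_actE f (s : Gamma0 E) x : act f s x = (f x : K) *: s x.
Proof. by []. Qed.

Lemma Gamma0_cutoff (s : Gamma0 E) (e : K) : 0 < e ->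
  exists h : C0 R k X, `|s - act h s| <= e.
Proof.
move=> e0; have [_ /(_ e e0)[L [cL sL]]] := sec_mem s.
have [h hb h1] := bump_compact R k hausX lcX cL.
exists h; apply: Gamma0_norm_le => [|x]; first exact: ltW.
have -> : (s - act h s) x = (1 - (h x : K)) *: s x.
  by rewrite scalerBl scale1r.
have [Lx|/sL sx] := pselect (L x).
  by rewrite h1// subrr scale0r normr0 ltW.
rewrite normrZ (ger0_norm (bump_onem_ge0 _ hb)) -[leRHS]mul1r.
by rewrite ler_pM// ?(bump_onem_ge0 _ hb)// gerBl (bump_ge0 _ hb).
Qed.

Lemma Gamma0_banach_module : is_banach_module act.
Proof.
split; first exact: Gamma0_complete.
- split=> [f a s t|s a f g]; apply: sections_ext => x /=.
    by rewrite scalerDr !scalerA [a * _]mulrC.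
  by rewrite scalerDl scalerA.
- by move=> f g s; apply: sections_ext => x /=; rewrite scalerA.
- move=> f s; apply: Gamma0_norm_le => [|x]; first by rewrite mulr_ge0.
  rewrite /= normrZ ler_pM ?Gamma0_norm_ge//.
  exact: (@sup_norm_ge R k X (fun=> K : normedModType K) _ f x).
- apply/seteqP; split => // s _; apply/closure_normP => e e0.
  have [h hs] := Gamma0_cutoff s e0; exists (act h s) => //.
  exists 1%N, (fun=> 1), (fun=> h), (fun=> s).
  by rewrite big_ord1 scale1r.
Qed.

Lemma Gamma0_cyclic_coneP s t : cyclic_cone act s t <->
  forall e, 0 < e -> exists2 f, C0_nonneg f & `|t - act f s| <= e.
Proof.
rewrite /cyclic_cone; split=> [/closure_normP h e /h[_ [f f0 <-] tf]|h].
  by exists f.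
by apply/closure_normP => e /h[f f0 tf]; exists (act f s) => //; exists f.
Qed.

Lemma Gamma0_cyclic_cone_ray s t : cyclic_cone act s t ->
  forall x, exists2 a, 0 <= a & t x = a *: s x.
Proof.
move=> /Gamma0_cyclic_coneP h x; apply: ray_closed => e /h[f f0 tf].
exists (f x); first exact: f0.
by apply: le_trans tf; exact: (Gamma0_norm_ge (t - act f s)).
Qed.

Definition pointwise_join (u v : forall x, fiber E x) x : fiber E x :=
  if `|u x| <= `|v x| then v x else u x.

Lemma pointwise_joinE (u v s : forall x, fiber E x) x (a b : K) :
  0 <= a -> 0 <= b -> u x = a *: s x -> v x = b *: s x ->
  pointwise_join u v x = Num.max a b *: s x.
Proof.
move=> a0 b0 ux vx; rewrite /pointwise_join ux vx !normrZ.
have [->|s0] := eqVneq (s x) 0; first by rewrite !scaler0 if_same.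
rewrite ler_pM2r ?normr_gt0// !ger0_norm//.
by case: (real_leP (ger0_real a0) (ger0_real b0)).
Qed.

Lemma norm_pointwise_join (u v : forall x, fiber E x) x :
  `|pointwise_join u v x| = Num.max `|u x| `|v x|.
Proof.
rewrite /pointwise_join.
by case: (real_leP (normr_real (u x)) (normr_real (v x))).
Qed.

(** In each fiber the cyclic cone of [s] is the ray of [s x], where the join of
    two vectors is the longer one. Choosing the longer vector in each fiber is a
    uniform limit of sections [C0_max f g] times [s], hence again a section. *)
Lemma Gamma0_AM_space s : is_AM_space (cyclic_submodule act s) (cyclic_cone act s).
Proof.
move=> u v Cu Cv.
have /choice[a ha] : forall x, exists a, 0 <= a /\ u x = a *: s x.
  by move=> x; have [a] := Gamma0_cyclic_cone_ray Cu x; exists a.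
have /choice[b hb] : forall x, exists b, 0 <= b /\ v x = b *: s x.
  by move=> x; have [b] := Gamma0_cyclic_cone_ray Cv x; exists b.
have a0 x := (ha x).1; have b0 x := (hb x).1.
pose w := pointwise_join u v.
have wE x : w x = Num.max (a x) (b x) *: s x.
  by apply: pointwise_joinE; [exact: a0|exact: b0|exact: (ha x).2|exact: (hb x).2].
have approx f g (e : K) : C0_nonneg f -> C0_nonneg g ->
    `|u - act f s| <= e -> `|v - act g s| <= e ->
    forall x, `|w x - act (C0_max f g) s x| <= e.
  move=> f0 g0 uf vg x; rewrite wE Gamma0_actE C0_maxE// distrC.
  apply: scale_max_dist => //.
    rewrite -(ha x).2 distrC; apply: le_trans uf.
    exact: (Gamma0_norm_ge (u - act f s)).
  rewrite -(hb x).2 distrC; apply: le_trans vg.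
  exact: (Gamma0_norm_ge (v - act g s)).
move: Cu Cv => /Gamma0_cyclic_coneP Cu /Gamma0_cyclic_coneP Cv.
have wG : Gamma0_mem w.
  apply: Gamma0_mem_limit => e e0.
  have [f f0 uf] := Cu e e0; have [g g0 vg] := Cv e e0.
  by exists (act (C0_max f g) s) => x; exact: approx.
pose W : Gamma0 E := MkSection (P := Gamma0_submodule E) wG.
have Wapprox f g (e : K) : 0 < e -> C0_nonneg f -> C0_nonneg g ->
    `|u - act f s| <= e -> `|v - act g s| <= e ->
    `|W - act (C0_max f g) s| <= e.
  move=> e0 f0 g0 uf vg; apply: Gamma0_norm_le; first exact: ltW.
  exact: approx.
have actB f g t : act (f - g) t = act f t - act g t.
  by apply: sections_ext => x /=; rewrite scalerBl.
have half (e : K) : 0 < e -> 0 < e / 2 by move=> e0; rewrite divr_gt0.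
have diff (y z y' z' : Gamma0 E) (e : K) : `|y - y'| <= e / 2 ->
    `|z - z'| <= e / 2 -> `|(y - z) - (y' - z')| <= e.
  move=> yy zz; rewrite opprD addrACA -opprD [leRHS]splitr.
  by rewrite (le_trans (ler_normD _ _))// normrN lerD.
exists W; first split.
- apply/closure_normP => e e0.
  have [f f0 uf] := Cu e e0; have [g g0 vg] := Cv e e0.
  by exists (act (C0_max f g) s); [exists (C0_max f g)|exact: Wapprox].
- apply/Gamma0_cyclic_coneP => e /half e0.
  have [f f0 uf] := Cu _ e0; have [g g0 vg] := Cv _ e0.
  exists (C0_max f g - f).
    by move=> x; rewrite /= subr_ge0; exact: C0_max_gel.
  by rewrite actB diff// Wapprox.
- apply/Gamma0_cyclic_coneP => e /half e0.
  have [f f0 uf] := Cu _ e0; have [g g0 vg] := Cv _ e0.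
  exists (C0_max f g - g).
    by move=> x; rewrite /= subr_ge0; exact: C0_max_ger.
  by rewrite actB diff// Wapprox.
- move=> z _ Czu Czv.
  have /choice[c hc] : forall x, exists c, 0 <= c /\ z x = c *: s x.
    move=> x; have [c c0 zc] := Gamma0_cyclic_cone_ray Czu x.
    exists (c + a x); split; first by rewrite addr_ge0.
    by rewrite scalerDl -zc -(ha x).2 /= subrK.
  move: Czu Czv => /Gamma0_cyclic_coneP Czu /Gamma0_cyclic_coneP Czv.
  apply/Gamma0_cyclic_coneP => e /half e0; have e20 := half _ e0.
  have [f f0 uf] := Cu _ e20; have [g g0 vg] := Cv _ e20.
  have [p p0 zp] := Czu _ e20; have [q q0 zq] := Czv _ e20.
  (* (p + f) s and (q + g) s are close to z, hence so is their join. *)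
  have pf0 : C0_nonneg (p + f) by move=> x; rewrite addr_ge0// ?p0 ?f0.
  have qg0 : C0_nonneg (q + g) by move=> x; rewrite addr_ge0// ?q0 ?g0.
  exists (C0_max (p + f) (q + g) - C0_max f g).
    move=> x; have -> : (C0_max (p + f) (q + g) - C0_max f g) x =
      (C0_max (p + f) (q + g) x : K) - C0_max f g x by [].
    rewrite subr_ge0 !C0_maxE//.
    have fp : (f x : K) <= (p + f) x by rewrite /= lerDr p0.
    have gq : (g x : K) <= (q + g) x by rewrite /= lerDr q0.
    case: (real_leP (ger0_real (f0 x)) (ger0_real (g0 x))) => _.
      apply: (le_trans gq).
      by case: (real_leP (ger0_real (pf0 x)) (ger0_real (qg0 x))) => // /ltW.
    apply: (le_trans fp).
    by case: (real_leP (ger0_real (pf0 x)) (ger0_real (qg0 x))).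
  have sum (y t : Gamma0 E) r h : `|z - t - act r s| <= e / 2 / 2 ->
      `|t - act h s| <= e / 2 / 2 -> `|z - act (r + h) s| <= e / 2.
    move=> zt th; have -> : z - act (r + h) s = (z - t - act r s) + (t - act h s).
      have -> : act (r + h) s = act r s + act h s.
        by apply: sections_ext => x /=; rewrite scalerDl.
      by rewrite [RHS]addrACA subrK -opprD.
    by rewrite (le_trans (ler_normD _ _))// [leRHS]splitr lerD.
  have zpf := sum z u p f zp uf; have zqg := sum z v q g zq vg.
  rewrite actB diff//; last first.
    have e42 : e / 2 / 2 <= e / 2.
      by rewrite ler_pdivrMr// ler_pMr// ler1n.
    by apply: Wapprox => //; [exact: le_trans uf e42|exact: le_trans vg e42].
  apply: Gamma0_norm_le => [|x]; first exact: ltW.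
  have -> : (z - act (C0_max (p + f) (q + g)) s) x =
      Num.max (c x) (c x) *: s x - Num.max ((p + f) x : K) ((q + g) x) *: s x.
    by rewrite maxxx -C0_maxE// -(hc x).2.
  rewrite distrC; apply: scale_max_dist => //; try exact: (hc x).1.
    rewrite -(hc x).2 distrC; apply: le_trans zpf.
    exact: (Gamma0_norm_ge (z - act (p + f) s)).
  rewrite -(hc x).2 distrC; apply: le_trans zqg.
  exact: (Gamma0_norm_ge (z - act (q + g) s)).
- apply/eqP; rewrite eq_le; apply/andP; split.
    apply: Gamma0_norm_le => [|x].
      by case: (real_leP (normr_real u) (normr_real v)).
    rewrite [`|W x|]norm_pointwise_join.
    have ux := Gamma0_norm_ge u x; have vx := Gamma0_norm_ge v x.
    case: (real_leP (normr_real (u x)) (normr_real (v x))) => _.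
      apply: (le_trans vx).
      by case: (real_leP (normr_real u) (normr_real v)) => // /ltW.
    apply: (le_trans ux).
    by case: (real_leP (normr_real u) (normr_real v)).
  have Wx x : Num.max `|u x| `|v x| <= `|W|.
    by rewrite -norm_pointwise_join; exact: (Gamma0_norm_ge W x).
  case: (real_leP (normr_real u) (normr_real v)) => _;
    apply: Gamma0_norm_le => // x; apply: le_trans (Wx x).
    by case: (real_leP (normr_real (u x)) (normr_real (v x))) => // /ltW.
  by case: (real_leP (normr_real (u x)) (normr_real (v x))).
Qed.

End Gamma0_AM.

(** * Koopman representations *)

Section submonoid_topology.
Context (G : topologicalGroupType) (S : closed_submonoid G).

Lemma val_submonoid_continuous : continuous (fun g : S => \val g).
Proof. exact: (@initial_continuous S G set_val). Qed.

(** Since [S] is closed, cluster points in [G] of filters on [S] lie in [S]. *)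
Lemma closed_submonoid_locally_compact : locally_compact [set: G] ->
  forall g : S, exists2 C : set S, nbhs g C & compact C.
Proof.
move=> lcG g; have [D [nD cD _]] := locally_compact_nbhs lcG (\val g).
exists ((fun g : S => \val g) @^-1` D); first exact: val_submonoid_continuous.
move=> F FF FD; pose F' : set_system G := (fun g : S => \val g) @ F.
have [p [[Dp Sp] clp]] : (D `&` S) `&` cluster F' !=set0.
  apply: (compact_closedI cD (@submonoid_closed _ S)).
  suff: F [set h | (D `&` S) (\val h)] by [].
  by apply: filterS FD => h Dh; split => //; exact: set_valP.
pose q : S := exist _ p (mem_set Sp).
exists q; split => // A B FA; rewrite nbhsE => -[B' [oB' B'q] B'B].
have [B1 oB1 B1B] := oB'.
have [||y [[h Ah <-] B1h]] := clp ((fun g : S => \val g) @` A) B1.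
- suff: F [set h | ((fun g : S => \val g) @` A) (\val h)] by [].
  by apply: filterS FA => h Ah; exists h.
- by apply: open_nbhs_nbhs; split => //; move: B'q; rewrite -B1B.
- by exists h; split => //; apply: B'B; rewrite -B1B.
Qed.

End submonoid_topology.

Section koopman_representation.
Context (R : realType) (k : scalar_kind).
Local Notation K := (scalar_field R k).
Context (G : topologicalGroupType) (S : closed_submonoid G).
Context (X : topologicalType) (phi : dynamical_system G X).
Implicit Types E F : dynamical_bundle R k S phi.

Lemma point_inj E x : injective (@point _ _ E x).
Proof. exact: can_inj (@pointK _ _ E x). Qed.

(** Every point is of the form [phi g y], where the Koopman operators are given
    by the fiber maps without transport along [phi g (phi g^-1 x) = x]. *)
Lemma flow_ind (g : G) (P : X -> Prop) : (forall y, P (phi g y)) -> forall x, P x.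
Proof. by move=> h x; rewrite -(flowVK phi g x). Qed.

Lemma koopman_funE E g (s : forall x, fiber E x) y :
  koopman_fun g s (phi (\val g) y) = fiber_map (phi (\val g)) (dact g) (s y).
Proof. by rewrite /koopman_fun flowK. Qed.

Lemma koopman_linear E g : linear (@koopman_Gamma0 _ _ _ _ _ _ E g).
Proof.
have [_ _ lg _] := dact_morphism E g.
move=> a s t; apply: sections_ext; apply: (@flow_ind (\val g)) => y.
by rewrite /= !koopman_funE lg.
Qed.

Lemma koopman_norm_le E g M (s : Gamma0 E) :
  (forall x (v : fiber E x), `|fiber_map (phi (\val g)) (dact g) v| <= M * `|v|) ->
  `|koopman_Gamma0 g s| <= `|M| * `|s|.
Proof.
move=> bM; apply: Gamma0_norm_le; first by rewrite mulr_ge0.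
apply: (@flow_ind (\val g)) => y; rewrite /= koopman_funE.
apply: (le_trans (le_mul_norm (normr_ge0 _) (normr_ge0 _) (bM _ _))).
by rewrite ler_wpM2l// Gamma0_norm_ge.
Qed.

Lemma koopman_one E : @koopman_Gamma0 _ _ _ _ _ _ E (sone S) = id.
Proof.
apply: funext => s; apply: sections_ext => x; apply: point_inj.
by rewrite point_koopman dact1 /= invg1 flow1.
Qed.

Lemma koopman_mul E g h : @koopman_Gamma0 _ _ _ _ _ _ E (smul g h) =
  @koopman_Gamma0 _ _ _ _ _ _ E g \o koopman_Gamma0 h.
Proof.
apply: funext => s; apply: sections_ext => x; apply: point_inj.
by rewrite /= !point_koopman dactM /= invgM flowM.
Qed.

Lemma koopman_act E g f (s : Gamma0 E) :
  koopman_Gamma0 g (Gamma0_act f s) =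
  Gamma0_act (koopman_C0 phi (\val g) f) (koopman_Gamma0 g s).
Proof.
have [_ _ lg _] := dact_morphism E g.
apply: sections_ext; apply: (@flow_ind (\val g)) => y.
rewrite /= !koopman_funE flowK.
exact: (linear_funZ (lg y)).
Qed.

(** Off the compact set [{phi g y | g in N, y in L}] both sections are small; on
    it, the tube lemma makes their difference small uniformly. *)
Lemma koopman_continuous E (s : Gamma0 E) : locally_compact [set: G] ->
  continuous (fun g : S => koopman_Gamma0 g s : Gamma0 E).
Proof.
move=> lcG g0; apply/(@cvgrPdist_le _ (Gamma0 E) _ (nbhs g0)) => e e0.
have [N nN cN] := closed_submonoid_locally_compact lcG g0.
have [M hM] := dact_bounded E cN.
have M1 : 0 < `|M| + 1 by rewrite ltr_wpDl.
have d0 : 0 < e / 2 / (`|M| + 1) by rewrite !divr_gt0.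
have [_ /(_ _ d0)[L [cL sL]]] := sec_mem s.
pose L' := (fun gy : S * X => phi (\val gy.1) gy.2) @` (N `*` L).
have cflow : continuous (fun gy : S * X => phi (\val gy.1) gy.2).
  move=> [g y]; apply: (@continuous_comp _ _ _
    (fun gy : S * X => (\val gy.1, gy.2)) (fun gx : G * X => phi gx.1 gx.2)).
    apply: cvg_pair; last exact: cvg_snd.
    by apply: cvg_comp cvg_fst _; exact: val_submonoid_continuous.
  exact: flow_continuous.
have cflowV : continuous (fun gy : S * X => phi (\val gy.1)^-1%g gy.2).
  move=> [g y]; apply: (@continuous_comp _ _ _
    (fun gy : S * X => ((\val gy.1)^-1%g, gy.2)) (fun gx : G * X => phi gx.1 gx.2)).
    apply: cvg_pair; last exact: cvg_snd.
    apply: (@continuous_comp _ _ _ (fun gy : S * X => \val gy.1)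
      (fun g : G => g^-1%g)); last exact: invg_continuous.
    apply: (@continuous_comp _ _ _ fst (fun g : S => \val g)).
      exact: cvg_fst.
    exact: val_submonoid_continuous.
  exact: flow_continuous.
have cL' : compact L'.
  by apply: continuous_compact; [exact: continuous_subspaceT|exact: compact_setX].
have off g : N g -> forall x, ~ L' x -> `|koopman_Gamma0 g s x| <= e / 2.
  move=> Ng; apply: (@flow_ind (\val g)) => y Ly; rewrite /= koopman_funE.
  apply: (le_trans (le_mul_norm (normr_ge0 _) (normr_ge0 _) (hM g Ng _ _))).
  have sy : `|s y| <= e / 2 / (`|M| + 1).
    by apply: sL => Ly'; apply: Ly; exists (g, y).
  apply: (le_trans (ler_wpM2l (normr_ge0 _) sy)).
  by rewrite mulrA ler_pdivrMr// mulrC ler_pM2l ?divr_gt0// lerDl.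
have on : \forall g \near g0, L' `<=` fun x =>
    `|koopman_Gamma0 g0 s x - koopman_Gamma0 g s x| <= e.
  apply: ((compact_near_coveringP L').1 cL' _ (nbhs g0) (fun g x =>
    `|koopman_Gamma0 g0 s x - koopman_Gamma0 g s x| <= e)) => x _.
  pose t := koopman_Gamma0 g0 s.
  have cd : continuous (fun gx : S * X =>
      dact gx.1 (point E (s (phi (\val gx.1)^-1%g gx.2)))).
    move=> [h y]; apply: (@continuous_comp _ _ _
      (fun gx : S * X => (gx.1, point E (s (phi (\val gx.1)^-1%g gx.2))))
      (fun ge : S * total E => dact ge.1 ge.2)); last exact: dact_continuous.
    have c1 : {for (h, y), continuous (@fst S X)} by exact: cvg_fst.
    have c2 : {for (h, y), continuous (fun gx : S * X =>
        point E (s (phi (\val gx.1)^-1%g gx.2)))}.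
      apply: (@continuous_comp _ _ _
        (fun gy : S * X => phi (\val gy.1)^-1%g gy.2) (fun y => point E (s y))).
        exact: cflowV.
      exact: Gamma0_continuous.
    exact: (cvg_pair c1 c2).
  have tx0 : `|t x - t x| < e by rewrite subrr normr0.
  have := tube_nbhs (@Gamma0_continuous _ _ _ _ t) tx0.
  rewrite [point E (t x)]point_koopman => /(cd (g0, x))[[A B]/= [hA hB] AB].
  exists (B, A) => // -[y g] [/= By Ag].
  have := AB (g, y) (conj Ag By); rewrite /= -point_koopman proj_point pointK.
  by rewrite distrC; exact: ltW.
have g0N := nbhs_singleton nN; apply: filterS2 nN on => g Ng hg.
apply: Gamma0_norm_le => [|x]; first exact: ltW.
have [L'x|L'x] := pselect (L' x); first exact: hg.
apply: (le_trans (ler_normB _ _)).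
by rewrite [leRHS]splitr lerD// off.
Qed.

Lemma Gamma0_dynamical_AM_module E : locally_compact [set: G] ->
  hausdorff_space X -> locally_compact [set: X] ->
  is_dynamical_AM_module phi (Gamma0_module E).
Proof.
move=> lcG hausX lcX; split.
- by split; [exact: Gamma0_banach_module|exact: Gamma0_AM_space].
- move=> g; split; first exact: koopman_linear.
  have [_ _ _ [M bM]] := dact_morphism E g.
  by exists `|M| => s; exact: koopman_norm_le.
- by split; [exact: koopman_one|exact: koopman_mul].
- exact: koopman_act.
- by move=> s; exact: koopman_continuous.
Qed.

Section morphisms.
Context (E F : dynamical_bundle R k S phi).

Lemma Gamma0_map_module_hom (Theta : bundle_hom E F) :
  is_module_hom (Gamma0_map Theta).
Proof.
have mT := bhom_morphism Theta; have [_ _ lT [M bM]] := mT.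
split; first split.
- by move=> a s t; apply: sections_ext => x /=; rewrite lT.
- exists `|M| => s; apply: Gamma0_norm_le => [|x]; first by rewrite mulr_ge0.
  apply: (le_trans (le_mul_norm (normr_ge0 _) (normr_ge0 _) (bM _ _))).
  by rewrite ler_wpM2l// Gamma0_norm_ge.
- move=> f s; apply: sections_ext => x /=.
  exact: (linear_funZ (lT x)).
- move=> g s; apply: sections_ext => x; apply: point_inj.
  rewrite point_Gamma0_map !point_koopman point_Gamma0_map.
  exact: (congr1 (fun f => f _) (bhom_dact Theta g)).
Qed.

End morphisms.

End koopman_representation.

(** * The functor is fully faithful *)

Section fullness.
Context (R : realType) (k : scalar_kind).
Local Notation K := (scalar_field R k).
Context (G : topologicalGroupType) (S : closed_submonoid G).
Context (X : topologicalType) (phi : dynamical_system G X).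
Hypotheses (hausX : hausdorff_space X) (lcX : locally_compact [set: X]).

Lemma section_norm_near (E : banach_bundle K X) (s : Gamma0 E) x (r : K) :
  `|s x| < r -> \forall y \near x, `|s y| < r.
Proof.
move=> /norm_nbhs h.
have {}h : \forall y \near x, fnorm (point E (s y)) < r :=
  @Gamma0_continuous _ _ _ _ s x _ h.
by apply: filterS h => y; rewrite fnorm_point.
Qed.

Lemma Gamma0_bump_norm_le (E : banach_bundle K X) (s : Gamma0 E) U
    (h : C0 R k X) (r : K) : 0 <= r -> is_bump U h ->
  (forall y, U y -> `|s y| <= r) -> `|Gamma0_act h s| <= r.
Proof.
move=> r0 hb sr; apply: Gamma0_norm_le => // y; rewrite Gamma0_actE normrZ.
rewrite (ger0_norm (bump_ge0 _ hb)).
have [/sr sy|Uy] := pselect (U y); last by rewrite (bump_off hb Uy) mul0r.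
by rewrite -[leRHS]mul1r ler_pM ?(bump_ge0 _ hb) ?(bump_le1 _ hb).
Qed.

Section full.
Context (E F : dynamical_bundle R k S phi).
Context (V : module_hom (Gamma0_module E) (Gamma0_module F)).

Let lV : linear V. Proof. by have [[]] := mhomP V. Qed.

(** Locality: multiplying [s] by a bump at [x] changes neither side at [x], and
    brings the norm of [s] down to nearly that of [s x] by upper
    semicontinuity. *)
Lemma module_hom_local : exists2 M : K, 0 <= M &
  forall (s : Gamma0 E) x, `|(V s : Gamma0 F) x| <= M * `|s x|.
Proof.
have [[_ [M bM]] aV _] := mhomP V; exists `|M| => // s x.
apply: ler_forall_gt0 => [|| e e0]; rewrite ?rpredM ?normr_real//.
have M1 : 0 < `|M| + 1 by rewrite ltr_wpDl.
pose d := e / (`|M| + 1); have d0 : 0 < d by rewrite divr_gt0.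
have /section_norm_near xU : `|s x| < `|s x| + d by rewrite ltrDl.
have [h hb h1] := bump_exists R k hausX lcX xU.
have -> : (V s : Gamma0 F) x = (V (Gamma0_act h s) : Gamma0 F) x.
  by rewrite aV /= (nbhs_singleton h1) scale1r.
apply: (le_trans (Gamma0_norm_ge (V (Gamma0_act h s)) x)).
apply: (le_trans (le_mul_norm (normr_ge0 _) (normr_ge0 _) (bM _))).
have hs : `|Gamma0_act h s| <= `|s x| + d.
  apply: Gamma0_bump_norm_le hb _; first by rewrite addr_ge0// ltW.
  by move=> y /ltW.
apply: (le_trans (ler_wpM2l (normr_ge0 _) hs)).
rewrite mulrDr lerD2l /d mulrA ler_pdivrMr// mulrC ler_pM2l//.
by rewrite lerDl.
Qed.

Let sect x (v : fiber E x) : Gamma0 E :=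
  sval (cid (section_through_point hausX lcX v)).

Let sectE x (v : fiber E x) : sect v x = v.
Proof. exact: svalP (cid (section_through_point hausX lcX v)). Qed.

(** The morphism inducing [V] has to map [s x] to [V s x]; by [module_hom_local]
    this depends on the vector [s x] only. *)
Definition full_map (e : total E) : total F :=
  point F ((V (sect (coord (proj e) e)) : Gamma0 F) (proj e)).

Lemma full_mapE (s : Gamma0 E) x :
  full_map (point E (s x)) = point F ((V s : Gamma0 F) x).
Proof.
rewrite /full_map proj_point pointK; congr point.
have [M M0 hM] := module_hom_local.
apply/eqP; rewrite -subr_eq0 -normr_le0.
have := hM (sect (s x) - s) x; rewrite (linear_funB lV) /= sectE subrr normr0.
by rewrite mulr0.
Qed.

Lemma total_section (e : total E) : exists (s : Gamma0 E) x, e = point E (s x).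
Proof.
by exists (sect (coord (proj e) e)), (proj e); rewrite sectE coordK.
Qed.

Lemma full_map_fiber x (s : Gamma0 E) :
  fiber_map id full_map (s x) = (V s : Gamma0 F) x.
Proof. by rewrite /fiber_map full_mapE pointK. Qed.

(** Near [s x] the map sends tubes around [s] into tubes around [V s]. *)
Lemma full_map_continuous : continuous full_map.
Proof.
move=> e W; have [s [x ->]] := total_section e.
rewrite full_mapE => /(section_tube_sub_nbhs (@Gamma0_continuous _ _ _ _ (V s))).
move=> [d d0 hd]; have [M M0 hM] := module_hom_local.
have M1 : 0 < M + 1 by rewrite ltr_wpDl.
have r0 : `|s x - s x| < d / (M + 1) by rewrite subrr normr0 divr_gt0.
have hs := tube_nbhs (@Gamma0_continuous _ _ _ _ s) r0.
suff : \forall e' \near point E (s x), W (full_map e') by [].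
apply: filterS2 hs (proj_near (s x) hd) => e' /= es; apply.
set y := proj e' in es *; set t := sect _.
have := hM (t - s) y; rewrite (linear_funB lV) /= => /le_trans; apply.
rewrite /t sectE (le_trans (ler_wpM2l M0 (ltW es)))//.
by rewrite mulrA ler_pdivrMr// mulrC ler_pM2l// lerDl.
Qed.

Lemma full_map_morphism : is_bundle_morphism id full_map.
Proof.
split.
- exact: full_map_continuous.
- by move=> e; rewrite /full_map proj_point.
- move=> x a u v; rewrite -(sectE u) -(sectE v).
  have -> : a *: (sect u) x + (sect v) x = (a *: sect u + sect v) x by [].
  by rewrite !full_map_fiber lV.
- have [M M0 hM] := module_hom_local; exists M => x v.
  by rewrite -(sectE v) full_map_fiber; exact: hM.
Qed.

Lemma full_map_dact g : full_map \o dact g = dact g \o full_map.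
Proof.
apply: funext => e /=; have [s [x ->]] := total_section e.
have [_ _ gV] := mhomP V.
have -> : dact g (point E (s x)) = point E (koopman_Gamma0 g s (phi (\val g) x)).
  by rewrite point_koopman flowK.
rewrite !full_mapE; have /= -> := gV g s.
by rewrite point_koopman flowK.
Qed.

Definition full_hom : bundle_hom E F :=
  BundleHom full_map_morphism full_map_dact.

Lemma full_homK (s : Gamma0 E) : Gamma0_map full_hom s = V s.
Proof. by apply: sections_ext => x; rewrite /= full_map_fiber. Qed.

End full.

Lemma Gamma0_map_faithful (E F : dynamical_bundle R k S phi)
    (Theta Xi : bundle_hom E F) :
  (forall s, Gamma0_map Theta s = Gamma0_map Xi s) -> Theta = Xi.
Proof.
move=> TX; apply: bundle_hom_ext => e.
have [s se] := section_through_point hausX lcX (coord (proj e) e).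
by rewrite -(coordK (erefl (proj e))) -se -!point_Gamma0_map TX.
Qed.

Lemma section_functor_fully_faithful
    (objP : forall E : dynamical_bundle R k S phi,
      is_dynamical_AM_module phi (Gamma0_module E))
    (homP : forall (E F : dynamical_bundle R k S phi) (Theta : bundle_hom E F),
      is_module_hom (Gamma0_map Theta)) :
  fully_faithful (section_functor objP homP).
Proof.
move=> E F; exists (fun V => full_hom V); first move=> Theta.
  by apply: Gamma0_map_faithful => s; rewrite full_homK.
by move=> V; apply: module_hom_ext => s; rewrite /= full_homK.
Qed.

End fullness.

(** * Norm inequalities in modules over continuous functions *)

Section C0_norm.
Context (R : realType) (k : scalar_kind) (X : topologicalType).
Local Notation K := (scalar_field R k).
Implicit Types f g : C0 R k X.

Lemma C0_norm_le f (M : K) : 0 <= M -> (forall x, `|f x : K| <= M) -> `|f| <= M.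
Proof. exact: (@sup_norm_le R k X (fun=> K : normedModType K) _ f M). Qed.

Lemma sqr_frac_le1 (K' : numFieldType) (a d : K') : 0 < d ->
  0 <= `|a| ^+ 2 / (`|a| ^+ 2 + d ^+ 2) <= 1.
Proof.
move=> d0; have h : 0 < `|a| ^+ 2 + d ^+ 2 by rewrite ltr_wpDl ?exprn_ge0 ?exprn_gt0.
rewrite divr_ge0 ?exprn_ge0 ?(ltW h)//= ler_pdivrMr// mul1r lerDl exprn_ge0//.
exact: ltW.
Qed.

Lemma C0_frac_mem f g (d : K) : 0 < d -> (forall x, `|g x : K| <= `|f x : K|) ->
  C0_mem (fun x => g x * f x / (`|f x : K| ^+ 2 + d ^+ 2) : K).
Proof.
move=> d0 gf; have d2 : 0 < d ^+ 2 by rewrite exprn_gt0.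
have h x : 0 < `|f x : K| ^+ 2 + d ^+ 2 by rewrite ltr_wpDl// exprn_ge0.
have cf : continuous (f : X -> K) := @C0_continuous _ _ _ f.
have cg : continuous (g : X -> K) := @C0_continuous _ _ _ g.
split.
  move=> x; apply: cvgM; first exact: cvgM (cg x) (cf x).
  apply: cvgV; first by rewrite gt_eqF.
  apply: cvgD; last exact: cvg_cst.
  rewrite expr2; under eq_fun do rewrite expr2.
  by apply: cvgM; apply: cvg_norm; exact: cf.
have [_ Vg] := sec_mem (C0_mul g f).
have d20 : 0 <= (d ^+ 2)^-1 by rewrite invr_ge0 ltW.
have := vanishing_lin d20 Vg (@vanishing0 X K).
apply: vanishing_le => x; rewrite addr0 normrM mulrC ler_wpM2r//.
by rewrite normfV (gtr0_norm (h x)) lef_pV2 ?posrE// lerDr exprn_ge0.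
Qed.

End C0_norm.

Section module_inequalities.
Context (R : realType) (k : scalar_kind) (X : topologicalType).
Local Notation K := (scalar_field R k).
Context (V : normedModType K) (act : C0 R k X -> V -> V).
Context (bm : is_banach_module act).
Implicit Types f g : C0 R k X.

Lemma act_linear f : linear (act f). Proof. by have [_ []] := bm. Qed.
Lemma act_linearl s : linear (act^~ s). Proof. by have [_ []] := bm. Qed.
Lemma actM f g s : act (C0_mul f g) s = act f (act g s).
Proof. by have [_ _ ->] := bm. Qed.
Lemma act_norm_le f s (M : K) : 0 <= M -> (forall x, `|f x : K| <= M) ->
  `|act f s| <= M * `|s|.
Proof.
have [_ _ _ h _] := bm => M0 fM; apply: (le_trans (h f s)).
by rewrite ler_wpM2r// C0_norm_le.
Qed.

(** As [d] tends to 0, [g] is the uniform limit of the functions [h f], where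
    [h = g f / (|f|^2 + d^2)] is bounded by 1. *)
Lemma act_dominated f g s : (forall x, (f x : K) \is Num.real) ->
  (forall x, `|g x : K| <= `|f x : K|) -> `|act g s| <= `|act f s|.
Proof.
move=> rf gf; apply: ler_forall_gt0 => // e e0.
have s1 : 0 < `|s| + 1 by rewrite ltr_wpDl.
pose d := e / (`|s| + 1); have d0 : 0 < d by rewrite divr_gt0.
pose h : C0 R k X := MkSection (P := C0_submodule R k X) (C0_frac_mem d0 gf).
have D x : 0 < `|f x : K| ^+ 2 + d ^+ 2.
  by rewrite ltr_wpDl ?exprn_ge0 ?exprn_gt0.
have h1 x : `|h x : K| <= 1.
  have /andP[_] := sqr_frac_le1 (f x : K) d0; apply: le_trans.
  rewrite /= !normrM normfV (gtr0_norm (D x)) ler_wpM2r ?invr_ge0 ?(ltW (D x))//.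
  by rewrite expr2 ler_wpM2r.
have hfg x : `|(g - C0_mul h f) x : K| <= d.
  have -> : (g - C0_mul h f) x = g x * (d ^+ 2 / (`|f x : K| ^+ 2 + d ^+ 2)) :> K.
    have -> : (g - C0_mul h f) x =
      g x - g x * f x / (`|f x : K| ^+ 2 + d ^+ 2) * f x :> K by [].
    have -> : (g x : K) * f x / (`|f x : K| ^+ 2 + d ^+ 2) * f x =
        g x * (`|f x : K| ^+ 2 / (`|f x : K| ^+ 2 + d ^+ 2)).
      by set D' := _ + d ^+ 2; rewrite real_normK// expr2 mulrAC !mulrA.
    rewrite -{1}(mulr1 (g x : K)) -mulrBr; congr (_ * _).
    by rewrite -{1}(divff (lt0r_neq0 (D x))) -mulrBl addrC addKr.
  rewrite normrM (@ger0_norm _ (_ / _)); last first.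
    by rewrite divr_ge0 ?exprn_ge0 ?(ltW (D x)) ?(ltW d0).
  apply: (le_trans (ler_wpM2r _ (gf x))).
    by rewrite divr_ge0 ?exprn_ge0 ?(ltW (D x)) ?(ltW d0).
  rewrite mulrA ler_pdivrMr// expr2 mulrA mulrC ler_pM2l//.
  have fd : `|f x : K| * d *+ 2 <= `|f x : K| ^+ 2 + d ^+ 2.
    exact: (real_leif_mean_square_scaled (normr_real _) (gtr0_real d0)).1.
  by apply: le_trans fd; rewrite mulr2n lerDl mulr_ge0// ltW.
rewrite -(subrK (act (C0_mul h f) s) (act g s)) (le_trans (ler_normD _ _))//.
rewrite -(linear_funB (act_linearl s)) addrC lerD//.
  rewrite actM -[leRHS]mul1r; exact: act_norm_le.
apply: (le_trans (act_norm_le s (ltW d0) hfg)).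
by rewrite /d mulrAC ler_pdivrMr// ler_pM2l// lerDl.
Qed.

(** Any upper bound [w] of [f s] and [g s] is approximated both by elements
    [p s] with [f <= p] and by elements [q s] with [g <= q]; then it is also
    approximated by [(p \/ q) s], whose norm dominates that of [(f \/ g) s]. *)
Lemma AM_norm_max f g s (r : K) :
  is_AM_space (cyclic_submodule act s) (cyclic_cone act s) ->
  C0_nonneg f -> C0_nonneg g -> `|act f s| <= r -> `|act g s| <= r ->
  `|act (C0_max f g) s| <= r.
Proof.
move=> AM f0 g0 fr gr.
have coneE h : C0_nonneg h -> cyclic_cone act s (act h s).
  by move=> h0; apply: subset_closure; exists h.
have [w [_ wf wg _] nw] := AM _ _ (coneE f f0) (coneE g g0).
have wr : `|w| <= r.
  by rewrite nw; case: (real_leP (normr_real (act f s)) (normr_real (act g s))).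
apply: ler_forall_gt0 => // [|e e0]; first by rewrite ger0_real// (le_trans _ wr).
have e4 : 0 < e / 4 by rewrite divr_gt0.
have [_ [a a0 <-] wa] := (closure_normP _ _).1 wf _ e4.
have [_ [b b0 <-] wb] := (closure_normP _ _).1 wg _ e4.
pose p := f + a; pose q := g + b; pose d := q - p.
have p0 x : 0 <= (p x : K) by rewrite addr_ge0// ?f0 ?a0.
have q0 x : 0 <= (q x : K) by rewrite addr_ge0// ?g0 ?b0.
have rd x : (d x : K) \is Num.real by rewrite realB ?ger0_real ?p0 ?q0.
have wp : `|w - act p s| <= e / 4.
  by rewrite /p (linear_funD (act_linearl s)) opprD addrA.
have wq : `|w - act q s| <= e / 4.
  by rewrite /q (linear_funD (act_linearl s)) opprD addrA.
have ds : `|act d s| <= e / 2.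
  rewrite (linear_funB (act_linearl s)) -(subrKA w) (le_trans (ler_normD _ _))//.
  have -> : e / 2 = e / 4 + e / 4.
    by rewrite [LHS]splitr -!mulrA -invfM -natrM.
  by rewrite lerD// distrC.
pose m := C0_max p q; have m0 : C0_nonneg m by exact: C0_max_ge0.
apply: (@le_trans _ _ `|act m s|).
  apply: act_dominated => x; first by rewrite ger0_real ?m0.
  rewrite (ger0_norm (C0_max_ge0 f0 g0 x)) (ger0_norm (m0 x)) C0_maxE//.
  have fp : (f x : K) <= p x by rewrite lerDl a0.
  have gq : (g x : K) <= q x by rewrite lerDl b0.
  case: (real_leP (ger0_real (f0 x)) (ger0_real (g0 x))) => _.
    exact: le_trans gq (C0_max_ger x p0 q0).
  exact: le_trans fp (C0_max_gel x p0 q0).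
have dm : `|act (m - p) s| <= e / 2.
  apply: le_trans ds; apply: act_dominated => // x.
  have -> : (m - p) x = (m x : K) - p x by [].
  rewrite C0_maxE//; have -> : (d x : K) = q x - p x by [].
  case: (real_leP (ger0_real (p0 x)) (ger0_real (q0 x))) => [pq|qp].
    by rewrite ger0_norm ?subr_ge0.
  by rewrite subrr normr0 subr_ge0 ltW.
have -> : act m s = w - (w - act p s) + act (m - p) s.
  rewrite (linear_funB (act_linearl s)) opprB [w + _]addrC subrK.
  by rewrite [RHS]addrC subrK.
rewrite [e]splitr addrA (le_trans (ler_normD _ _))// lerD//.
rewrite (le_trans (ler_normB _ _))// lerD// (le_trans wp)//.
by rewrite ler_pM2l// lef_pV2 ?posrE// ler_nat.
Qed.

End module_inequalities.

(** * Fibers of a Banach module *)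

Section seminorm_quotient.
Context (K : numFieldType) (V : lmodType K).

Record seminorm := Seminorm {
  sn :> V -> K ;
  snD : forall u v, sn (u + v) <= sn u + sn v ;
  snZ : forall a u, sn (a *: u) = `|a| * sn u
}.

Context (p : seminorm).

Lemma sn0 : p 0 = 0.
Proof. by rewrite -(scale0r 0) snZ normr0 mul0r. Qed.

Lemma snN u : p (- u) = p u.
Proof. by rewrite -scaleN1r snZ normrN1 mul1r. Qed.

Lemma sn_ge0 u : 0 <= p u.
Proof.
have := snD p u (- u); rewrite subrr sn0 snN -mulr2n.
by rewrite -mulr_natr pmulr_lge0.
Qed.

Lemma sn_subC u v : p (u - v) = p (v - u).
Proof. by rewrite -opprB snN. Qed.

Definition sn_rel : rel V := fun u v => p (u - v) == 0.

Lemma sn_rel_refl : reflexive sn_rel.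
Proof. by move=> u; rewrite /sn_rel subrr sn0. Qed.

Lemma sn_rel_sym : symmetric sn_rel.
Proof. by move=> u v; rewrite /sn_rel sn_subC. Qed.

Lemma sn_rel_trans : transitive sn_rel.
Proof.
move=> v u w /eqP uv /eqP vw; rewrite /sn_rel -(subrKA v) eq_le sn_ge0 andbT.
by rewrite (le_trans (snD _ _ _))// uv vw addr0.
Qed.

Canonical sn_equiv := EquivRel sn_rel sn_rel_refl sn_rel_sym sn_rel_trans.

Definition sn_quotient := {eq_quot sn_equiv}.

HB.instance Definition _ := Choice.on sn_quotient.

Definition sn_class (u : V) : sn_quotient := \pi u.

Lemma sn_class_eq u v : sn_class u = sn_class v <-> p (u - v) = 0.
Proof.
split=> [/eqmodP /eqP//|uv]; apply/eqmodP; exact/eqP.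
Qed.

Lemma sn_classK (a : sn_quotient) : sn_class (repr a) = a.
Proof. exact: reprK. Qed.

Lemma sn_repr u : p (repr (sn_class u) - u) = 0.
Proof. by apply/sn_class_eq; rewrite sn_classK. Qed.

Definition snq_add (a b : sn_quotient) := sn_class (repr a + repr b).
Definition snq_opp (a : sn_quotient) := sn_class (- repr a).
Definition snq_scale (c : K) (a : sn_quotient) := sn_class (c *: repr a).
Definition snq_norm (a : sn_quotient) := p (repr a).

Lemma snq_addE u v : snq_add (sn_class u) (sn_class v) = sn_class (u + v).
Proof.
apply/sn_class_eq/eqP; rewrite opprD addrACA eq_le sn_ge0 andbT.
by rewrite (le_trans (snD _ _ _))// !sn_repr addr0.
Qed.

Lemma snq_oppE u : snq_opp (sn_class u) = sn_class (- u).
Proof. by apply/sn_class_eq; rewrite -opprD snN sn_repr. Qed.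

Lemma snq_scaleE c u : snq_scale c (sn_class u) = sn_class (c *: u).
Proof. by apply/sn_class_eq; rewrite -scalerBr snZ sn_repr mulr0. Qed.

Lemma snq_normE u : snq_norm (sn_class u) = p u.
Proof.
apply/eqP; rewrite eq_le /snq_norm; apply/andP; split.
  by rewrite -{1}(subrK u (repr _)) (le_trans (snD _ _ _))// sn_repr add0r.
rewrite -{1}(subrK (repr (sn_class u)) u) (le_trans (snD _ _ _))//.
by rewrite sn_subC sn_repr add0r.
Qed.

Lemma sn_class_surj (a : sn_quotient) : exists u, a = sn_class u.
Proof. by exists (repr a); rewrite sn_classK. Qed.

Lemma snq_addA : associative snq_add.
Proof.
move=> a b c; have [u ->] := sn_class_surj a; have [v ->] := sn_class_surj b.
by have [w ->] := sn_class_surj c; rewrite !snq_addE addrA.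
Qed.

Lemma snq_addC : commutative snq_add.
Proof.
move=> a b; have [u ->] := sn_class_surj a; have [v ->] := sn_class_surj b.
by rewrite !snq_addE addrC.
Qed.

Lemma snq_add0 : left_id (sn_class 0) snq_add.
Proof. by move=> a; have [u ->] := sn_class_surj a; rewrite snq_addE add0r. Qed.

Lemma snq_addN : left_inverse (sn_class 0) snq_opp snq_add.
Proof.
by move=> a; have [u ->] := sn_class_surj a; rewrite snq_oppE snq_addE addNr.
Qed.

HB.instance Definition _ :=
  GRing.isZmodule.Build sn_quotient snq_addA snq_addC snq_add0 snq_addN.

Lemma snq_scaleA c d a : snq_scale c (snq_scale d a) = snq_scale (c * d) a.
Proof.
by have [u ->] := sn_class_surj a; rewrite !snq_scaleE scalerA.
Qed.

Lemma snq_scale1 : left_id 1 snq_scale.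
Proof. by move=> a; have [u ->] := sn_class_surj a; rewrite snq_scaleE scale1r. Qed.

Lemma snq_scaleDr : right_distributive snq_scale +%R.
Proof.
move=> c a b; have [u ->] := sn_class_surj a; have [v ->] := sn_class_surj b.
have addE w x : sn_class w + sn_class x = sn_class (w + x) by exact: snq_addE.
by rewrite addE !snq_scaleE addE scalerDr.
Qed.

Lemma snq_scaleDl a : {morph snq_scale^~ a : c d / c + d}.
Proof.
move=> c d; have [u ->] := sn_class_surj a.
have addE w x : sn_class w + sn_class x = sn_class (w + x) by exact: snq_addE.
by rewrite !snq_scaleE addE scalerDl.
Qed.

HB.instance Definition _ := GRing.Zmodule_isLmodule.Build K sn_quotient
  snq_scaleA snq_scale1 snq_scaleDr snq_scaleDl.

Lemma snq_normD (a b : sn_quotient) : snq_norm (a + b) <= snq_norm a + snq_norm b.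
Proof.
have [u ->] := sn_class_surj a; have [v ->] := sn_class_surj b.
have -> : sn_class u + sn_class v = sn_class (u + v) by exact: snq_addE.
by rewrite !snq_normE snD.
Qed.

Lemma snq_normZ (c : K) (a : sn_quotient) : snq_norm (c *: a) = `|c| * snq_norm a.
Proof.
have [u ->] := sn_class_surj a.
have -> : c *: sn_class u = sn_class (c *: u) by exact: snq_scaleE.
by rewrite !snq_normE snZ.
Qed.

Lemma snq_norm_eq0 (a : sn_quotient) : snq_norm a = 0 -> a = 0.
Proof.
have [u ->] := sn_class_surj a; rewrite snq_normE => u0.
by apply/sn_class_eq; rewrite subr0.
Qed.

HB.instance Definition _ := Lmodule_isNormed.Build K sn_quotient
  snq_normD snq_normZ snq_norm_eq0.

Lemma sn_class_linear : linear sn_class.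
Proof.
move=> c u v.
have -> : c *: sn_class u = sn_class (c *: u) by exact: snq_scaleE.
by symmetry; exact: snq_addE.
Qed.

Lemma sn_class_norm u : `|sn_class u| = p u.
Proof. exact: snq_normE. Qed.

End seminorm_quotient.

Section localization.
Context (R : realType) (k : scalar_kind) (X : topologicalType).
Local Notation K := (scalar_field R k).
Context (V : normedModType K) (act : C0 R k X -> V -> V).
Context (bm : is_banach_module act).
Hypotheses (hausX : hausdorff_space X) (lcX : locally_compact [set: X]).
Implicit Types f g : C0 R k X.

Definition is_peak (x : X) f : Prop :=
  (forall y, 0 <= (f y : K) <= 1) /\ \forall y \near x, f y = 1.

Lemma peak_exists x U : nbhs x U -> exists2 f, is_peak x f & is_bump U f.
Proof.
move=> xU; have [h hb h1] := bump_exists R k hausX lcX xU.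
by exists h => //; split => //; have [] := hb.
Qed.

Lemma is_peakM x f g : is_peak x f -> is_peak x g -> is_peak x (C0_mul f g).
Proof.
move=> [f01 f1] [g01 g1]; split=> [y|].
  have /andP[f0 fl] := f01 y; have /andP[g0 gl] := g01 y.
  by rewrite /= mulr_ge0// mulr_ile1.
by apply: filterS2 f1 g1 => y /= -> ->; rewrite mulr1.
Qed.

Lemma is_peak_near x f : is_peak x f -> \forall y \near x, is_peak y f.
Proof. by move=> [f01 /nbhs_interior f1]; apply: filterS f1 => y fy; split. Qed.

Lemma peak_norm_le x f s : is_peak x f -> `|act f s| <= `|s|.
Proof.
move=> [f01 _]; rewrite -[leRHS]mul1r; apply: (act_norm_le bm) => // y.
by have /andP[f0 f1] := f01 y; rewrite ger0_norm.
Qed.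

(** The seminorm of the fiber at [x]: the norm of [s] in the quotient by the
    closed submodule generated by the functions vanishing at [x]. *)
Definition loc_norm x s : K :=
  ofR k (inf [set toR `|act f s| | f in is_peak x]).

Lemma loc_norm_le x f s : is_peak x f -> loc_norm x s <= `|act f s|.
Proof.
move=> fx; rewrite -[leRHS]toRK// /loc_norm le_ofR; apply: ge_inf.
  exists 0 => _ [g _ <-]; have := le_toR (normr_ge0 (act g s)).
  by rewrite -(ofR0 R k) ofRK.
by exists f.
Qed.

Lemma loc_norm_ge0 x s : 0 <= loc_norm x s.
Proof.
have [f0 f0x _] := @peak_exists x setT filterT.
rewrite /loc_norm -(ofR0 R k) le_ofR; apply: lb_le_inf.
  by exists (toR `|act f0 s|), f0.
move=> _ [g _ <-]; have := le_toR (normr_ge0 (act g s)).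
by rewrite -(ofR0 R k) ofRK.
Qed.

Lemma loc_norm_lt x s (r : K) : loc_norm x s < r ->
  exists2 f, is_peak x f & `|act f s| < r.
Proof.
move=> sr.
have [f0 f0x _] := @peak_exists x setT filterT.
have r0 := le_trans (loc_norm_ge0 x s) (ltW sr).
have [||_ [f fx <-] fr] := @inf_lt _ [set toR `|act f s| | f in is_peak x] (toR r).
- by exists (toR `|act f0 s|), f0.
- by move: sr; rewrite /loc_norm -{1}(toRK r0) lt_ofR.
- by exists f => //; rewrite -(toRK r0) -(toRK (normr_ge0 (act f s))) lt_ofR.
Qed.

Lemma loc_norm_real x s : loc_norm x s \is Num.real.
Proof. by rewrite ger0_real// loc_norm_ge0. Qed.

Lemma loc_norm_leP x s (r : K) : r \is Num.real ->
  (forall e, 0 < e -> exists2 f, is_peak x f & `|act f s| <= r + e) ->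
  loc_norm x s <= r.
Proof.
move=> rr h; apply: ler_forall_gt0 => // [|e /h[f fx]].
  exact: loc_norm_real.
exact: le_trans (loc_norm_le _ fx).
Qed.

Lemma loc_normD x s t : loc_norm x (s + t) <= loc_norm x s + loc_norm x t.
Proof.
apply: loc_norm_leP => [|e e0]; first by rewrite realD ?loc_norm_real.
have e20 : 0 < e / 2 by rewrite divr_gt0.
have [f fx fs] : exists2 f, is_peak x f & `|act f s| < loc_norm x s + e / 2.
  by apply: loc_norm_lt; rewrite ltrDl.
have [g gx gt] : exists2 f, is_peak x f & `|act f t| < loc_norm x t + e / 2.
  by apply: loc_norm_lt; rewrite ltrDl.
exists (C0_mul f g); first exact: is_peakM.
rewrite (linear_funD (act_linear bm _)) (le_trans (ler_normD _ _))//.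
rewrite [e]splitr addrACA lerD//.
  have -> : C0_mul f g = C0_mul g f.
    by apply: sections_ext => y /=; rewrite mulrC.
  rewrite (actM bm); apply: le_trans (ltW fs).
  exact: (peak_norm_le _ gx).
by rewrite (actM bm); apply: le_trans (ltW gt); exact: (peak_norm_le _ fx).
Qed.

Lemma loc_normZ x (a : K) s : loc_norm x (a *: s) = `|a| * loc_norm x s.
Proof.
have le b t : loc_norm x (b *: t) <= `|b| * loc_norm x t.
  apply: loc_norm_leP => [|e e0]; first by rewrite realM ?normr_real ?loc_norm_real.
  have b1 : 0 < `|b| + 1 by rewrite ltr_wpDl.
  have [f fx ft] : exists2 f, is_peak x f &
      `|act f t| < loc_norm x t + e / (`|b| + 1).
    by apply: loc_norm_lt; rewrite ltrDl divr_gt0.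
  exists f => //; rewrite (linear_funZ (act_linear bm f)) normrZ.
  apply: (le_trans (ler_wpM2l (normr_ge0 b) (ltW ft))).
  by rewrite mulrDr lerD2l mulrA ler_pdivrMr// mulrC ler_pM2l// lerDl.
apply/eqP; rewrite eq_le le/=.
have [->|a0] := eqVneq a 0; first by rewrite normr0 mul0r loc_norm_ge0.
have := le a^-1 (a *: s); rewrite scalerA mulVf// scale1r normfV.
by rewrite -ler_pdivrMl ?invr_gt0 ?normr_gt0// invrK.
Qed.

Definition loc_seminorm x : seminorm V :=
  Seminorm (loc_normD x) (loc_normZ x).

Lemma loc_norm_norm x s : loc_norm x s <= `|s|.
Proof.
have [f fx _] := @peak_exists x setT filterT.
exact: le_trans (loc_norm_le s fx) (peak_norm_le s fx).
Qed.

Lemma loc_norm_near x s (r : K) : loc_norm x s < r ->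
  \forall y \near x, loc_norm y s < r.
Proof.
move=> /loc_norm_lt[f /is_peak_near fx fs]; apply: filterS fx => y fy.
exact: le_lt_trans (loc_norm_le s fy) fs.
Qed.

(** A function acts on the fiber at [x] by its value at [x]: cut off near [x], it
    is uniformly close to this constant. *)
Lemma loc_norm_act x f s : loc_norm x (act f s - (f x : K) *: s) = 0.
Proof.
apply/eqP; rewrite eq_le loc_norm_ge0 andbT; apply: loc_norm_leP => // e e0.
have s1 : 0 < `|s| + 1 by rewrite ltr_wpDl.
pose d := e / (`|s| + 1); have d0 : 0 < d by rewrite divr_gt0.
have fU : \forall y \near x, `|(f x : K) - f y| < d.
  exact: (@cvgr_dist_lt _ _ _ _ _ _ _ (@C0_continuous _ _ _ f x)).
have [h hx hb] := peak_exists fU; exists h => //; rewrite add0r.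
have -> : act h (act f s - (f x : K) *: s) =
    act (C0_mul h f - (f x : K) *: h) s.
  rewrite (linear_funB (act_linear bm h)) (linear_funZ (act_linear bm h)) -(actM bm).
  by rewrite (linear_funB (act_linearl bm s)) (linear_funZ (act_linearl bm s)).
apply: (@le_trans _ _ (d * `|s|)).
  apply: (act_norm_le bm) => [|y]; first exact: ltW.
  have -> : (C0_mul h f - (f x : K) *: h) y = h y * (f y - f x) :> K.
    by rewrite mulrBr [h y * f x]mulrC.
  rewrite normrM (ger0_norm (bump_ge0 _ hb)).
  have [fy|Uy] := pselect (`|(f x : K) - f y| < d); last first.
    by rewrite (bump_off hb Uy) mul0r ltW.
  by rewrite -[leRHS]mul1r ler_pM ?(bump_ge0 _ hb) ?(bump_le1 _ hb)// distrC ltW.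
by rewrite /d mulrAC ler_pdivrMr// ler_pM2l// lerDl.
Qed.

Lemma loc_norm_peak x f s : is_peak x f -> loc_norm x (s - act f s) = 0.
Proof.
move=> [_ f1]; have := loc_norm_act x f s; rewrite (nbhs_singleton f1) scale1r.
by rewrite -[LHS](snN (loc_seminorm x)) /= opprB.
Qed.

Definition loc_fiber_normed x : normedModType K := sn_quotient (loc_seminorm x).

(** A class of norm less than [r] contains [act f s] with norm less than [r], for
    a suitable peak [f]; so the fiber is a quotient of [V]. *)
Lemma loc_fiber_complete x : complete_space (loc_fiber_normed x).
Proof.
apply: (@complete_lift _ _ V (loc_fiber_normed x) (sn_class (loc_seminorm x))).
- by have [] := bm.
- exact: sn_class_linear.
- by move=> s; rewrite sn_class_norm; exact: loc_norm_norm.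
- move=> a r; have [s ->] := sn_class_surj a.
  rewrite sn_class_norm => /loc_norm_lt[f fx fs].
  exists (act f s); last exact: ltW.
  by apply/sn_class_eq; rewrite sn_subC /= loc_norm_peak.
Qed.

Definition loc_fiber x : completeNormedModType K :=
  HB.pack_for (completeNormedModType K) (loc_fiber_normed x)
    (Uniform_isComplete.Build (loc_fiber_normed x) (@loc_fiber_complete x)).

Definition germ x (s : V) : loc_fiber x := sn_class (loc_seminorm x) s.

Lemma germ_linear x : linear (@germ x).
Proof. exact: sn_class_linear. Qed.

Lemma germ_norm x s : `|germ x s| = loc_norm x s.
Proof. exact: sn_class_norm. Qed.

Lemma germ_surj x (v : loc_fiber x) : exists s, v = germ x s.
Proof. exact: sn_class_surj. Qed.

Lemma germ_act x f s : germ x (act f s) = (f x : K) *: germ x s.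
Proof.
rewrite -(linear_funZ (@germ_linear x)).
by apply/sn_class_eq; exact: loc_norm_act.
Qed.

End localization.

(** * The bundle of a Banach module *)

Section localization_bundle.
Context (R : realType) (k : scalar_kind) (X : topologicalType).
Local Notation K := (scalar_field R k).
Context (V : normedModType K) (act : C0 R k X -> V -> V).
Context (bm : is_banach_module act).
Context (hausX : hausdorff_space X) (lcX : locally_compact [set: X]).
Local Notation loc_norm := (@loc_norm R k X V act).
Local Notation loc_fiber := (loc_fiber bm hausX lcX).
Local Notation germ := (@germ R k X V act bm hausX lcX).

Record loc_total := LocPoint { loc_base : X ; loc_val : loc_fiber loc_base }.

Definition loc_point x (s : V) : loc_total := LocPoint (germ x s).

Lemma loc_point_surj (z : loc_total) : exists x s, z = loc_point x s.
Proof. by case: z => x v; have [s ->] := germ_surj v; exists x, s. Qed.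

Lemma LocPoint_inj x : injective (@LocPoint x).
Proof.
(* Two values over the same base point are compared by transport along an
   equality of base points, which is trivial by proof irrelevance. *)
move=> v w vw; have h z : LocPoint v = z -> forall q : x = loc_base z,
    eq_rect x loc_fiber v (loc_base z) q = loc_val z.
  by move=> <- q /=; rewrite (Prop_irrelevance q erefl).
exact: (h _ vw erefl).
Qed.

Lemma loc_point_eq x s t : loc_point x s = loc_point x t <->
  loc_norm x (s - t) = 0.
Proof.
split=> [/LocPoint_inj /sn_class_eq//|st]; congr LocPoint.
exact/sn_class_eq.
Qed.

Lemma loc_norm_tri x s t u :
  loc_norm x (s - u) <= loc_norm x (s - t) + loc_norm x (t - u).
Proof. by rewrite -(subrKA t) loc_normD. Qed.

Lemma loc_norm0 x : loc_norm x 0 = 0.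
Proof. exact: (sn0 (loc_seminorm bm hausX lcX x)). Qed.

(** The topology generated by the tubes around the sections [germ ^~ s]. It is
    described by representatives in [V], because vectors over different base
    points cannot be subtracted. *)
Definition loc_open (W : set loc_total) : Prop := forall x s, W (loc_point x s) ->
  exists2 e : K, 0 < e & \forall y \near x, forall t : V,
    loc_norm y (t - s) < e -> W (loc_point y t).

Lemma loc_openT : loc_open setT.
Proof. by move=> x s _; exists 1 => //; exact: nearW. Qed.

Lemma loc_openI : setI_closed loc_open.
Proof.
move=> A B oA oB x s [/oA[a a0 ha] /oB[b b0 hb]].
have [c [c0 ca cb]] := exists_le2 a0 b0; exists c => //.
apply: filterS2 ha hb => y ha hb t tc.
by split; [apply: ha|apply: hb]; exact: lt_le_trans tc _.
Qed.

Lemma loc_open_bigU (I : Type) (f : I -> set loc_total) :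
  (forall i, loc_open (f i)) -> loc_open (\bigcup_i f i).
Proof.
move=> of_ x s [i _ /of_[e e0 h]]; exists e => //.
by apply: filterS h => y h t /h ft; exists i.
Qed.

HB.instance Definition _ := gen_eqMixin loc_total.
HB.instance Definition _ := gen_choiceMixin loc_total.
HB.instance Definition _ :=
  isOpenTopological.Build loc_total loc_openT loc_openI loc_open_bigU.

Lemma germ_dist x s t : `|germ x s - germ x t| = loc_norm x (s - t).
Proof.
by rewrite -(linear_funB (@germ_linear _ _ _ _ _ bm hausX lcX x)) germ_norm.
Qed.

Definition tube (P : set X) (s : V) (e : K) : set loc_total :=
  [set z | P (loc_base z) /\ `|loc_val z - germ (loc_base z) s| < e].

Lemma tubeE (P : set X) (s : V) (e : K) y t :
  tube P s e (loc_point y t) = (P y /\ loc_norm y (t - s) < e).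
Proof. by rewrite /tube /= germ_dist. Qed.

Lemma loc_nbhsP x s (W : set loc_total) : nbhs (loc_point x s) W <->
  exists2 e : K, 0 < e & \forall y \near x, forall t : V,
    loc_norm y (t - s) < e -> W (loc_point y t).
Proof.
split=> [[B [oB Bx BW]]|[e e0 hQ]].
  have [e e0 h] := oB _ _ Bx; exists e => //.
  by apply: filterS h => y h t /h /BW.
pose Q : set X := fun y => forall t : V,
  loc_norm y (t - s) < e -> W (loc_point y t).
exists (tube Q^° s e); split.
- move=> y t; rewrite tubeE => -[Qy ts].
  pose d := (e - loc_norm y (t - s)) / 2.
  have d0 : 0 < d by rewrite divr_gt0 ?subr_gt0.
  exists d => //.
  have tsd : loc_norm y (t - s) < loc_norm y (t - s) + d by rewrite ltrDl.
  have tsn := loc_norm_near hausX lcX tsd.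
  apply: filterS2 (nbhs_interior Qy) tsn => z Qz zts t' t't.
  rewrite tubeE; split => //; rewrite (le_lt_trans (loc_norm_tri _ _ t _))//.
  have -> : e = d + (loc_norm y (t - s) + d).
    by rewrite addrCA -splitr addrC subrK.
  exact: ltrD.
- by rewrite tubeE subrr loc_norm0.
- move=> z; have [y [t ->]] := loc_point_surj z.
  by rewrite tubeE => -[/interior_subset Qy]; exact: Qy.
Qed.

Lemma loc_nbhs_tube x s (P : set X) (e : K) : nbhs x P -> 0 < e ->
  nbhs (loc_point x s) (tube P s e).
Proof.
move=> xP e0; apply/loc_nbhsP; exists e => //.
by apply: filterS xP => y Py t ts; rewrite tubeE.
Qed.

Lemma loc_base_nbhs x s (P : set X) :
  nbhs (loc_point x s) (@loc_base @^-1` P) <-> nbhs x P.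
Proof.
split=> [/loc_nbhsP[e e0]|xP].
  by apply: filterS => y /(_ s); rewrite subrr loc_norm0; apply.
by apply: filterS (loc_nbhs_tube s xP ltr01) => z [].
Qed.

Lemma LocPoint_bij x :
  set_bij [set: loc_fiber x] (@loc_base @^-1` [set x]) (@LocPoint x).
Proof.
split; first by [].
  by move=> v w _ _; exact: LocPoint_inj.
by move=> [y v] /= <-; exists v.
Qed.

Definition loc_space : fibered_space K X := FiberedSpace LocPoint_bij.

Lemma loc_fadd x s t : @fadd _ _ loc_space (loc_point x s, loc_point x t) =
  loc_point x (s + t).
Proof.
rewrite /fadd /= !(@pointK _ _ loc_space x (germ x _)) /= /loc_point.
by rewrite (linear_funD (@germ_linear _ _ _ _ _ bm hausX lcX x)).
Qed.

Lemma loc_fscale x a s : @fscale _ _ loc_space (a, loc_point x s) =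
  loc_point x (a *: s).
Proof.
rewrite /fscale /= !(@pointK _ _ loc_space x (germ x _)) /= /loc_point.
by rewrite (linear_funZ (@germ_linear _ _ _ _ _ bm hausX lcX x)).
Qed.

Lemma loc_fnorm x s : @fnorm _ _ loc_space (loc_point x s) = loc_norm x s.
Proof.
by rewrite -[LHS]/(@fnorm _ _ loc_space (point loc_space (germ x s)))
  fnorm_point germ_norm.
Qed.

Lemma loc_proj_continuous : continuous (@proj _ _ loc_space).
Proof.
move=> z P; have [x [s ->]] := loc_point_surj z => xP.
exact: (loc_base_nbhs x s P).2 xP.
Qed.

Lemma loc_proj_open (U : set (total loc_space)) :
  open U -> open (@proj _ _ loc_space @` U).
Proof.
rewrite !openE => oU x [z + <-]; have [y [s ->]] := loc_point_surj z.
move=> /oU /loc_nbhsP[e e0] /=; apply: filterS => y' /(_ s) h.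
exists (loc_point y' s) => //; apply: h.
by rewrite subrr loc_norm0.
Qed.

Lemma loc_proj_surj : set_surj setT setT (@proj _ _ loc_space).
Proof. by move=> x _; exists (loc_point x 0). Qed.

Lemma loc_fadd_continuous : {within [set ee : total loc_space * total loc_space |
  proj ee.1 = proj ee.2], continuous (@fadd _ _ loc_space)}.
Proof.
apply/subspace_continuousP => -[z z'] /=.
have [x [s ->]] := loc_point_surj z; have [x' [t ->]] := loc_point_surj z'.
move=> /= xx'; rewrite -{x'}xx' /from_subspace loc_fadd => W /loc_nbhsP[e e0 h].
have e20 : 0 < e / 2 by rewrite divr_gt0.
pose Q : set X := fun y => forall u : V,
  loc_norm y (u - (s + t)) < e -> W (loc_point y u).
exists (tube Q s (e / 2), tube Q t (e / 2)).
  by split; exact: loc_nbhs_tube.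
move=> [z1 z2]; have [y [s' ->]] := loc_point_surj z1.
have [y' [t' ->]] := loc_point_surj z2 => -[t1 t2] yy'.
have [hy ss] : Q y /\ loc_norm y (s' - s) < e / 2 by move: t1; rewrite /= tubeE.
have [_ tt] : Q y' /\ loc_norm y' (t' - t) < e / 2.
  by move: t2; rewrite /= tubeE.
suff : W (@fadd _ _ loc_space (loc_point y s', loc_point y' t')) by [].
have {}yy' : y = y' := yy'; rewrite -{y' t1 t2}yy' in tt *.
rewrite loc_fadd; apply: hy.
rewrite opprD addrACA (le_lt_trans (loc_normD bm hausX lcX _ _ _))//.
by rewrite [e]splitr ltrD.
Qed.

Lemma loc_fscale_continuous : continuous (@fscale _ _ loc_space).
Proof.
move=> [a z]; have [x [s ->]] := loc_point_surj z.
move=> W hW; have {hW} : nbhs (loc_point x (a *: s)) W by rewrite -loc_fscale.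
move=> /loc_nbhsP[e e0 h].
have a1 : 0 < `|a| + 1 by rewrite ltr_wpDl.
have s1 : 0 < `|s| + 1 by rewrite ltr_wpDl.
have e1 : 0 < e / 2 / (`|a| + 1) by rewrite !divr_gt0.
have e2 : 0 < e / 2 / (`|s| + 1) by rewrite !divr_gt0.
have [d [d0 d1 de]] := exists_le2 ltr01 e2.
pose Q : set X := fun y => forall u : V,
  loc_norm y (u - a *: s) < e -> W (loc_point y u).
exists (ball a d, tube Q s (e / 2 / (`|a| + 1))).
  by split; [exact: nbhsx_ballx|exact: loc_nbhs_tube].
move=> [b w]; have [y [t ->]] := loc_point_surj w => -[ab t1].
have [hy ts] : Q y /\ loc_norm y (t - s) < e / 2 / (`|a| + 1).
  by move: t1; rewrite /= tubeE.
suff : W (@fscale _ _ loc_space (b, loc_point y t)) by [].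
move: ab; rewrite loc_fscale -ball_normE => /= ab; apply: hy.
have -> : b *: t - a *: s = b *: (t - s) + (b - a) *: s.
  by rewrite scalerBr scalerBl addrA subrK.
rewrite (le_lt_trans (loc_normD bm hausX lcX _ _ _))// !(loc_normZ bm hausX lcX).
have ba : `|b| <= `|a| + 1.
  rewrite -(subrK a b) (le_trans (ler_normD _ _))// addrC lerD2l distrC.
  exact: le_trans (ltW ab) d1.
rewrite [e]splitr ltr_leD//.
  apply: (@le_lt_trans _ _ ((`|a| + 1) * loc_norm y (t - s))).
    by rewrite ler_wpM2r// loc_norm_ge0.
  by rewrite mulrC -ltr_pdivlMr.
have sn := loc_norm_norm bm hausX lcX y s.
apply: (@le_trans _ _ (e / 2 / (`|s| + 1) * `|s|)).
  rewrite ler_pM ?loc_norm_ge0// distrC.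
  exact: le_trans (ltW ab) de.
by rewrite mulrAC ler_pdivrMr// ler_pM2l ?divr_gt0// lerDl.
Qed.

Lemma loc_fnorm_usc (r : K) : open [set e : total loc_space | fnorm e < r].
Proof.
rewrite openE => z; have [x [s ->]] := loc_point_surj z.
rewrite /= loc_fnorm => sr; apply/loc_nbhsP.
pose d := (r - loc_norm x s) / 2; have d0 : 0 < d by rewrite divr_gt0 ?subr_gt0.
exists d => //; have sd : loc_norm x s < loc_norm x s + d by rewrite ltrDl.
apply: filterS (loc_norm_near hausX lcX sd) => y ys t ts.
rewrite /= loc_fnorm -(subrK s t).
rewrite (le_lt_trans (loc_normD bm hausX lcX _ _ _))//.
have -> : r = d + (loc_norm x s + d) by rewrite addrCA -splitr addrC subrK.
exact: ltrD.
Qed.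

Lemma loc_zero_nbhs x (W : set (total loc_space)) : open W ->
  W (point loc_space (0 : fiber loc_space x)) ->
  exists2 e : K, 0 < e & exists U : set X, [/\ open U, U x &
    [set v : total loc_space | U (proj v) /\ fnorm v <= e] `<=` W].
Proof.
move=> oW; have -> : point loc_space (0 : fiber loc_space x) = loc_point x 0.
  by rewrite /loc_point (linear_fun0 (@germ_linear _ _ _ _ _ bm hausX lcX x)).
move: oW; rewrite openE => oW /oW /loc_nbhsP[e e0 h].
pose Q : set X := fun y => forall t : V,
  loc_norm y (t - 0) < e -> W (loc_point y t).
exists (e / 2); first by rewrite divr_gt0.
exists Q^°; split => //; first exact: open_interior.
move=> z; have [y [t ->]] := loc_point_surj z.
rewrite /= loc_fnorm => -[/interior_subset Qy te]; apply: Qy.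
by rewrite subr0 (le_lt_trans te)// ltr_pdivrMr// ltr_pMr// ltr1n.
Qed.

Definition loc_bundle : banach_bundle K X :=
  BanachBundle loc_proj_continuous loc_proj_open loc_proj_surj
    loc_fadd_continuous loc_fscale_continuous loc_fnorm_usc loc_zero_nbhs.

Lemma germ_continuous (s : V) : continuous (fun x => loc_point x s).
Proof.
move=> x W /loc_nbhsP[e e0 h].
suff : \forall y \near x, W (loc_point y s) by [].
by apply: filterS h => y; apply; rewrite subrr loc_norm0.
Qed.

End localization_bundle.

(** * AM-modules are spaces of sections *)

Section germ_isometry.
Context (R : realType) (k : scalar_kind) (X : topologicalType).
Local Notation K := (scalar_field R k).
Context (V : normedModType K) (act : C0 R k X -> V -> V).
Context (am : is_AM_module act).
Context (hausX : hausdorff_space X) (lcX : locally_compact [set: X]).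
Local Notation loc_norm := (@loc_norm R k X V act).

Local Notation bm := (proj1 am).

Lemma act_bump_norm_le U (h : C0 R k X) s : is_bump U h -> `|act h s| <= `|s|.
Proof.
move=> hb; rewrite -[leRHS]mul1r; apply: (act_norm_le bm) => // y.
by rewrite (ger0_norm (bump_ge0 _ hb)) (bump_le1 _ hb).
Qed.

Lemma act_cup (h H : C0 R k X) s :
  s - act (cup h H) s = (s - act H s) - act h (s - act H s).
Proof.
rewrite /cup (linear_funB (act_linearl bm s)) (linear_funD (act_linearl bm s)).
by rewrite (actM bm) (linear_funB (act_linear bm h)) -[X in s - X]addrA opprD addrA.
Qed.

(** By nondegeneracy it suffices to treat [act f t], where [f] is small off a
    compact set. Two bumps are merged by [cup h H], since [1 - cup h H] is the
    product of [1 - h] and [1 - H]. *)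
Lemma approximate_unit s (e : K) : 0 < e ->
  exists2 h, is_bump setT h & `|s - act h s| <= e.
Proof.
pose D t := forall e : K, 0 < e -> exists2 h, is_bump setT h & `|t - act h t| <= e.
suff Ds : D s by exact: Ds.
have Dact f t : D (act f t).
  move=> {}e e0; have t1 : 0 < `|t| + 1 by rewrite ltr_wpDl.
  have d0 : 0 < e / (`|t| + 1) by rewrite divr_gt0.
  have [_ /(_ _ d0)[L [cL fL]]] := sec_mem f.
  have [h hb h1] := bump_compact R k hausX lcX cL; exists h => //.
  rewrite -(actM bm) -(linear_funB (act_linearl bm t)).
  apply: (@le_trans _ _ (e / (`|t| + 1) * `|t|)); last first.
    by rewrite mulrAC ler_pdivrMr// ler_pM2l// lerDl.
  apply: (act_norm_le bm) => [|y]; first exact: ltW.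
  have -> : (f - C0_mul h f) y = (1 - (h y : K)) * f y by rewrite mulrBl mul1r.
  have [Ly|Ly] := pselect (L y); first by rewrite h1// subrr mul0r normr0 ltW.
  rewrite normrM (ger0_norm (bump_onem_ge0 _ hb)) -[leRHS]mul1r.
  by rewrite ler_pM ?(bump_onem_ge0 _ hb) ?fL// gerBl (bump_ge0 _ hb).
have D0 : D 0.
  move=> {}e e0; exists 0; first exact: is_bump0.
  by rewrite (linear_fun0 (act_linear bm 0)) subrr normr0 ltW.
have DZ a t : D t -> D (a *: t).
  move=> Dt {}e e0; have a1 : 0 < `|a| + 1 by rewrite ltr_wpDl.
  have [h hb ht] := Dt _ (divr_gt0 e0 a1); exists h => //.
  rewrite (linear_funZ (act_linear bm h)) -scalerBr normrZ.
  apply: (le_trans (ler_wpM2l (normr_ge0 a) ht)).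
  by rewrite mulrA ler_pdivrMr// mulrC ler_pM2l// lerDl.
have Dcup t h H U U' (d : K) : is_bump U h -> is_bump U' H ->
    `|t - act H t| <= d -> `|t - act (cup h H) t| <= 2 * d.
  move=> hb Hb tH; rewrite act_cup (le_trans (ler_normB _ _))//.
  rewrite mulr_natl mulr2n lerD// (le_trans _ tH)//.
  exact: act_bump_norm_le hb.
have cupC (h H : C0 R k X) : cup h H = cup H h.
  by apply: sections_ext => y /=; rewrite [(H y : K) + _]addrC [(h y : K) * _]mulrC.
have DD t u : D t -> D u -> D (t + u).
  move=> Dt Du {}e e0; have e40 : 0 < e / 2 / 2 by rewrite !divr_gt0.
  have [h hb ht] := Dt _ e40; have [H Hb Hu] := Du _ e40.
  exists (cup h H).
    by rewrite -(setUT setT); exact: is_bump_cup.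
  rewrite (linear_funD (act_linear bm _)) opprD addrACA [leRHS]splitr.
  have e2 : e / 2 = 2 * (e / 2 / 2) by rewrite [RHS]mulrC divfK// pnatr_eq0.
  rewrite e2 (le_trans (ler_normD _ _))// lerD//.
    by rewrite cupC; exact: Dcup Hb hb ht.
  exact: Dcup hb Hb Hu.
have Dsum n (u : 'I_n -> V) : (forall i, D (u i)) -> D (\sum_(i < n) u i).
  by move=> Du; elim/big_ind: _.
move=> {}e e0; have e40 : 0 < e / 2 / 2 by rewrite !divr_gt0.
have [_ _ _ _ nd] := bm.
have /closure_normP/(_ _ e40)[_ [n [a [f [u ->]]]] su] : closure
    [set t | exists n (a : 'I_n -> K) (f : 'I_n -> C0 R k X) (s : 'I_n -> V),
      t = \sum_(i < n) a i *: act (f i) (s i)] s by rewrite nd.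
set t := \sum_(i < n) _ in su.
have [|h hb ht] := Dsum n (fun i => a i *: act (f i) (u i)) _ _ e40.
  by move=> i; apply: DZ.
exists h => //.
have -> : s - act h s = (s - t) + (t - act h t) - act h (s - t).
  by rewrite (linear_funB (act_linear bm h)) addrA subrK opprB addrA subrK.
have e4 : e = (e / 2 / 2 + e / 2 / 2) + (e / 2 / 2 + e / 2 / 2).
  by rewrite -!splitr.
rewrite (le_trans (ler_normB _ _))// e4 lerD//.
  by rewrite (le_trans (ler_normD _ _))// lerD.
by rewrite (le_trans (act_bump_norm_le _ hb))// (le_trans su)// lerDl ltW.
Qed.

(** The AM property turns the local bounds of the norm, valid after
    cutting off around each point, into a global one: the maximum of finitely
    many cutoffs dominates any bump supported in the compact set they cover. *)
Lemma AM_norm_local s (r : K) : 0 <= r -> (forall x, loc_norm x s <= r) ->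
  `|s| <= r.
Proof.
move=> r0 sr; apply: ler_forall_gt0 => [|| e e0]; rewrite ?ger0_real//.
have e20 : 0 < e / 2 by rewrite divr_gt0.
have [h0 [h01 [L [cL _ _ h0L]]] sh0] := approximate_unit s e20.
pose P (H : C0 R k X) := exists m, [/\ C0_nonneg m, forall y, (H y : K) <= m y &
  `|act m s| <= r + e / 2].
have r1 : r < r + e / 2 by rewrite ltrDl.
have r2 : 0 <= r + e / 2 by rewrite addr_ge0// ltW.
have [| |H [Hb [m [m0 Hm ms]] H1]] := @compact_bump_ind _ _ _ hausX lcX L P cL.
- exists 0; split => //.
  have -> : act 0 s = 0 := linear_fun0 (act_linearl bm s).
  by rewrite normr0.
- move=> x _.
  have [f fx fs] := loc_norm_lt hausX lcX (le_lt_trans (sr x) r1).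
  exists [set y | f y = 1]; first by have [] := fx.
  move=> h H hb Hb [m [m0 Hm ms]].
  have f0 : C0_nonneg f by move=> y; have [/(_ y)/andP[]] := fx.
  exists (C0_max m f); split; first exact: C0_max_ge0.
    move=> y; have [fy|fy] := pselect ((f y : K) = 1).
      apply: le_trans (C0_max_ger y m0 f0); rewrite fy.
      apply: (@bump_le1 _ _ _ (setT `|` setT)).
      exact: is_bump_cup (is_bumpS _ hb) Hb.
    rewrite cupE (bump_off hb fy) subr0 mul1r addr0.
    exact: le_trans (Hm y) (C0_max_gel y m0 f0).
  apply: (AM_norm_max bm) => //; [by have [] := am|exact: ltW].
have h0m : `|act h0 s| <= r + e / 2.
  apply: le_trans ms; apply: (act_dominated bm) => y; first by rewrite ger0_real ?m0.
  have /andP[h00 h0l] := h01 y.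
  rewrite (ger0_norm h00) (ger0_norm (m0 y)).
  have [Ly|Ly] := pselect (L y); last by rewrite h0L// m0.
  by rewrite (le_trans h0l)// -(H1 y Ly).
rewrite -(subrK (act h0 s) s) (le_trans (ler_normD _ _))//.
by rewrite [e]splitr addrCA lerD// addrC.
Qed.

Local Notation E := (loc_bundle bm hausX lcX).

Lemma germ_section_mem (s : V) :
  Gamma0_mem (fun x => germ bm hausX lcX x s : fiber E x).
Proof.
split; first exact: germ_continuous.
move=> e e0; have [h [_ [L [cL _ _ hL]]] sh] := approximate_unit s e0.
exists L; split => // x Lx; rewrite germ_norm.
have := loc_norm_act bm hausX lcX x h s; rewrite hL// scale0r subr0 => hs0.
rewrite -(subrK (act h s) s) (le_trans (loc_normD bm hausX lcX _ _ _))//.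
by rewrite hs0 addr0 (le_trans (loc_norm_norm bm hausX lcX _ _)).
Qed.

Definition germ_section (s : V) : Gamma0 E :=
  MkSection (P := Gamma0_submodule E) (germ_section_mem s).

Lemma germ_section_linear : linear germ_section.
Proof.
move=> a s t; apply: sections_ext => x /=.
exact: (@germ_linear _ _ _ _ _ bm hausX lcX x).
Qed.

Lemma germ_section_norm s : `|germ_section s| = `|s|.
Proof.
apply/eqP; rewrite eq_le; apply/andP; split.
  apply: Gamma0_norm_le => // x.
  by rewrite /= germ_norm; exact: (loc_norm_norm bm).
apply: AM_norm_local => // x; rewrite -(germ_norm bm hausX lcX).
exact: (Gamma0_norm_ge (germ_section s)).
Qed.

(** Near each point [sigma] is close to the section of an element of [V] with the
    same value there; these elements are glued with bumps. *)
Lemma germ_section_dense (sigma : Gamma0 E) (e : K) : 0 < e ->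
  exists s, `|sigma - germ_section s| <= e.
Proof.
move=> e0; have [_ /(_ e e0)[L [cL sL]]] := sec_mem sigma.
pose P (H : C0 R k X) := exists s, forall y,
  `|(H y : K) *: sigma y - germ_section s y| <= H y * e.
have [| |H [Hb [s hs] H1]] := @compact_bump_ind _ _ _ hausX lcX L P cL.
- exists 0 => y; rewrite scale0r (linear_fun0 germ_section_linear) subrr.
  by rewrite normr0 mul0r.
- move=> x _; have [t xt] := germ_surj (sigma x).
  have : `|(sigma - germ_section t) x| < e by rewrite /= xt subrr normr0.
  move=> /section_norm_near U.
  exists [set y | `|(sigma - germ_section t) y| < e] => //.
  move=> h H hb Hb [s hs]; exists (s - act h s + act h t) => y.
  have -> : germ_section (s - act h s + act h t) y =
      (1 - (h y : K)) *: germ_section s y + (h y : K) *: germ_section t y.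
    have gl := @germ_linear _ _ _ _ _ bm hausX lcX y.
    by rewrite /= (linear_funD gl) (linear_funB gl) !germ_act scalerBl scale1r.
  rewrite cupE [_ * e]mulrDl [(_ + _) *: sigma y]scalerDl -scalerA opprD addrACA.
  rewrite -!scalerBr (le_trans (ler_normD _ _))// -mulrA !normrZ.
  rewrite (ger0_norm (bump_onem_ge0 _ hb)) (ger0_norm (bump_ge0 _ hb)).
  apply: lerD; first by apply: ler_wpM2l (bump_onem_ge0 _ hb) _ _ (hs y).
  have [Uy|Uy] := pselect (`|(sigma - germ_section t) y| < e).
    by apply: ler_wpM2l (bump_ge0 _ hb) _ _ (ltW Uy).
  by rewrite (bump_off hb Uy) !mul0r.
- exists s; apply: Gamma0_norm_le => [|y]; first exact: ltW.
  have -> : (sigma - germ_section s) y =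
      (1 - (H y : K)) *: sigma y + ((H y : K) *: sigma y - germ_section s y).
    by rewrite scalerBl scale1r addrA subrK.
  rewrite (le_trans (ler_normD _ _))//.
  have -> : e = (1 - (H y : K)) * e + H y * e by rewrite mulrBl mul1r subrK.
  rewrite lerD// normrZ (ger0_norm (bump_onem_ge0 _ Hb)).
  have [Ly|Ly] := pselect (L y); first by rewrite H1// subrr !mul0r.
  by apply: ler_wpM2l (bump_onem_ge0 _ Hb) _ _ (sL y Ly).
Qed.

(** An isometry between complete spaces with dense range. *)
Lemma germ_section_bij : bijective germ_section.
Proof.
have small (v : Gamma0 E) : (forall n, `|v| <= 4 / 2 ^+ n) -> v = 0.
  move=> hv; apply/eqP; rewrite -normr_le0; apply: ler_forall_gt0 => // e e0.
  have [n ne] := half_pow_small (ler0n K 4) e0.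
  by rewrite add0r (le_trans (hv n))// ltW.
have inv sigma : {s | germ_section s = sigma}.
  apply: cid.
  have /choice[u hu] : forall n, exists s, `|sigma - germ_section s| <= 1 / 2 ^+ n.
    by move=> n; apply: germ_section_dense; rewrite divr_gt0 ?exprn_gt0.
  have uS n : `|u n.+1 - u n| <= 2 / 2 ^+ n.
    rewrite -germ_section_norm (linear_funB germ_section_linear) -(subrKA sigma).
    rewrite (le_trans (ler_normD _ _))// [X in _ <= X / _](natrD _ 1 1) mulrDl.
    rewrite lerD//.
    rewrite distrC (le_trans (hu n.+1))// !mul1r lef_pV2 ?posrE ?exprn_gt0//.
    by rewrite ler_weXn2l ?ler1n.
  have cV : complete_space V by have [] := bm.
  have [l hl] := geometric_cvg cV (ler0n K 2) uS.
  exists l; apply/eqP; rewrite -subr_eq0; apply/eqP/small => n.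
  have p2 : 0 < 2 ^+ n.+1 :> K by rewrite exprn_gt0.
  rewrite -(subrKA (germ_section (u n.+1))) -(linear_funB germ_section_linear).
  rewrite (le_trans (ler_normD _ _))// germ_section_norm [X in _ + X]distrC.
  apply: (le_trans (lerD (hl n.+1) (hu n.+1))).
  rewrite -mulrDl exprS invfM mulrA ler_pM2r ?invr_gt0 ?exprn_gt0//.
  by rewrite ler_pdivrMr// -!natrM natr1 ler_nat.
exists (fun sigma => sval (inv sigma)) => [s|sigma].
  have := svalP (inv (germ_section s)); set t := sval _ => ts.
  apply/eqP; rewrite -subr_eq0 -normr_eq0 -germ_section_norm.
  by rewrite (linear_funB germ_section_linear) ts subrr normr0.
exact: svalP (inv sigma).
Qed.

End germ_isometry.

(** * Dynamics on the bundle and the equivalence *)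

Section localization_dynamics.
Context (R : realType) (k : scalar_kind).
Local Notation K := (scalar_field R k).
Context (G : topologicalGroupType) (S : closed_submonoid G).
Context (X : topologicalType) (phi : dynamical_system G X).
Context (lcG : locally_compact [set: G]).
Context (hausX : hausdorff_space X) (lcX : locally_compact [set: X]).
Context (M : dynamical_AM_module R k S phi).
Local Notation V := (mcarrier M).
Local Notation act := (@mact _ _ _ _ _ M).
Local Notation rep := (@mrep _ _ _ _ _ M).
Local Notation loc_norm := (@loc_norm R k X V act).

Lemma dynamical_AM : is_AM_module act.
Proof. by have [] := am_moduleP M. Qed.

Local Notation am := dynamical_AM.
Local Notation bm := (proj1 am).
Local Notation E := (loc_bundle bm hausX lcX).
Local Notation loc_point := (loc_point bm hausX lcX).

Lemma rep_linear g : linear (rep g).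
Proof. by have [_ /(_ g)[]] := am_moduleP M. Qed.

Lemma rep_bounded g : exists2 N : K, 0 <= N & forall s, `|rep g s| <= N * `|s|.
Proof.
have [_ /(_ g)[_ [N hN]] _ _ _] := am_moduleP M.
by exists `|N| => // s; exact: le_mul_norm (hN s).
Qed.

(** The Koopman operator of [g] maps peaks at [x] to peaks at [phi g x]. *)
Lemma loc_norm_rep (g : S) (N : K) x s : 0 <= N ->
  (forall s, `|rep g s| <= N * `|s|) ->
  loc_norm (phi (\val g) x) (rep g s) <= N * loc_norm x s.
Proof.
move=> N0 hN; apply: (loc_norm_leP hausX lcX) => [|e e0].
  by rewrite ger0_real// mulr_ge0// (loc_norm_ge0 act hausX lcX).
have N1 : 0 < N + 1 by rewrite ltr_wpDl.
have [|f [f01 f1] fs] := @loc_norm_lt _ _ _ _ act hausX lcX x s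
    (loc_norm x s + e / (N + 1)).
  by rewrite ltrDl divr_gt0.
exists (koopman_C0 phi (\val g) f).
  split=> [y|]; first exact: f01.
  have {}f1 : nbhs (phi (\val g)^-1%g (phi (\val g) x)) [set y | f y = 1].
    by rewrite flowK.
  exact: (@flow_cont _ _ phi (\val g)^-1%g (phi (\val g) x) _ f1).
have [_ _ _ <- _] := am_moduleP M.
apply: (le_trans (hN _)); apply: (le_trans (ler_wpM2l N0 (ltW fs))).
by rewrite mulrDr lerD2l mulrA ler_pdivrMr// mulrC ler_pM2l// lerDl.
Qed.

Definition loc_rep (z : total E) : V := repr (loc_val z).

Lemma loc_repK (z : total E) : loc_point (loc_base z) (loc_rep z) = z.
Proof.
by case: z => x v; rewrite /loc_point /germ /loc_rep /= sn_classK.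
Qed.

Definition loc_act (g : S) (z : total E) : total E :=
  loc_point (phi (\val g) (loc_base z)) (rep g (loc_rep z)).

Lemma loc_actE g x s :
  loc_act g (loc_point x s) = loc_point (phi (\val g) x) (rep g s).
Proof.
have [N N0 hN] := rep_bounded g.
rewrite /loc_act; set z := loc_point x s.
apply/loc_point_eq; rewrite -(linear_funB (rep_linear g)).
apply/eqP; rewrite eq_le (loc_norm_ge0 act hausX lcX) andbT.
apply: (le_trans (loc_norm_rep _ _ N0 hN)).
have /loc_point_eq -> : loc_point x (loc_rep z) = loc_point x s.
  exact: (loc_repK z).
by rewrite mulr0.
Qed.

Lemma loc_act1 : loc_act (sone S) = id.
Proof.
have [_ _ [r1 _] _ _] := am_moduleP M.
apply: funext => z; have [x [s ->]] := loc_point_surj z.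
by rewrite loc_actE r1 /= flow1.
Qed.

Lemma loc_actM g h : loc_act (smul g h) = loc_act g \o loc_act h.
Proof.
have [_ _ [_ rM] _ _] := am_moduleP M.
apply: funext => z; have [x [s ->]] := loc_point_surj z.
by rewrite /= !loc_actE rM /= flowM.
Qed.

(** Orbits of compact sets are bounded, so Banach-Steinhaus applies. *)
Lemma rep_bounded_compact (L : set S) : compact L ->
  exists2 N : K, 0 <= N & forall g, L g -> forall s, `|rep g s| <= N * `|s|.
Proof.
move=> cL; have [_ _ _ _ cont] := am_moduleP M.
have [||||N hN] := @uniform_boundedness R k V V S L (fun g => rep g).
- by have [] := bm.
- exact: rep_linear.
- by move=> g; have [N _ hN] := rep_bounded g; exists N.
- move=> s.
  have [n _ hn] : \forall n \near \oo, L `<=` (fun g => `|rep g s| < n%:R).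
    apply: ((compact_near_coveringP L).1 cL nat \oo
      (fun n g => `|rep g s| < n%:R)) => g _.
    have [n ng] := scalar_archi (addr_ge0 (normr_ge0 (rep g s)) ler01).
    exists ([set h : S | `|rep h s| < n%:R], [set m | (n <= m)%N]).
      split; last by exists n.
      have hs : \forall h \near g, `|rep g s - rep h s| < 1.
        exact: (@cvgr_dist_lt _ V _ (nbhs g) _ _ _ (cont s g) 1 ltr01).
      suff : \forall h \near g, `|rep h s| < n%:R by [].
      apply: filterS hs => h hg; apply: le_lt_trans ng.
      rewrite -(subrK (rep g s) (rep h s)) (le_trans (ler_normD _ _))// addrC.
      by rewrite lerD2l distrC ltW.
    by move=> [h m] [/= hs nm]; apply: (lt_le_trans hs); rewrite ler_nat.
  by exists n%:R => g Lg; apply/ltW/hn => //=.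
exists `|N| => // g Lg s; apply: le_mul_norm => //; exact: hN.
Qed.

Lemma loc_act_continuous :
  continuous (fun gz : S * total E => loc_act gz.1 gz.2).
Proof.
move=> [g0 z] W; have [x [s ->]] := loc_point_surj z.
move=> hW; have {hW} : nbhs (loc_point (phi (\val g0) x) (rep g0 s)) W.
  by rewrite -loc_actE.
move=> /loc_nbhsP[e e0 hW].
have [_ _ _ _ cont] := am_moduleP M.
have [C nC cC] := closed_submonoid_locally_compact lcG g0.
have [N N0 hN] := rep_bounded_compact cC.
have N1 : 0 < N + 1 by rewrite ltr_wpDl.
have e20 : 0 < e / 2 by rewrite divr_gt0.
pose Q : set X := fun y => forall t : V,
  loc_norm y (t - rep g0 s) < e -> W (loc_point y t).
have cflow : {for (\val g0, x), continuous (fun gx : G * X => phi gx.1 gx.2)}.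
  exact: flow_continuous.
have [[A B] /= [gA xB] AB] := cflow Q hW.
have gs : \forall g \near g0, `|rep g0 s - rep g s| < e / 2.
  exact: (@cvgr_dist_lt _ V _ (nbhs g0) _ _ _ (cont s g0) _ e20).
have gA' : nbhs g0 ((fun g : S => \val g) @^-1` A).
  exact: (val_submonoid_continuous gA).
exists ([set g | [/\ C g, A (\val g) & `|rep g0 s - rep g s| < e / 2]],
    @tube _ _ _ _ _ bm hausX lcX B s (e / 2 / (N + 1))).
  split; last by apply: loc_nbhs_tube => //; rewrite divr_gt0.
  by apply: filterS3 nC gA' gs => g ? ? ?; split.
move=> [g w]; have [y [t ->]] := loc_point_surj w => -[[Cg Ag gs1] t1].
have [By ts] : B y /\ loc_norm y (t - s) < e / 2 / (N + 1).
  by move: t1; rewrite /= tubeE.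
suff : W (loc_act g (loc_point y t)) by [].
rewrite loc_actE; apply: (AB (\val g, y) (conj Ag By)).
rewrite -(subrKA (rep g s)) (le_lt_trans (loc_normD bm hausX lcX _ _ _))//.
rewrite [e]splitr ltrD//; last first.
  by rewrite (le_lt_trans (loc_norm_norm bm hausX lcX _ _))// distrC.
rewrite -(linear_funB (rep_linear g)).
apply: (le_lt_trans (loc_norm_rep _ _ N0 (hN g Cg))).
apply: (@le_lt_trans _ _ ((N + 1) * loc_norm y (t - s))).
  by rewrite ler_wpM2r ?(loc_norm_ge0 act hausX lcX)// lerDl.
by rewrite mulrC -ltr_pdivlMr.
Qed.

Lemma loc_act_fiber (g : S) x s :
  @fiber_map _ _ E E (phi (\val g)) (loc_act g) x (germ bm hausX lcX x s) =
  germ bm hausX lcX (phi (\val g) x) (rep g s).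
Proof.
rewrite /fiber_map.
have -> : loc_act g (@point _ _ E x (germ bm hausX lcX x s)) =
    @point _ _ E _ (germ bm hausX lcX (phi (\val g) x) (rep g s)).
  exact: loc_actE.
by rewrite pointK.
Qed.

Lemma loc_act_bounded (g : S) (N : K) : 0 <= N ->
  (forall s, `|rep g s| <= N * `|s|) ->
  forall x (v : fiber E x),
    `|@fiber_map _ _ E E (phi (\val g)) (loc_act g) x v| <= N * `|v|.
Proof.
move=> N0 hN x v; have [s ->] := germ_surj v.
by rewrite loc_act_fiber !germ_norm; exact: loc_norm_rep.
Qed.

Lemma loc_act_morphism (g : S) :
  @is_bundle_morphism _ _ E E (phi (\val g)) (loc_act g).
Proof.
split.
- move=> z W hW.
  have cp : (fun z : total E => (g, z)) @ z --> ((g, z) : (S * total E)%type).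
    have c1 : (fun _ : total E => g) @ z --> g.
      move=> U /nbhs_singleton Ug; suff : \forall y \near z, U g by [].
      by apply: (@filterS _ _ (nbhs_filter z) setT) => //; exact: filterT.
    have c2 : (fun y : total E => y) @ z --> z by exact: cvg_id.
    exact: (cvg_pair c1 c2).
  exact: cp _ (@loc_act_continuous (g, z) W hW).
- by move=> z.
- move=> x a u v; have [s ->] := germ_surj u; have [t ->] := germ_surj v.
  rewrite -(@germ_linear _ _ _ _ _ bm hausX lcX x) !loc_act_fiber rep_linear.
  exact: germ_linear.
- have [N N0 hN] := rep_bounded g; exists N; exact: loc_act_bounded.
Qed.

Lemma loc_act_locally_bounded (L : set S) : compact L ->
  exists N : K, forall g, L g -> forall x (v : fiber E x),
    `|@fiber_map _ _ E E (phi (\val g)) (loc_act g) x v| <= N * `|v|.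
Proof.
move=> /rep_bounded_compact[N N0 hN]; exists N => g /hN; exact: loc_act_bounded.
Qed.

Definition loc_dynamical_bundle : dynamical_bundle R k S phi :=
  DynamicalBundle loc_act1 loc_actM loc_act_morphism loc_act_continuous
    loc_act_locally_bounded.

Let eta : V -> Gamma0_module loc_dynamical_bundle := germ_section am hausX lcX.

Lemma germ_section_hom : is_module_hom eta.
Proof.
split; first split.
- exact: (germ_section_linear am hausX lcX).
- by exists 1 => s; rewrite mul1r (germ_section_norm am hausX lcX).
- by move=> f s; apply: sections_ext => x; exact: germ_act.
- move=> g s; apply: sections_ext; apply: (@flow_ind _ _ phi (\val g)) => y.
  by rewrite /= koopman_funE; exact/esym/loc_act_fiber.
Qed.

Lemma germ_section_inv_hom (theta : Gamma0_module loc_dynamical_bundle -> V) :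
  cancel theta eta -> is_module_hom theta.
Proof.
move=> thetaK; have [[le _] ae ge] := germ_section_hom.
have [xi etaK _] := germ_section_bij am hausX lcX.
have inj : injective eta := can_inj etaK.
split; first split.
- by move=> a s t; apply: inj; rewrite le !thetaK.
- exists 1 => s; rewrite mul1r -[X in _ <= `|X|]thetaK.
  by rewrite -[leLHS](germ_section_norm am hausX lcX).
- by move=> f s; apply: inj; rewrite ae !thetaK.
- by move=> g s; apply: inj; rewrite ge !thetaK.
Qed.

End localization_dynamics.

Theorem theorem4p6 (R : realType) (k : scalar_kind)
    (G : topologicalGroupType) (S : closed_submonoid G)
    (X : topologicalType) (phi : dynamical_system G X)
    (hausG : hausdorff_space G) (lcG : locally_compact [set: G])
    (hausX : hausdorff_space X) (lcX : locally_compact [set: X]) :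
  exists (objP : forall E : dynamical_bundle R k S phi,
            is_dynamical_AM_module phi (Gamma0_module E))
         (homP : forall (E F : dynamical_bundle R k S phi)
            (Theta : bundle_hom E F), is_module_hom (Gamma0_map Theta)),
    essentially_surjective (section_functor objP homP) /\
    fully_faithful (section_functor objP homP).
Proof.
exists (fun E => Gamma0_dynamical_AM_module E lcG hausX lcX).
exists (fun E F Theta => Gamma0_map_module_hom Theta).
split; last exact: section_functor_fully_faithful.
move=> M; exists (loc_dynamical_bundle lcG hausX lcX M).
have [theta etaK thetaK] := germ_section_bij (dynamical_AM M) hausX lcX.
exists (ModuleHom (germ_section_inv_hom thetaK)).
exists (ModuleHom (germ_section_hom lcG hausX lcX M)).
by split; apply: module_hom_ext => s /=; [exact: thetaK|exact: etaK].
Qed.
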